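(* Let $G$ be a connected bridgeless bipartite graph (multiple edges allowed). Then $G$ does not have the $\{0,1\}$-property if and only if $G$ is an odd multi-cactus.
   Context: For a graph $G$ (possibly with multiple edges) and a set $S\subset\mathbb{Z}$, $G$ has the $S$-property if there is a map $w:E(G)\to S$ such that for every pair of adjacent vertices $u,v$ we have $\sum_{e\in E(u)}w(e)\neq\sum_{e\in E(v)}w(e)$, where $E(x)$ is the set of edges incident to $x$ (each parallel edge is weighted separately). An odd multi-cactus is defined as follows: take a collection of cycles of length $2 \pmod 4$, each with its edges coloured alternately red and green; form a connected simple graph by pasting these cycles together one by one in a tree-like fashion along green edges (identifying a green edge of the new cycle with a green edge of the graph built so far); finally replace every green edge by a multiple edge of any multiplicity ($\ge 1$). The graph consisting of one edge and two vertices is also called an odd multi-cactus.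
   Formalization: Two vertices joined by any number m ≥ 1 of parallel edges count as an odd multi-cactus, not only the single edge; otherwise two vertices joined by m ≥ 2 parallel edges (connected, bridgeless, bipartite, without the {0,1}-property) would be a counterexample. *)

(* Defs.v *)
From HB Require Import structures.
From mathcomp Require Import all_boot all_order all_algebra.

Set Implicit Arguments.
Unset Strict Implicit.
Unset Printing Implicit Defensive.

(* Finite loopless multigraphs; parallel edges are distinct elements of [edge]
   with the same set of ends. *)
Record multigraph := Multigraph {
  vert : finType;
  edge : finType;
  ends : edge -> {set vert};
  card_ends : forall e, #|ends e| = 2
}.

Section MultigraphTheory.

Variable G : multigraph.

(* Adjacency in the spanning subgraph of [G] with edge set [F]. *)
Definition adj_in (F : {set edge G}) : rel (vert G) :=
  [rel u v | [exists e in F, ends e == [set u; v]]].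

Definition adj : rel (vert G) := adj_in [set: edge G].

Definition connected_graph : Prop :=
  0 < #|vert G| /\ forall u v : vert G, connect adj u v.

(* Deleting a bridge increases the number of connected components. *)
Definition bridge (e : edge G) : bool :=
  n_comp adj (vert G) < n_comp (adj_in [set~ e]) (vert G).

Definition bridgeless : Prop := forall e : edge G, ~~ bridge e.

Definition bipartite : Prop :=
  exists A : {set vert G},
    forall u v : vert G, adj u v -> (u \in A) != (v \in A).

Definition weight_sum (w : edge G -> int) (x : vert G) : int :=
  (\sum_(e : edge G | x \in ends e) w e)%R.

Definition has_property (S : pred int) : Prop :=
  exists w : edge G -> int,
    (forall e, w e \in S) /\
    (forall u v : vert G, adj u v -> weight_sum w u <> weight_sum w v).

End MultigraphTheory.

Section Cactus.

Variable V : finType.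

(* A cycle is given by the duplicate-free sequence [c] of its vertices; its
   edge from [nth c i] to the cyclically next vertex is green for [i] even and
   red for [i] odd. *)
Definition cycle_edges (c : seq V) (b : bool) : {set {set V}} :=
  [set [set x; next c x] | x in c & odd (index x c) == b].

Definition cycle_green (c : seq V) := cycle_edges c false.
Definition cycle_red (c : seq V) := cycle_edges c true.

(* Length 2 is excluded because the pasted graph is required to be simple. *)
Definition cycle_2mod4 (c : seq V) : bool :=
  [&& uniq c, size c %% 4 == 2 & 2 < size c].

(* [pasted W R Gr]: the simple graph with vertex set [W], red edges [R] and
   green edges [Gr] arises by pasting cycles along green edges. The new cycle
   meets the graph built so far exactly in the two ends of the green edge that
   is identified. *)
Inductive pasted : {set V} -> {set {set V}} -> {set {set V}} -> Prop :=
| Pasted_cycle (c : seq V) :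
    cycle_2mod4 c ->
    pasted [set x in c] (cycle_red c) (cycle_green c)
| Pasted_step (W : {set V}) (R Gr : {set {set V}}) (c : seq V) (x y : V) :
    pasted W R Gr ->
    cycle_2mod4 c ->
    [set x; y] \in Gr ->
    [set x; y] \in cycle_green c ->
    W :&: [set z in c] = [set x; y] ->
    pasted (W :|: [set z in c]) (R :|: cycle_red c) (Gr :|: cycle_green c).

End Cactus.

Definition multiplicity (G : multigraph) (p : {set vert G}) : nat :=
  #|[set e : edge G | ends e == p]|.

(* [G] is obtained from the simple graph with red edges [R] and green edges
   [Gr] by replacing green edges by multiple edges. *)
Definition green_thickening (G : multigraph) (R Gr : {set {set vert G}}) : Prop :=
  [/\ forall e : edge G, ends e \in R :|: Gr,
      forall p, p \in R -> multiplicity p = 1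
    & forall p, p \in Gr -> 1 <= multiplicity p].

(* In the degenerate case of a single edge on two vertices, the edge counts as
   green, so it may also be replaced by a multiple edge: a bundle of m >= 2
   parallel edges is connected, bridgeless and bipartite, and its two vertices
   always have equal sums. *)
Definition odd_multi_cactus (G : multigraph) : Prop :=
  (exists R Gr : {set {set vert G}},
     pasted [set: vert G] R Gr /\ green_thickening R Gr)
  \/ (exists x y : vert G,
     [/\ x != y, [set: vert G] = [set x; y]
       & green_thickening set0 [set [set x; y]]]).

(* Main.v *)
Require Import Defs.
From mathcomp Require Import all_boot all_order all_algebra zify.

(** In an odd multi-cactus the green pairs form a perfect matching, so the sums of a green pair
    differ iff its red sums differ; since every cycle has an odd number of green edges, this fails
    for some green pair.

    Conversely, let [G] have no good weighting. In a connected graph all sums can be given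
    prescribed parities up to the parity of their number; so a weighting that is prescribed near
    some vertices, leaving the rest connected and exactly one vertex [h] of wrong parity, can be
    completed so that conflicts are only possible at [h]. Two adjacent vertices that are joined by
    parallel edges and have one further edge each (a pod) can be suppressed: the resulting edge
    only remembers the parity of the number of suppressed pods and whether some pod is thick.
    An even suppressed path parallel to an ordinary edge may be replaced by an ordinary edge. If
    no such reduction applies and at least three vertices remain, a vertex at maximal distance
    from the cut vertex of an end block, together with the vertices that it traps, has a
    neighbourhood where a prescribed weighting excludes all conflicts. Hence [G] reduces to a
    bundle of parallel edges, and undoing the reductions pastes and extends cycles of an odd
    multi-cactus. *)

Set Implicit Arguments.
Unset Strict Implicit.
Unset Printing Implicit Defensive.

(** * Odd multi-cacti do not have the property *)

(** Without a good weighting, each of the two patterns that make one side even and the other odd is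
    missed at an odd number of vertices, whatever the weighting. This is why a single wrong vertex
    [h] is available with a sum of either parity, so that its sum can be chosen extreme. A deepest
    vertex is taken because all its edges lead up: fixing them does not cut the others off from the
    root. Suppressing a pod does not give the same problem on a smaller graph, since the values on
    its two sides are opposite; hence the labels, and only the step from a good weighting of the
    reduced graph to one of the original is proved. The recurring obstacle is that forcing edges
    near [h] may trap other deepest vertices. For degree two this closes a 4-cycle, which is
    weighted by hand; for larger degree a smallest neighbourhood is shared by all vertices that it
    traps, and these are weighted together. A thin edge between vertices of degree two escapes both
    reduction and local argument, which dictates the order of the contractions. The length 2 mod 4
    arises because an even path parallel to a green pair closes a cycle with an odd number of green
    pairs. *)

Section CycleColours.
Variables (V : finType) (c : seq V).
Hypothesis c_cycle : cycle_2mod4 c.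

Let uc : uniq c. Proof. by case/and3P: c_cycle. Qed.
Let c3 : 2 < size c. Proof. by case/and3P: c_cycle. Qed.
Let c_mod : exists m, size c = m * 4 + 2.
Proof. by case/and3P: c_cycle => _ /eqP c4 _; exists (size c %/ 4); rewrite {1}(divn_eq (size c) 4) c4. Qed.
Let c_even : odd (size c) = false.
Proof. by have [m ->] := c_mod; rewrite oddD oddM andbF. Qed.

Lemma index_next z : z \in c -> index (next c z) c = (index z c).+1 %% size c.
Proof.
move=> zc; have iz : index z c < size c by rewrite index_mem.
move: uc iz zc; rewrite next_nth; case: c => // x c' uc' iz ->.
case: (ltngtP (index z (x :: c')) (size c')) => cmp.
- by rewrite -[nth x c' _]/(nth x (x :: c') (index z (x :: c')).+1) index_uniq // modn_small.
- by move: iz; rewrite ltnS leqNgt cmp.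
by rewrite cmp nth_default // /= eqxx modnn.
Qed.

Lemma odd_index_next z : z \in c -> odd (index (next c z) c) = ~~ odd (index z c).
Proof. by move=> zc; rewrite index_next // odd_mod // c_even. Qed.

Lemma odd_index_prev z : z \in c -> odd (index (prev c z) c) = ~~ odd (index z c).
Proof.
by move=> zc; rewrite -{2}(next_prev uc z) odd_index_next ?mem_prev // negbK.
Qed.

Lemma next_neq z : z \in c -> next c z != z.
Proof. by move=> zc; apply/eqP => E1; have := odd_index_next zc; rewrite E1; case: (odd _). Qed.

Lemma next_neq_prev z : z \in c -> next c z != prev c z.
Proof.
move=> zc; apply/eqP => E1.
have nc : next c z \in c by rewrite mem_next.
have : index (next c (next c z)) c = index z c by rewrite E1 next_prev.
rewrite !index_next //; have : index z c < size c by rewrite index_mem.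
move: (index z c) (size c) c3 => i n n3 lin.
rewrite -addn1 modnDml addn1; case: (ltngtP i.+2 n) => cmp.
- by rewrite modn_small // => /eqP; rewrite -addn2 -[X in _ == X]addn0 eqn_add2l.
- have -> : i.+2 = n + 1 by lia.
  by rewrite addnC modnDr modn_small; lia.
by rewrite cmp modnn; lia.
Qed.

Definition red_at z := if odd (index z c) then [set z; next c z] else [set prev c z; z].
Definition green_at z := if odd (index z c) then [set prev c z; z] else [set z; next c z].

(** The length is even, so the parity of the index alternates all around the cycle, also across the
    end of [c]. Hence each vertex has exactly one edge of each colour, to its successor or from its
    predecessor. *)
Lemma cycle_edgesP b p z : (p \in cycle_edges c b) && (z \in p) =
  (z \in c) && (p == if odd (index z c) == b then [set z; next c z] else [set prev c z; z]).
Proof.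
apply/idP/idP => [/andP[/imsetP[t]]|/andP[zc /eqP ->]].
  rewrite inE => /andP[tc /eqP ti] ->; rewrite in_set2 => /orP[] /eqP ->.
    by rewrite tc ti !eqxx.
  rewrite mem_next tc odd_index_next // ti prev_next //.
  by case: b {ti}; rewrite eqxx.
case: ifP => ib.
  rewrite !inE eqxx andbT; apply/imsetP; exists z => //.
  by rewrite inE zc ib.
rewrite !inE eqxx orbT andbT; apply/imsetP; exists (prev c z).
  rewrite inE mem_prev zc odd_index_prev //.
  by move: ib; case: (odd _); case: b.
by rewrite next_prev.
Qed.

Lemma cycle_redP p z : (p \in cycle_red c) && (z \in p) = (z \in c) && (p == red_at z).
Proof. by rewrite cycle_edgesP /red_at; case: (odd _). Qed.

Lemma cycle_greenP p z : (p \in cycle_green c) && (z \in p) = (z \in c) && (p == green_at z).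
Proof. by rewrite cycle_edgesP /green_at; case: (odd _). Qed.

Lemma red_green_neq z : z \in c -> red_at z != green_at z.
Proof.
move=> zc; have nz := next_neq zc; have np := next_neq_prev zc.
rewrite /red_at /green_at; case: ifP => _; apply/eqP => E1.
  have : next c z \in [set prev c z; z] by rewrite -E1 !inE eqxx orbT.
  by rewrite in_set2 (negbTE nz) (negbTE np).
have : next c z \in [set prev c z; z] by rewrite E1 !inE eqxx orbT.
by rewrite in_set2 (negbTE nz) (negbTE np).
Qed.

Lemma cycle_edges_pair b p : p \in cycle_edges c b ->
  exists x y, [/\ p = [set x; y], x != y, x \in c & y \in c].
Proof.
case/imsetP => t; rewrite inE => /andP[tc _] ->; exists t, (next c t).
by rewrite mem_next eq_sym next_neq.
Qed.

Lemma red_next z : z \in c -> odd (index z c) -> red_at (next c z) = red_at z.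
Proof. by move=> zc oz; rewrite /red_at odd_index_next // oz /= prev_next. Qed.

Let even_at z := (z \in c) && ~~ odd (index z c).

Lemma sum_even_odd (f : V -> bool) :
  \big[addb/false]_(z in c) f z = \big[addb/false]_(z | even_at z) (f z (+) f (next c z)).
Proof.
rewrite (bigID (fun z => ~~ odd (index z c))) /= big_split /=; congr (_ (+) _).
rewrite (reindex_onto (next c) (prev c)) /=; last by move=> z _; rewrite next_prev.
apply: eq_bigl => z; rewrite mem_next prev_next // eqxx andbT negbK /even_at.
by case zc: (z \in c) => //=; rewrite odd_index_next.
Qed.

(** [next] exchanges even and odd indices, so each kind makes up half of a length [m * 4 + 2]. *)
Lemma odd_even_count : \big[addb/false]_(z | even_at z) true = true.
Proof.
have half : #|[pred z in c | odd (index z c)]| = #|[pred z | even_at z]|.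
  rewrite -!sum1_card (reindex_onto (next c) (prev c)) /=; last by move=> z _; rewrite next_prev.
  apply: eq_bigl => z; rewrite !inE mem_next prev_next // eqxx andbT /even_at.
  by case zc: (z \in c) => //=; rewrite odd_index_next.
have tot : #|[pred z in c | odd (index z c)]| + #|[pred z | even_at z]| = size c.
  rewrite -(card_uniqP uc) -[RHS]sum1_card (bigID (fun z => odd (index z c))) /= -!sum1_card.
  by congr (_ + _); apply: eq_bigl => z; rewrite !inE.
have od : odd #|[pred z | even_at z]|.
  have [m E1] := c_mod; move: tot; rewrite half E1; move: #|_| => k tot.
  have -> : k = (m * 2).+1 by lia.
  by rewrite /= oddM andbF.
move: od; rewrite -sum1_card (big_morph odd oddD (erefl _)) /= => od.
by rewrite -[RHS]od; apply: eq_bigl.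
Qed.

(* Going around the cycle the red values change an even number of times, while the number of
   green edges is odd. *)
Lemma cycle_conflict (f : {set V} -> bool) z0 : z0 \in c -> ~~ odd (index z0 c) ->
  (forall z, z \in c -> ~~ odd (index z c) -> z != z0 -> f (red_at z) != f (red_at (next c z))) ->
  f (red_at z0) = f (red_at (next c z0)).
Proof.
move=> z0c oz0 H.
have ev0 : even_at z0 by rewrite /even_at z0c.
have : \big[addb/false]_(z in c) f (red_at z) = false.
  rewrite (bigID (fun z => odd (index z c))) /=.
  rewrite [X in _ (+) X](reindex_onto (next c) (prev c)) /=; last by move=> z _; rewrite next_prev.
  rewrite [X in _ (+) X](_ : _ = \big[addb/false]_(z in c | odd (index z c)) f (red_at z)) ?addbb //.
  apply: eq_big => z; last first.
    by move=> /andP[/andP[]]; rewrite mem_next => zc; rewrite odd_index_next // negbK => oz _; rewrite red_next.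
  rewrite mem_next prev_next // eqxx andbT.
  by case zc: (z \in c) => //=; rewrite odd_index_next // negbK.
rewrite sum_even_odd (bigD1 z0) //=.
rewrite (eq_bigr (fun=> true)); last first.
  move=> z /andP[/andP[zc oz] zz]; have := H z zc oz zz.
  by case: (f _); case: (f _).
have := odd_even_count; rewrite (bigD1 z0) //=.
by case: (\big[_/_]_(_ | _) _); case: (f _); case: (f _).
Qed.

Lemma cycle_has_conflict (f : {set V} -> bool) :
  exists z, [/\ z \in c, ~~ odd (index z c) & f (red_at z) = f (red_at (next c z))].
Proof.
case: (pickP [pred z | [&& z \in c, ~~ odd (index z c) & f (red_at z) == f (red_at (next c z))]]).
  by move=> z /and3P[zc oz /eqP E1]; exists z.
move=> none; have [x xc ix] : exists2 x, x \in c & index x c = 0.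
  by case: c c3 => // x c' _; exists x; rewrite ?inE /= eqxx.
exists x; rewrite xc ix; split=> //; apply: cycle_conflict => //; first by rewrite ix.
by move=> z zc oz _; have := none z; rewrite /= zc oz /= => ->.
Qed.

Lemma green_even z : z \in c -> ~~ odd (index z c) -> [set z; next c z] \in cycle_green c.
Proof. by move=> zc oz; apply/imsetP; exists z => //; rewrite inE zc (negbTE oz). Qed.
End CycleColours.

Section Conflict.
Variable V : finType.
Implicit Types (R Gr : {set {set V}}) (W : {set V}).

(** Invariant of pasting. The green pairs form a matching, so green edges contribute equally to the
    two sums at a green pair. *)
Record matched W R Gr : Prop := Matched {
  matched_sub : forall p, (p \in R) || (p \in Gr) ->
    exists x y, [/\ p = [set x; y], x != y, x \in W & y \in W];
  matched_disj : forall p, p \in R -> p \notin Gr;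
  matched_uniq : forall p q x, p \in Gr -> q \in Gr -> x \in p -> x \in q -> p = q
}.

Lemma cycle_matched (c : seq V) : cycle_2mod4 c ->
  matched [set x in c] (cycle_red c) (cycle_green c).
Proof.
move=> cc; split.
- by move=> p /orP[] /(cycle_edges_pair cc)[x [y [-> xy xc yc]]]; exists x, y; rewrite !inE.
- move=> p pr; apply/negP => pg; have [x [y [pE _ _ _]]] := cycle_edges_pair cc pr.
  have xp : x \in p by rewrite pE !inE eqxx.
  have := cycle_redP cc p x; rewrite pr xp => /esym/andP[xc /eqP p1].
  have := cycle_greenP cc p x; rewrite pg xp => /esym/andP[_ /eqP p2].
  by have := red_green_neq cc xc; rewrite -p1 -p2 eqxx.
move=> p q x pg qg xp xq.
have := cycle_greenP cc p x; rewrite pg xp => /esym/andP[_ /eqP ->].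
by have := cycle_greenP cc q x; rewrite qg xq => /esym/andP[_ /eqP ->].
Qed.

(** Such a pair has both its vertices in the intersection, which has only two elements; so red edges
    of the old and the new part never coincide. *)
Lemma pair_inter W (c : seq V) (x y : V) p : W :&: [set z in c] = [set x; y] ->
  (exists s t, [/\ p = [set s; t], s != t, s \in W & t \in W]) ->
  (exists s t, [/\ p = [set s; t], s != t, s \in c & t \in c]) -> p = [set x; y].
Proof.
move=> WI [s [t [pE st sW tW]]] [s' [t' [pE' _ s'c t'c]]].
have pc z : z \in p -> z \in c by rewrite pE' in_set2 => /orP[] /eqP ->.
have pxy z : z \in p -> z \in [set x; y].
  by move=> zp; rewrite -WI !inE pc // andbT; move: zp; rewrite pE in_set2 => /orP[] /eqP ->.
apply/eqP; rewrite eqEcard; apply/andP; split; first exact/subsetP.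
by rewrite pE !cards2 st; case: (_ != _).
Qed.

Lemma pasted_matched W R Gr : pasted W R Gr -> matched W R Gr.
Proof.
elim=> {W R Gr} [c|W R Gr c x y _ [m1 m2 m3] cc gxy cxy WI]; first exact: cycle_matched.
have [c1 c2 c4] := cycle_matched cc.
have inc p : (p \in cycle_red c) || (p \in cycle_green c) ->
    exists s t, [/\ p = [set s; t], s != t, s \in c & t \in c].
  by case/orP; apply: cycle_edges_pair.
have both p : (p \in R) || (p \in Gr) -> (p \in cycle_red c) || (p \in cycle_green c) -> p = [set x; y].
  by move=> /m1 h1 /inc h2; apply: pair_inter WI h1 h2.
split.
- move=> p; rewrite !in_setU => H.
  have : ((p \in R) || (p \in Gr)) || ((p \in cycle_red c) || (p \in cycle_green c)).
    by move: H; do !case: (p \in _).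
  case/orP => [/m1|/c1] [s [t [-> st sW tW]]]; exists s, t; rewrite !in_setU sW tW ?orbT //.
- move=> p; rewrite !in_setU negb_or => /orP[pR|pr]; apply/andP; split.
  + exact: m2.
  + by apply/negP => pg; have := m2 p pR; rewrite (both p) ?pR ?pg ?orbT // gxy.
  + by apply/negP => pG; have := c2 p pr; rewrite (both p) ?pr ?pG ?orbT // cxy.
  exact: c2.
have mix p q z : p \in Gr -> q \in cycle_green c -> z \in p -> z \in q -> p = q.
  move=> pG qg zp zq.
  have zW : z \in W.
    by have [|s [t [pE _ sW tW]]] := m1 p; [rewrite pG orbT | move: zp; rewrite pE in_set2 => /orP[] /eqP ->].
  have zc : z \in c.
    by have [|s [t [pE _ sW tW]]] := inc q; [rewrite qg orbT | move: zq; rewrite pE in_set2 => /orP[] /eqP ->].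
  have zxy : z \in [set x; y] by rewrite -WI !inE zW.
  by rewrite (m3 p [set x; y] z) // (c4 q [set x; y] z).
move=> p q z; rewrite !in_setU => /orP[pG|pg] /orP[qG|qg] zp zq.
- exact: m3 pG qG zp zq.
- exact: mix pG qg zp zq.
- by rewrite (mix q p z).
exact: c4 pg qg zp zq.
Qed.

Definition red_sum R (f : {set V} -> bool) (x : V) : nat := \sum_(p in R | x \in p) f p.

Lemma red_sum_out W R Gr f x : matched W R Gr -> x \notin W -> red_sum R f x = 0.
Proof.
move=> [m1 _ _] xW; rewrite /red_sum big1 // => p /andP[pR xp].
have [|s [t [pE _ sW tW]]] := m1 p; first by rewrite pR.
by move: xp xW; rewrite pE in_set2 => /orP[] /eqP ->; rewrite ?sW ?tW.
Qed.

Lemma red_sum_cycle (c : seq V) f x : cycle_2mod4 c -> x \in c ->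
  red_sum (cycle_red c) f x = f (red_at c x).
Proof.
move=> cc xc; rewrite /red_sum (big_pred1 (red_at c x)) // => p.
by rewrite /= (cycle_redP cc) xc.
Qed.

Lemma red_sumU R R' f x : (forall p, p \in R -> p \notin R') ->
  red_sum (R :|: R') f x = red_sum R f x + red_sum R' f x.
Proof.
move=> dis; rewrite /red_sum big_mkcondr [X in _ = X + _]big_mkcondr [X in _ = _ + X]big_mkcondr /=.
rewrite -bigU /=; first by apply: eq_bigl => p; rewrite !inE.
by rewrite disjoint_subset; apply/subsetP => p; exact: dis.
Qed.

(** A conflict of the new cycle at a green pair other than the pasted one lies outside [W] and
    persists. If there is none, [cycle_conflict] makes the new cycle add equal amounts at the two
    ends of the pasted pair, and it adds nothing at other green pairs of [W]; so the conflict of the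
    old part persists. *)
Lemma pasted_conflict W R Gr : pasted W R Gr -> forall f : {set V} -> bool,
  exists x y, [/\ [set x; y] \in Gr, x != y & red_sum R f x = red_sum R f y].
Proof.
elim=> {W R Gr} [c cc|W R Gr c x y pst IH cc gxy cxy WI] f.
  have [z [zc oz E1]] := cycle_has_conflict cc f; exists z, (next c z).
  by rewrite green_even // eq_sym next_neq // !red_sum_cycle ?mem_next // E1.
have mW := pasted_matched pst; have mc := cycle_matched cc.
have dis p : p \in R -> p \notin cycle_red c.
  move=> pR; apply/negP => pr.
  have pE : p = [set x; y].
    apply: (pair_inter WI); first by apply: (matched_sub mW); rewrite pR.
    exact: cycle_edges_pair pr.
  by have := matched_disj mW pR; rewrite pE gxy.
have split_sum t : red_sum (R :|: cycle_red c) f t = red_sum R f t + red_sum (cycle_red c) f t.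
  exact: red_sumU.
have xy : x != y.
  have [|s [t [E1 st _ _]]] := matched_sub mW (p := [set x; y]); first by rewrite gxy orbT.
  by have := congr1 (fun A : {set V} => #|A|) E1; rewrite !cards2 st; case: (x != y).
have Wc t : t \in W -> t \in c -> t \in [set x; y] by move=> tW tc; rewrite -WI !inE tW.
have [xW xc] : x \in W /\ x \in c.
  by have : x \in W :&: [set z in c]; [rewrite WI !inE eqxx | rewrite !inE => /andP[]].
have [yW yc] : y \in W /\ y \in c.
  by have : y \in W :&: [set z in c]; [rewrite WI !inE eqxx orbT | rewrite !inE => /andP[]].
have [z0 [z0c oz0 zE]] : exists z0, [/\ z0 \in c, ~~ odd (index z0 c) & [set x; y] = [set z0; next c z0]].
  by case/imsetP: cxy => z0; rewrite inE => /andP[z0c /eqP oz] zE; exists z0; rewrite oz.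
case: (pickP [pred z | [&& z \in c, ~~ odd (index z c), z != z0 & f (red_at c z) == f (red_at c (next c z))]]).
  move=> z /and4P[zc oz zz /eqP E1].
  have zg := green_even zc oz.
  have out t : t \in [set z; next c z] -> t \notin W.
    move=> tz; apply/negP => tW.
    have tc : t \in c by move: tz; rewrite in_set2 => /orP[] /eqP ->; rewrite ?mem_next.
    have gE : [set z; next c z] = [set x; y] := matched_uniq mc zg cxy tz (Wc t tW tc).
    have : z \in [set z0; next c z0] by rewrite -zE -gE !inE eqxx.
    rewrite in_set2 (negbTE zz) /= => /eqP zn.
    by move: oz; rewrite zn (odd_index_next cc) // oz0.
  exists z, (next c z); split; first by rewrite in_setU zg orbT.
    by rewrite eq_sym (next_neq cc).
  rewrite !split_sum !(red_sum_out f mW) ?out ?inE ?eqxx ?orbT //.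
  by rewrite !red_sum_cycle ?mem_next // E1.
move=> none.
have eq0 : f (red_at c z0) = f (red_at c (next c z0)).
  apply: (cycle_conflict cc) => // z zc oz zz.
  by have := none z; rewrite /= zc oz zz /= => ->.
have eqxy : f (red_at c x) = f (red_at c y).
  have xz : x \in [set z0; next c z0] by rewrite -zE !inE eqxx.
  have yz : y \in [set z0; next c z0] by rewrite -zE !inE eqxx orbT.
  by move: xz yz; rewrite !in_set2 => /orP[] /eqP -> /orP[] /eqP ->.
have [x' [y' [g' xy' E1]]] := IH f; exists x', y'; split=> //; first by rewrite in_setU g'.
rewrite !split_sum E1; congr (_ + _).
have [gE|gn] := eqVneq [set x'; y'] [set x; y].
  have x'z : x' \in [set x; y] by rewrite -gE !inE eqxx.
  have y'z : y' \in [set x; y] by rewrite -gE !inE eqxx orbT.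
  by move: x'z y'z; rewrite !in_set2 => /orP[] /eqP -> /orP[] /eqP ->; rewrite !red_sum_cycle ?eqxy.
have out t : t \in [set x'; y'] -> red_sum (cycle_red c) f t = 0.
  move=> tg; apply: (red_sum_out f mc); rewrite inE; apply/negP => tc.
  have tW : t \in W.
    have [|s [q [E2 _ sW qW]]] := matched_sub mW (p := [set x'; y']); first by rewrite g' orbT.
    by move: tg; rewrite E2 in_set2 => /orP[] /eqP ->.
  by move: gn; rewrite (matched_uniq mW g' gxy tg (Wc t tW tc)) eqxx.
by rewrite !out // !inE eqxx ?orbT.
Qed.
End Conflict.

Section NoProperty.
Variable G : multigraph.
Implicit Types (R Gr : {set {set vert G}}).

Definition on_deg (b : edge G -> bool) (x : vert G) : nat := \sum_(e | x \in ends e) b e.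

Lemma weight_sum_on (b : edge G -> bool) x :
  weight_sum (fun e => (b e)%:R%R) x = (on_deg b x)%:R%R.
Proof. by rewrite /weight_sum /on_deg GRing.natr_sum. Qed.

Lemma has_property01 : has_property G (pred2 0%R 1%R) <->
  exists b : edge G -> bool, forall u v, adj u v -> on_deg b u != on_deg b v.
Proof.
split=> [[w [w01 ww]]|[b bb]].
  pose b e := w e == 1%R.
  have wb e : w e = (b e)%:R%R by have := w01 e; rewrite inE /b => /orP[] /eqP ->.
  have wsE x : weight_sum w x = (on_deg b x)%:R%R.
    by rewrite -weight_sum_on; apply: eq_bigr => e _.
  by exists b => u v /ww; rewrite !wsE => ne; apply/eqP => E1; rewrite E1 in ne.
exists (fun e => (b e)%:R%R); split=> [e|u v /bb ne]; first by rewrite inE; case: (b e).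
by rewrite !weight_sum_on => /eqP; rewrite Num.Theory.eqr_nat (negbTE ne).
Qed.

Lemma adj_ends (e : edge G) u v : ends e = [set u; v] -> adj u v.
Proof. by move=> E1; apply/existsP; exists e; rewrite inE E1 eqxx. Qed.

(** The edges at a vertex are red ones, which are simple, and its green bundle, which both ends of a
    green pair share; so equal red sums at a green pair give equal sums. *)
Lemma cactus_no_property : odd_multi_cactus G -> ~ has_property G (pred2 0%R 1%R).
Proof.
move=> cac /has_property01[b bb].
case: cac => [[R [Gr [pst [t1 t2 t3]]]]|[x [y [xy _ [t1 _ t3]]]]]; last first.
  have [e eE] : exists e : edge G, ends e = [set x; y].
    have := t3 [set x; y]; rewrite set11 => /(_ isT).
    by rewrite /multiplicity card_gt0 => /set0Pn[e]; rewrite inE => /eqP eE; exists e.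
  have := bb x y (adj_ends eE); rewrite /on_deg; apply/negP; rewrite negbK; apply/eqP.
  apply: eq_bigl => f; have := t1 f; rewrite set0U inE => /eqP ->.
  by rewrite !inE !eqxx orbT.
have mt := pasted_matched pst.
pose rho (p : {set vert G}) : nat := \sum_(e : edge G | ends e == p) b e.
pose f (p : {set vert G}) : bool := [exists e : edge G, (ends e == p) && b e].
have rhoR p : p \in R -> rho p = f p.
  move=> /t2 /eqP /cards1P[e eE].
  have E1 e' : (ends e' == p) = (e' == e) by move/setP/(_ e'): eE; rewrite !inE.
  rewrite /rho (big_pred1 e) //; congr nat_of_bool; apply/idP/existsP => [be|[e']].
    by exists e; rewrite be E1 eqxx.
  by rewrite E1 => /andP[/eqP ->].
have degE x : on_deg b x = \sum_(p : {set vert G} | x \in p) rho p.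
  rewrite /on_deg (partition_big (@ends G) (fun p : {set vert G} => x \in p)) //.
  by apply: eq_bigr => p xp; apply: eq_bigl => e; case: eqP => [->|]; rewrite ?xp ?andbF.
have rho0 p : p \notin R :|: Gr -> rho p = 0.
  by move=> np; rewrite /rho big1 // => e /eqP eE; move: np; rewrite -eE t1.
have [x [y [gxy xy E1]]] := pasted_conflict pst f.
have degS z : z \in [set x; y] -> on_deg b z = red_sum R f z + rho [set x; y].
  move=> zg; rewrite degE (bigID (fun p => p \in R)) /=; congr (_ + _).
    rewrite /red_sum; under eq_bigl do rewrite andbC.
    by apply: eq_bigr => p /andP[pR _]; rewrite rhoR.
  rewrite (bigD1 [set x; y]) /=; last first.
    by rewrite zg; apply/negP => /(matched_disj mt); rewrite gxy.
  rewrite big1 ?addn0 // => p /andP[/andP[zp nR] np]; apply: rho0.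
  rewrite in_setU negb_or nR /=; apply/negP => pG.
  by move: np; rewrite (matched_uniq mt pG gxy zp zg) eqxx.
have [e eE] : exists e : edge G, ends e = [set x; y].
  have := t3 _ gxy.
  by rewrite /multiplicity card_gt0 => /set0Pn[e]; rewrite inE => /eqP eE; exists e.
have := bb x y (adj_ends eE).
by rewrite !degS ?E1 ?eqxx // !inE eqxx ?orbT.
Qed.
End NoProperty.

(** * Labelled graphs *)

(* A non-plain edge stands for a suppressed path through pods, a pod being a pair of vertices
   joined by parallel edges and having one further edge each. [od] is the parity of the number
   of pods on the path and [thick] tells whether some pod has at least two parallel edges. *)
Record lgraph (V E : finType) := LGraph {
  vs : {set V};
  es : {set E};
  src : E -> V;
  dst : E -> V;
  plain : E -> bool;
  thick : E -> bool;
  od : E -> bool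
}.

Section LGraph.
Variables (V E : finType) (side : V -> bool).
Implicit Types (K : lgraph V E) (w : E -> bool) (x y u v h : V) (e : E).

Definition inc K x e := (x == src K e) || (x == dst K e).
Definition at_ K x : {set E} := [set e in es K | inc K x e].
Definition joins K e x y :=
  ((x == src K e) && (y == dst K e)) || ((x == dst K e) && (y == src K e)).
(* [w] gives the value at the end [src]. The two ends of a pod have distinct sums iff its two
   outer edges have distinct values, so the value changes at every pod. *)
Definition va K w e x := w e (+) (od K e && (x == dst K e)).
Definition sm K w x : nat := \sum_(e in at_ K x) va K w e x.

(* The weight of the single edge of a pod is excluded by at most one value at either side; a thin
   edge fails iff the two sides exclude both values, which happens exactly when the end sums have
   the same parity and at both ends the other edges contribute at most 1. *)
Definition ok K w e :=
  let a := sm K w (src K e) in let b := sm K w (dst K e) in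
  if plain K e then a != b
  else [|| thick K e, odd a != odd b, (va K w e (src K e)).+1 < a
         | (va K w e (dst K e)).+1 < b].

Definition kprop K := exists w, forall e, e \in es K -> ok K w e.

Definition cut K (S : {set V}) : {set E} :=
  [set e in es K | (src K e \in S) != (dst K e \in S)].

(* [wf_cut] says that [K] is connected and bridgeless. *)
Record wf K : Prop := Wf {
  wf_src : forall e, e \in es K -> src K e \in vs K;
  wf_dst : forall e, e \in es K -> dst K e \in vs K;
  wf_side : forall e, e \in es K -> side (src K e) != side (dst K e);
  wf_plain : forall e, plain K e -> ~~ thick K e && ~~ od K e;
  wf_cut : forall S : {set V}, S \subset vs K -> S != set0 -> S != vs K ->
             1 < #|cut K S|
}.

Section Basic.
Variables (K : lgraph V E).
Hypothesis wfK : wf K.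

Lemma joinsC e x y : joins K e x y = joins K e y x.
Proof. by rewrite /joins orbC; congr (_ || _); rewrite andbC. Qed.

Lemma joins_src_dst e : joins K e (src K e) (dst K e).
Proof. by rewrite /joins !eqxx. Qed.

Lemma joinsP e x y : joins K e x y ->
  (x = src K e /\ y = dst K e) \/ (x = dst K e /\ y = src K e).
Proof. by case/orP => /andP[/eqP -> /eqP ->]; [left|right]. Qed.

Lemma joins_inc e x y : joins K e x y -> inc K x e.
Proof. by rewrite /inc; case/joinsP => -[-> _]; rewrite eqxx ?orbT. Qed.

Lemma inc_joins e x : inc K x e -> exists y, joins K e x y.
Proof.
case/orP => /eqP ->; first by exists (dst K e); rewrite joins_src_dst.
by exists (src K e); rewrite joinsC joins_src_dst.
Qed.

Lemma at_es e x : e \in at_ K x -> e \in es K.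
Proof. by rewrite inE => /andP[]. Qed.

Lemma at_joins e x : e \in at_ K x -> exists y, joins K e x y.
Proof. by rewrite inE => /andP[_ /inc_joins]. Qed.

Lemma joins_at e x y : e \in es K -> joins K e x y -> e \in at_ K x.
Proof. by move=> eK /joins_inc; rewrite inE eK. Qed.

Lemma joins_atr e x y : e \in es K -> joins K e x y -> e \in at_ K y.
Proof. by rewrite joinsC; apply: joins_at. Qed.

Lemma joins_side e x y : e \in es K -> joins K e x y -> side x = ~~ side y.
Proof.
move=> /(wf_side wfK) ne /joinsP[] [-> ->]; move: ne;
by case: (side (src K e)); case: (side (dst K e)).
Qed.

Lemma joins_neq e x y : e \in es K -> joins K e x y -> x != y.
Proof. by move=> eK /(joins_side eK) sxy; apply/eqP => xy; move: sxy; rewrite xy; case: (side y). Qed.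

Lemma joins_vs e x y : e \in es K -> joins K e x y -> (x \in vs K) /\ (y \in vs K).
Proof. by move=> eK; case/joinsP => -[-> ->]; rewrite !(wf_src wfK, wf_dst wfK). Qed.

Lemma joins_inj e x y z : e \in es K -> joins K e x y -> joins K e x z -> y = z.
Proof.
move=> eK xy; have := joins_neq eK xy; move: xy => /joinsP[] [-> ->] ne /joinsP[] [] //.
  by move=> xy; rewrite -xy eqxx in ne.
by move=> xy; rewrite -xy eqxx in ne.
Qed.

Lemma joins_or e x y z : joins K e x y -> inc K z e -> (z == x) || (z == y).
Proof. by rewrite /inc; case/joinsP => -[-> ->] //; rewrite orbC. Qed.

Lemma va_other w e x y : e \in es K -> joins K e x y -> va K w e y = va K w e x (+) od K e.
Proof.
move=> eK; have := wf_side wfK eK; rewrite /va => ne.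
have sd : (src K e == dst K e) = false by apply/eqP => sd; rewrite sd eqxx in ne.
by case/joinsP => -[-> ->]; rewrite sd eqxx ?andbF ?andbT ?addbF // -addbA addbb addbF.
Qed.

Lemma okE w e x y : joins K e x y ->
  ok K w e = if plain K e then sm K w x != sm K w y
  else [|| thick K e, odd (sm K w x) != odd (sm K w y), (va K w e x).+1 < sm K w x
         | (va K w e y).+1 < sm K w y].
Proof.
case/joinsP => -[-> ->] //; rewrite /ok eq_sym.
by case: ifP => // _; rewrite eq_sym; congr (_ || (_ || _)); rewrite orbC.
Qed.

Lemma ok_parity w e x y : joins K e x y -> odd (sm K w x) != odd (sm K w y) -> ok K w e.
Proof.
move=> exy ne; rewrite (okE w exy) ne /= orbT; case: ifP => // _.
by apply: contraNneq ne => ->.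
Qed.

Lemma ok_thick w e : thick K e -> ok K w e.
Proof.
move=> te; rewrite /ok te /=; case: ifP => // /(wf_plain wfK).
by rewrite te.
Qed.

Lemma ok_rest w e x y : joins K e x y -> ~~ plain K e ->
  (va K w e x).+1 < sm K w x -> ok K w e.
Proof. by move=> exy pe lt; rewrite (okE w exy) (negbTE pe) lt !orbT. Qed.

Lemma eq_sm w w' x : (forall e, e \in at_ K x -> w e = w' e) -> sm K w x = sm K w' x.
Proof. by move=> H; apply: eq_bigr => e /H we; rewrite /va we. Qed.

(** The change of parity at [x] when the weighting is flipped on [f]. *)
Definition tg (f : E -> bool) x := \big[addb/false]_(e in at_ K x) f e.

Lemma odd_sm w x : odd (sm K w x) = \big[addb/false]_(e in at_ K x) va K w e x.
Proof.
rewrite /sm (big_morph odd oddD (erefl _)).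
by apply: eq_bigr => e _; case: (va _ _ _ _).
Qed.

Lemma odd_sm_flip w f x :
  odd (sm K (fun e => w e (+) f e) x) = odd (sm K w x) (+) tg f x.
Proof.
rewrite !odd_sm /tg -big_split /=; apply: eq_bigr => e _.
by rewrite /va -!addbA [f e (+) _]addbC.
Qed.

Lemma tgD f g x : tg (fun e => f e (+) g e) x = tg f x (+) tg g x.
Proof. by rewrite /tg big_split. Qed.

Lemma tg1 e x y z : e \in es K -> joins K e x y ->
  tg (pred1 e) z = (z == x) (+) (z == y).
Proof.
move=> eK exy; have ne := joins_neq eK exy.
have -> : tg (pred1 e) z = (e \in at_ K z).
  rewrite /tg; case: (boolP (e \in at_ K z)) => ez.
    rewrite (bigD1 e) //= eqxx big1 // => f /andP[_ /negbTE ->] //.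
  by rewrite big1 // => f fz; apply/negbTE; apply: contraNneq ez => <-.
rewrite inE eK /=; apply/idP/idP => [/(joins_or exy)|].
  case/orP => /eqP ->; rewrite eqxx ?(negbTE ne) // eq_sym (negbTE ne) //.
case: (eqVneq z x) => [-> _|_]; first exact: joins_inc exy.
by move=> /= /eqP ->; move: exy; rewrite joinsC; apply: joins_inc.
Qed.

Definition kappa := \big[addb/false]_(e in es K) od K e.

(** An even edge contributes equal values at its two ends and an odd edge opposite ones, so only odd
    edges count. *)
Lemma sum_parity w : \big[addb/false]_(x in vs K) odd (sm K w x) = kappa.
Proof.
under eq_bigr => x _ do rewrite odd_sm.
rewrite (exchange_big_dep (mem (es K))) /=; last by move=> x e _; apply: at_es.
apply: eq_bigr => e eK.
have ne := joins_neq eK (joins_src_dst e).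
rewrite (bigD1 (src K e)) /=; last by rewrite (wf_src wfK) // inE eK /inc eqxx.
rewrite (bigD1 (dst K e)) /=; last first.
  by rewrite (wf_dst wfK) // inE eK /inc eqxx orbT eq_sym.
rewrite big1 => [|x]; last first.
  by rewrite inE /inc; case: (x == src K e); case: (x == dst K e); rewrite ?andbF //.
rewrite (va_other w eK (joins_src_dst e)) addbF addbA addbb //.
Qed.

Section Toggle.
Variables (M : {set V}) (F0 : pred E) (r : V) (l : V -> nat).
Hypothesis low : forall x, x \in M -> x != r ->
  exists e y, [/\ F0 e, e \in es K, joins K e x y, y \in M & l y < l x].

Definition inner e := [&& F0 e, e \in es K, src K e \in M & dst K e \in M].

(** The steps given by [low] lead from [x] down to [r]; flipping the edges passed changes the parity
    at these two vertices only. *)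
Lemma toggle_path x : x \in M ->
  exists f : E -> bool, (forall e, f e -> inner e) /\
    forall y, tg f y = (y == x) (+) (y == r).
Proof.
have [n] := ubnP (l x); elim: n x => // n IH x lx xM.
have [->|xr] := eqVneq x r.
  by exists (fun _ => false); split => // y; rewrite /tg big1 // addbb.
have [e [y [F0e eK exy yM ly]]] := low xM xr.
have [||f [fi ft]] := IH y; [by apply: leq_trans ly _ | by [] |].
exists (fun e' => f e' (+) (e' == e)); split.
  move=> e'; case: eqP => [->|_]; last by rewrite addbF; apply: fi.
  move=> _; rewrite /inner F0e eK /=.
  by case/joinsP: exy => -[<- <-]; rewrite xM yM.
move=> z; rewrite tgD ft (tg1 z eK exy).
by case: (z == x); case: (z == y); case: (z == r).
Qed.

Lemma toggle_set (T : {set V}) : T \subset M ->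
  exists f : E -> bool, (forall e, f e -> inner e) /\
    forall y, y != r -> tg f y = (y \in T).
Proof.
have [n] := ubnP #|T|; elim: n T => // n IH T le_n TM.
have [->|[x xT]] := set_0Vmem T.
  by exists (fun _ => false); split => // y _; rewrite inE /tg big1.
have [||f [fi ft]] := IH (T :\ x).
- by move: le_n; rewrite (cardsD1 x) xT.
- exact: subset_trans (subsetDl _ _) TM.
have [g [gi gt]] := toggle_path (subsetP TM x xT).
exists (fun e => f e (+) g e); split.
  by move=> e; case fe: (f e); [move=> _; apply: fi | apply: gi].
move=> y yr; rewrite tgD ft // gt (negbTE yr) addbF !inE.
by have [->|] := eqVneq y x; rewrite ?xT //= addbF.
Qed.

(** The root absorbs the defect: its parity is not controlled here and is recovered later from
    [sum_parity]. *)
Lemma toggle_fix w (tau : V -> bool) : exists w',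
  [/\ forall e, ~~ inner e -> w' e = w e,
      forall y, y \in M -> y != r -> odd (sm K w' y) = tau y
    & forall y, y \notin M -> sm K w' y = sm K w y].
Proof.
have [|f [fi ft]] := @toggle_set [set y in M | odd (sm K w y) != tau y].
  by apply/subsetP => y; rewrite inE => /andP[].
exists (fun e => w e (+) f e); split.
- by move=> e ne; rewrite [f e](contraNF (fi e) ne) addbF.
- move=> y yM yr; rewrite odd_sm_flip ft // inE yM /=.
  by case: (odd _); case: (tau y).
move=> y yM; apply: eq_sm => e; rewrite inE => /andP[eK ie].
rewrite [f e](contraNF (fi e)) ?addbF //; apply/negP => /and4P[_ _ sM dM].
by case/orP: ie => /eqP E1; rewrite -E1 ?(negbTE yM) in sM dM.
Qed.
End Toggle.

End Basic.
End LGraph.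

(** * Levels and extension of partial configurations *)

Section RelLevels.
Variables (T : finType) (R : rel T) (A : {set T}) (r : T).
Hypothesis rA : r \in A.
Hypothesis Acut : forall S : {set T}, S \subset A -> r \in S -> S != A ->
  exists x y, [/\ x \in S, y \in A :\: S & R x y].

Let RA : rel T := [rel x y | [&& y \in A & R x y]].

Fixpoint ball n : {set T} :=
  if n is n'.+1 then ball n' :|: [set y | [exists x in ball n', RA x y]] else [set r].

Lemma ball_sub n : ball n \subset A.
Proof.
elim: n => [|n IH]; first by apply/subsetP => x; rewrite inE => /eqP ->.
apply/subsetP => y; rewrite !inE => /orP[|/existsP[x /and3P[]] //].
exact: (subsetP IH).
Qed.

Lemma rel_connected x : x \in A -> connect RA r x.
Proof.
pose S := [set y in A | connect RA r y]; suff : S == A.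
  by move=> /eqP SE; rewrite -SE inE => /andP[].
apply/negPn/negP => nS.
have [||y [z [yS zA Ryz]]] := Acut _ _ nS; first by apply/subsetP => y; rewrite inE => /andP[].
  by rewrite inE rA connect0.
move: yS zA; rewrite !inE => /andP[yA cy] /andP[nz zA].
case/negP: nz; rewrite zA /=; apply: connect_trans cy (connect1 _).
by apply/andP.
Qed.

Lemma ball_exists x : x \in A -> exists n, x \in ball n.
Proof.
move=> /rel_connected /connectP[p pth ->]; exists (size p).
elim/last_ind: p pth => [|p y IH]; first by rewrite inE.
rewrite rcons_path size_rcons last_rcons => /andP[/IH lp fy] /=.
by rewrite !inE; apply/orP; right; apply/existsP; exists (last r p); rewrite lp.
Qed.

(** [l] is the breadth-first distance from [r] inside [A], the least radius of a ball that contains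
    the vertex; [Acut] stands for connectedness. *)
Lemma rel_levels : exists l : T -> nat,
  [/\ l r = 0,
      forall x, x \in A -> x != r -> exists2 y, y \in A & R y x && (l y < l x)
    & forall x y, x \in A -> y \in A -> R x y -> l y <= (l x).+1].
Proof.
have [l Hl] : exists l : T -> nat, forall x, x \in A ->
    (x \in ball (l x)) && [forall m : 'I_(l x), x \notin ball m].
  apply: (@fin_all_exists T (fun=> nat)
    (fun x n => x \in A -> (x \in ball n) && [forall m : 'I_n, x \notin ball m])) => x.
  case xK: (x \in A); last by exists 0.
  have [n xn nmin] := ex_minnP (ball_exists xK); exists n => _; rewrite xn /=.
  apply/forallP => m; apply/negP => /nmin; have := ltn_ord m; lia.
have lmin x n : x \in A -> x \in ball n -> l x <= n.
  move=> /Hl /andP[_ /forallP nm] xn; rewrite leqNgt; apply/negP => ln.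
  by have := nm (Ordinal ln); rewrite xn.
have lin x : x \in A -> x \in ball (l x) by move=> /Hl /andP[].
exists l; split.
- by apply/eqP; rewrite -leqn0; apply: lmin; rewrite ?inE.
- move=> x xK xr; have := lin x xK; case lx: (l x) => [|n] /=.
    by rewrite inE (negbTE xr).
  rewrite !inE => /orP[/(lmin _ _ xK)|]; first by rewrite lx ltnn.
  case/existsP => y /and3P[yn _ Ryx]; have yA := subsetP (ball_sub n) y yn.
  by exists y => //; rewrite Ryx ltnS; apply: lmin.
move=> x y xA yA Rxy; apply: lmin => //=; rewrite !inE; apply/orP; right.
by apply/existsP; exists x; apply/andP; split; [exact: lin | apply/andP; split].
Qed.
End RelLevels.

Section Levels.
Variables (V E : finType) (side : V -> bool).
Variable (K : lgraph V E).
Hypothesis wfK : wf side K.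
Implicit Types (w : E -> bool) (x y u v h : V) (e : E).

Definition edge_rel (F : pred E) : rel V := [rel x y | [exists e in es K, F e && joins K e x y]].

Lemma edge_relP (F : pred E) x y :
  reflect (exists e, [/\ e \in es K, F e & joins K e x y]) (edge_rel F x y).
Proof.
apply: (iffP existsP) => [[e /and3P[*]]|[e [*]]]; exists e; first by split.
by apply/and3P; split.
Qed.

Lemma cutP (S : {set V}) e : e \in cut K S ->
  exists x y, [/\ e \in es K, joins K e x y, x \in S & y \in vs K :\: S].
Proof.
rewrite inE => /andP[eK]; have js := joins_src_dst K e.
have [sK dK] := joins_vs wfK eK js.
case sS: (src K e \in S); case dS: (dst K e \in S) => // _.
  by exists (src K e), (dst K e); rewrite !inE sS dS.
by exists (dst K e), (src K e); rewrite !inE sS dS joinsC.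
Qed.

(** The predicate [F] allows distances in the graph without one edge, which stays connected as there
    is no bridge. *)
Lemma levels_exist (F : pred E) r : r \in vs K ->
  (forall S : {set V}, S \subset vs K -> r \in S -> S != vs K ->
     exists2 e, e \in cut K S & F e) ->
  exists l : V -> nat,
  [/\ l r = 0,
      forall x, x \in vs K -> x != r ->
        exists e y, [/\ F e, e \in es K, joins K e x y & l y < l x]
    & forall e x y, F e -> e \in es K -> joins K e x y -> l y <= (l x).+1].
Proof.
move=> rK Fcut; have [|l [l0 ll lip]] := @rel_levels V (edge_rel F) (vs K) r rK.
  move=> S SK rS Sn; have [e /cutP[x [y [eK exy xS yS]]] Fe] := Fcut S SK rS Sn.
  by exists x, y; split=> //; apply/edge_relP; exists e.
exists l; split=> //.
  move=> x xK xr; have [y yK /andP[/edge_relP[e [eK Fe eyx]] ly]] := ll x xK xr.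
  by exists e, y; rewrite joinsC.
move=> e x y Fe eK exy; have [xK yK] := joins_vs wfK eK exy.
by apply: lip => //; apply/edge_relP; exists e.
Qed.

Lemma cut_nonempty (S : {set V}) : S \subset vs K -> S != set0 -> S != vs K ->
  exists e, e \in cut K S.
Proof.
move=> S1 S2 S3; have := wf_cut wfK S1 S2 S3; case: (set_0Vmem (cut K S)) => [->|[e ?] _].
  by rewrite cards0.
by exists e.
Qed.

(** Since every edge changes sides, no edge stays inside a level. *)
Lemma lvl_exist r : r \in vs K -> exists l : V -> nat,
  [/\ forall x, x \in vs K -> (l x == 0) = (x == r),
      forall x, x \in vs K -> x != r ->
        exists e y, [/\ e \in es K, joins K e x y & l x = (l y).+1],
      forall e x y, e \in es K -> joins K e x y -> l x = (l y).+1 \/ l y = (l x).+1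
    & forall x, x \in vs K -> side x = odd (l x) (+) side r].
Proof.
move=> rK; have [|l [l0 ll lip]] := @levels_exist predT r rK.
  move=> S Sv rS Sn; have [|e eS] := cut_nonempty Sv _ Sn; last by exists e.
  by apply/set0Pn; exists r.
have llow x : x \in vs K -> x != r ->
    exists e y, [/\ e \in es K, joins K e x y & l x = (l y).+1].
  move=> xK xr; have [e [y [_ eK exy ly]]] := ll x xK xr.
  exists e, y; split=> //; have := lip e y x isT eK; rewrite joinsC => /(_ exy); lia.
have par x : x \in vs K -> side x = odd (l x) (+) side r.
  have [n] := ubnP (l x); elim: n x => // n IH x lx xK.
  have [->|xr] := eqVneq x r; first by rewrite l0.
  have [e [y [eK exy lxy]]] := llow x xK xr.
  have [_ yK] := joins_vs wfK eK exy.
  by rewrite (joins_side wfK eK exy) IH //; [rewrite lxy /= addNb | rewrite lxy in lx; lia].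
exists l; split=> //.
- move=> x xK; apply/eqP/eqP => [lx|-> //]; apply/eqP/negPn/negP => xr.
  by have [e [y [_ _]]] := llow x xK xr; rewrite lx.
move=> e x y eK exy; have [xK yK] := joins_vs wfK eK exy.
have := lip e x y isT eK exy; have := lip e y x isT eK; rewrite joinsC => /(_ exy).
have := joins_side wfK eK exy; rewrite (par x) // (par y) // => sxy h1 h2.
have : l x <> l y by move=> lxy; move: sxy; rewrite lxy; case: (_ (+) _).
lia.
Qed.

(** If the parities [side x (+) f] were compatible with [sum_parity], toggling towards [r] would
    realise them everywhere, including [r], and opposite parities at the ends make every edge
    good. *)
Lemma nonprop_kappa f : vs K != set0 -> ~ kprop K ->
  \big[addb/false]_(x in vs K) (side x (+) f) != kappa K.
Proof.
case/set0Pn => r rK nK; apply/negP => /eqP kE; apply: nK.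
have [l [l0 ll _ _]] := lvl_exist rK.
have [|w' [_ Hw _]] := @toggle_fix V E side K wfK (vs K) predT r l _ (fun=> false) (fun x => side x (+) f).
  move=> x xK xr; have [e [y [eK exy lxy]]] := ll x xK xr.
  by exists e, y; split=> //; [have [] := joins_vs wfK eK exy | rewrite lxy].
have rr : odd (sm K w' r) = side r (+) f.
  have := sum_parity wfK w'; rewrite -kE (bigD1 r) //= [RHS](bigD1 r) //=.
  rewrite (eq_bigr (fun x => side x (+) f)) => [|x /andP[xK xr]]; last exact: Hw.
  exact: addIb.
exists w' => e eK; apply: (ok_parity (joins_src_dst K e)).
have Hw2 x : x \in vs K -> odd (sm K w' x) = side x (+) f.
  by move=> xK; have [->|xr] := eqVneq x r; [|apply: Hw].
rewrite !Hw2 ?(wf_src wfK) ?(wf_dst wfK) //.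
by have := wf_side wfK eK; case: (side _); case: (side _); case: f {kE rr Hw Hw2}.
Qed.

Lemma nonprop_extend_gen (Z : {set V}) (F0 : pred E) r (l : V -> nat) f w :
  ~ kprop K -> Z \subset vs K -> r \in vs K -> r \notin Z ->
  (forall x, x \in vs K -> x \notin Z -> x != r ->
     exists e y, [/\ F0 e, e \in es K, joins K e x y, y \notin Z & l y < l x]) ->
  \big[addb/false]_(z in Z) (odd (sm K w z) (+) (side z (+) f)) ->
  exists w', [/\ forall e, ~~ F0 e -> w' e = w e,
    forall e x, x \in Z -> inc K x e -> w' e = w e,
    forall x, x \in Z -> sm K w' x = sm K w x
    & forall x, x \in vs K -> x \notin Z -> odd (sm K w' x) = side x (+) f].
Proof.
move=> nK Zv rK rZ low Zok.
pose tau x := side x (+) f.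
have [|w' [w1 w2 w3]] := @toggle_fix V E side K wfK (vs K :\: Z) F0 r l _ w tau.
  move=> x; rewrite inE => /andP[xZ xK] xr.
  have [e [y [Fe eK exy yZ ly]]] := low x xK xZ xr.
  by exists e, y; split=> //; rewrite inE yZ; have [] := joins_vs wfK eK exy.
have wZ x : x \in Z -> sm K w' x = sm K w x by move=> xZ; apply: w3; rewrite inE xZ.
have right_nr x : x \in vs K -> x \notin Z -> x != r -> odd (sm K w' x) = tau x.
  by move=> xK xZ xr; apply: w2 => //; rewrite inE xZ.
have right x : x \in vs K -> x \notin Z -> odd (sm K w' x) = tau x.
  move=> xK xZ; have [->|] := eqVneq x r; last exact: right_nr.
  have vn0 : vs K != set0 by apply/set0Pn; exists r.
  have : \big[addb/false]_(y in vs K) (odd (sm K w' y) (+) tau y).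
    rewrite big_split /=; have := nonprop_kappa f vn0 nK; rewrite -(sum_parity wfK w').
    have ne (a b : bool) : a != b -> b (+) a by case: a; case: b.
    exact: ne.
  rewrite (big_setID Z) /= (setIidPr Zv).
  have -> : \big[addb/false]_(z in Z) (odd (sm K w' z) (+) tau z) = true.
    by rewrite -[RHS]Zok; apply: eq_bigr => z zZ; rewrite wZ.
  rewrite (bigD1 r) /= ?inE ?rK ?rZ //.
  rewrite [\big[_/_]_(_ in _ | _) _]big1; last first.
    by move=> y /andP[]; rewrite inE => /andP[yZ yK] yr; rewrite right_nr // addbb.
  by case: (odd _); case: (tau r).
exists w'; split=> //.
- by move=> e Fe; apply: w1; rewrite /inner (negbTE Fe).
move=> e x xZ ie; apply: w1; apply/negP => /and4P[_ _]; rewrite !inE.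
by case/orP: ie => /eqP <-; rewrite xZ.
Qed.

Lemma nonprop_bad w : ~ kprop K -> exists e x y,
  [/\ e \in es K, joins K e x y, ~~ ok K w e & odd (sm K w x) = odd (sm K w y)].
Proof.
move=> nK; have [e eK nok] : exists2 e, e \in es K & ~~ ok K w e.
  apply/exists_inP; apply: contraT => /exists_inPn allok; case: nK; exists w => e eK.
  by have := allok e eK; rewrite negbK.
exists e, (src K e), (dst K e); have js := joins_src_dst K e; split=> //.
by apply/eqP; apply: contraR nok; apply: ok_parity.
Qed.

(* Without a good weighting the number of vertices of wrong parity is always odd, so a weighting
   around [Z] in which only [h] has the wrong parity extends to one where all other vertices are
   right; a violated edge is then incident with [h]. *)
Lemma nonprop_extend (Z : {set V}) (F0 : pred E) r (l : V -> nat) h w :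
  ~ kprop K -> Z \subset vs K -> h \in Z -> r \in vs K -> r \notin Z ->
  (forall x, x \in vs K -> x \notin Z -> x != r ->
     exists e y, [/\ F0 e, e \in es K, joins K e x y, y \notin Z & l y < l x]) ->
  (forall z, z \in Z -> z != h -> odd (sm K w z) = odd (sm K w h) (+) (side z == side h)) ->
  exists w', [/\ forall e, ~~ F0 e -> w' e = w e,
    forall e x, x \in Z -> inc K x e -> w' e = w e,
    forall x, x \in Z -> sm K w' x = sm K w x,
    forall x, x \in vs K -> x != h ->
      odd (sm K w' x) = odd (sm K w h) (+) (side x == side h)
    & exists e x, [/\ e \in es K, joins K e h x & ~~ ok K w' e]].
Proof.
move=> nK Zv hZ rK rZ low Zok.
have hK : h \in vs K by apply: (subsetP Zv).
(* With this [f] exactly [h] is off the pattern within [Z]. *)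
pose f := ~~ odd (sm K w h) (+) side h.
have fE x : side x (+) f = odd (sm K w h) (+) (side x == side h).
  by rewrite /f; case: (side x); case: (side h); case: (odd _).
have [|w' [w1 w2 w3 w4]] := nonprop_extend_gen (F0 := F0) (r := r) (l := l) (f := f) (w := w) nK Zv rK rZ low.
  rewrite (bigD1 h) //= big1; last by move=> z /andP[zZ zh]; rewrite Zok // fE addbb.
  by rewrite fE eqxx; case: (odd _).
have right x : x \in vs K -> x != h ->
    odd (sm K w' x) = odd (sm K w h) (+) (side x == side h).
  by move=> xK xh; case xZ: (x \in Z); [rewrite w3 // Zok | rewrite -fE w4 // xZ].
exists w'; split=> //.
have [e [x [y [eK exy nok par]]]] := nonprop_bad w' nK.
have [xK yK] := joins_vs wfK eK exy.
have [xh|xh] := eqVneq x h; first by exists e, y; rewrite -xh.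
have [yh|yh] := eqVneq y h; first by exists e, x; rewrite -yh joinsC.
move: par; rewrite !right // (joins_side wfK eK exy).
by case: (side y); case: (side h); case: (odd _).
Qed.
End Levels.

(** * Configurations around a vertex *)

Lemma neqS n : n <> n.+1. Proof. lia. Qed.
Lemma neqSS n : n <> n.+2. Proof. lia. Qed.
Lemma in_set3 (T : finType) (a b c x : T) :
  (x \in [set a; b; c]) = [|| x == a, x == b | x == c].
Proof. by rewrite !inE -orbA. Qed.

(** Meant for two captives with [s] common neighbours, degrees [D0], [D1], numbers [o0], [o1] of
    non-plain edges, and exactly [D - 2] plain edges to each neighbour. Since [s * (D - 2)] is at
    most [D], degrees are at most 4 and [s] at most 3; the parities then exclude [s = 3]. *)
Lemma captive_pair_arith s D0 D1 o0 o1 : 1 < s -> 2 < D0 -> 2 < D1 ->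
  D0 = s * (D0 - 2) + o0 -> D1 = s * (D1 - 2) + o1 ->
  odd o1 = odd D0 -> odd o0 = odd D1 ->
  ~~ odd (s * (D1 - 2)) /\ (D1 = 4 \/ (s = 2 /\ D1 = 3)).
Proof.
move=> s2 D03 D13 E0 E1 p1 p2.
have l0 : s * (D0 - 2) <= D0 by rewrite {2}E0 leq_addr.
have l1 : s * (D1 - 2) <= D1 by rewrite {2}E1 leq_addr.
have a0 : D0 <= 4 by nia.
have a1 : D1 <= 4 by nia.
have s3 : s <= 3 by nia.
have [d0|d0] : D0 = 3 \/ D0 = 4 by lia.
all: have [d1|d1] : D1 = 3 \/ D1 = 4 by lia.
all: have [ss|ss] : s = 2 \/ s = 3 by lia.
all: subst; rewrite ?mul2n in E0 E1 *; try (exfalso; lia); split; auto; lia.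
Qed.

Lemma two_of (T : finType) (A : {set T}) : 1 < #|A| -> exists x y, [/\ x \in A, y \in A & x != y].
Proof.
move=> A2; have [x xA] : exists x, x \in A by apply/set0Pn; rewrite -card_gt0 ltnW.
have : A :\ x != set0 by rewrite -card_gt0; move: A2; rewrite (cardsD1 x) xA.
by case/set0Pn => y; rewrite in_setD1 => /andP[yx yA]; exists x, y; rewrite eq_sym.
Qed.

Section Config.
Variables (V E : finType) (side : V -> bool).
Variable (K : lgraph V E).
Hypothesis wfK : wf side K.
Implicit Types (w : E -> bool) (x y u v h : V) (e : E).

(* The value of [w e] for which [e] has value [b] at its end [x]. *)
Definition pv e x (b : bool) := b (+) (od K e && (x == dst K e)).

Lemma va_pv w e x b : w e = pv e x b -> va K w e x = b.
Proof. by rewrite /va => ->; rewrite /pv -addbA addbb addbF. Qed.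

Lemma sm_ge w x (A : {set E}) : A \subset at_ K x ->
  (forall e, e \in A -> va K w e x) -> #|A| <= sm K w x.
Proof.
move=> Ax Aon; rewrite /sm (big_setID A) /= (setIidPr Ax) -sum1_card.
by apply: leq_trans (leq_addr _ _); apply: leq_sum => e /Aon ->.
Qed.

Lemma sm_card w x (A : {set E}) : A \subset at_ K x ->
  (forall e, e \in at_ K x -> va K w e x = (e \in A)) -> sm K w x = #|A|.
Proof.
move=> Ax Aon; rewrite /sm (big_setID A) /= (setIidPr Ax) -sum1_card.
rewrite [X in _ + X]big1 ?addn0; last first.
  by move=> e; rewrite inE => /andP[eA /Aon ->]; rewrite (negbTE eA).
by apply: eq_bigr => e eA; rewrite Aon ?eA //; apply: (subsetP Ax).
Qed.

Lemma sm_ge1 w x e : e \in at_ K x -> va K w e x -> 0 < sm K w x.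
Proof.
move=> ex on; rewrite -(cards1 e); apply: sm_ge; first by rewrite sub1set.
by move=> e'; rewrite inE => /eqP ->.
Qed.

Lemma sm_ge2 w x e e' : e != e' -> e \in at_ K x -> e' \in at_ K x ->
  va K w e x -> va K w e' x -> 1 < sm K w x.
Proof.
move=> ne ex e'x on on'; have <- : #|[set e; e']| = 2 by rewrite cards2 ne.
apply: sm_ge; first by apply/subsetP => f; rewrite in_set2 => /orP[] /eqP ->.
by move=> f; rewrite in_set2 => /orP[] /eqP ->.
Qed.

Lemma card_at_ge2 x : x \in vs K -> vs K != [set x] -> 1 < #|at_ K x|.
Proof.
move=> xK nx; apply: (@leq_trans #|cut K [set x]|).
  apply: (wf_cut wfK); [by rewrite sub1set | | by rewrite eq_sym].
  by apply/set0Pn; exists x; rewrite inE.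
apply: subset_leq_card; apply/subsetP => e; rewrite !inE /inc => /andP[-> ne] /=.
by move: ne; rewrite ![x == _]eq_sym; case: (src K e == x); case: (dst K e == x).
Qed.

Lemma other_in (A : {set E}) e : 1 < #|A| -> exists2 e', e' \in A & e' != e.
Proof.
move=> A2; have : A :\ e != set0.
  by rewrite -card_gt0; have := cardsD1 e A; case: (e \in A) => /=; lia.
by case/set0Pn => e'; rewrite !inE => /andP[]; exists e'.
Qed.

Lemma even_plain e : plain K e -> od K e = false.
Proof. by case/(wf_plain wfK)/andP => _ /negbTE. Qed.

(* If some edge at [h] is even, [h] gets sum 1 and [t] an odd sum at least 3; otherwise [h] gets
   sum 2 and [t] a positive even sum. *)
Lemma case_one_nbr h t : ~ kprop K -> h \in vs K -> 2 < #|vs K| ->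
  (forall e, e \in at_ K h -> joins K e h t) -> False.
Proof.
move=> nK hK v3 ht.
have nvh : vs K != [set h] by apply: contraTneq v3 => ->; rewrite cards1.
have deg2 := card_at_ge2 hK nvh.
have [e0 e0h] : exists e, e \in at_ K h by apply/set0Pn; rewrite -card_gt0; lia.
have [_ tK] := joins_vs wfK (at_es e0h) (ht _ e0h).
have htn : h != t := joins_neq wfK (at_es e0h) (ht _ e0h).
have [g gt gh] : exists2 g, g \in at_ K t & g \notin at_ K h.
  have [||| g] := @cut_nonempty V E side K wfK [set h; t].
  - by apply/subsetP => x; rewrite !inE => /orP[] /eqP ->.
  - by apply/set0Pn; exists h; rewrite !inE eqxx.
  - by apply: contraTneq v3 => <-; rewrite cards2; case: (_ != _).
  case/(cutP wfK) => x [y [gK gxy]]; rewrite !inE => xht /andP[yht yK].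
  have gnh : g \notin at_ K h.
    apply/negP => gh; have gj := ht _ gh.
    have := joins_or gj (joins_inc (etrans (joinsC K g y x) gxy)).
    by rewrite (negbTE yht).
  exists g => //; case/orP: xht => /eqP xE; last by rewrite -xE; apply: joins_at gxy.
  by case/negP: gnh; rewrite -xE; apply: joins_at gxy.
(* The edge [g] is going to be forced on at [t], so the descent has to avoid it. *)
have [|l [l0 ll _]] := levels_exist wfK (F := predC1 g) tK.
  move=> S SK tS Sn.
  have [|e eS eg] := @other_in (cut K S) g; last by exists e.
  by apply: (wf_cut wfK) => //; apply/set0Pn; exists t.
pose ev := [pick e in at_ K h | ~~ od K e].
have [e1 e1h e1n] : exists2 e1, e1 \in at_ K h & e1 != e0 by apply: other_in.
pose A : {set E} := if ev is Some e then [set e] else [set e0; e1].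
pose w e := if e \in at_ K h then pv e h (e \in A) else if e == g then pv g t true else false.
have low x : x \in vs K -> x \notin [set h] -> x != t ->
  exists e y, [/\ predC1 g e, e \in es K, joins K e x y, y \notin [set h] & l y < l x].
  move=> xK _ xt; have [e [y [eg eK exy ly]]] := ll x xK xt.
  exists e, y; split=> //; rewrite inE; apply: contraNneq xt => yh.
  rewrite yh joinsC in exy; have eh := joins_at eK exy.
  by rewrite (joins_inj wfK eK exy (ht _ eh)).
have AH : A \subset at_ K h.
  rewrite /A /ev; case: pickP => [e /andP[eh _]|_]; first by rewrite sub1set.
  by apply/subsetP => e; rewrite in_set2 => /orP[] /eqP ->.
have vah e : e \in at_ K h -> va K w e h = (e \in A).
  by move=> eh; apply: va_pv; rewrite /w eh.
have smh : sm K w h = #|A| by apply: sm_card.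
have [||||w' [w1 w2 w3 w4 [e [x [eK ehx nok]]]]] := nonprop_extend wfK (Z := [set h]) (h := h) (w := w) nK _ _ tK _ low.
- by rewrite sub1set.
- by rewrite inE.
- by rewrite inE eq_sym.
- by move=> z; rewrite inE => ->.
have eh : e \in at_ K h := joins_at eK ehx.
have xt : x = t := joins_inj wfK eK ehx (ht _ eh); rewrite {x}xt in ehx.
have smh' : sm K w' h = #|A| by rewrite w3 ?inE.
have vah' f : f \in at_ K h -> va K w' f h = (f \in A).
  move=> fh; rewrite -(vah f fh) /va (w2 f h) ?inE //.
  by move: fh; rewrite inE => /andP[].
have vat' f : f \in at_ K h -> va K w' f t = (f \in A) (+) od K f.
  by move=> fh; rewrite (va_other wfK w' (at_es fh) (ht f fh)) vah'.
have gon : va K w' g t.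
  by apply: va_pv; rewrite w1 /= ?eqxx // /w (negbTE gh) eqxx.
have smt : odd (sm K w' t) = odd #|A|.
  rewrite w4 ?(eq_sym t) // smh (joins_side wfK eK ehx).
  by case: (side t) => /=; rewrite addbF.
move: smh' smt vah' vat'; rewrite /A /ev; case: pickP => [e2 /andP[e2h ev2]|allodd] smh' smt vah' vat'.
  rewrite cards1 /= in smh' smt.
  have t2 : 1 < sm K w' t.
    apply: (@sm_ge2 w' t g e2) => //; first by apply: contraNneq gh => ->.
      by apply: (joins_at (at_es e2h)); rewrite joinsC; exact: ht.
    by rewrite vat' // inE eqxx (negbTE ev2).
  have t3 : 2 < sm K w' t by move: smt t2; case: (sm K w' t) => [|[|[|]]].
  case/negP: nok; rewrite (okE w' ehx); case: ifP => _; first by rewrite smh'; apply: contraTneq t3 => <-.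
  by apply/or4P/Or44; case: (va _ _ _ t) => //; apply: ltnW.
rewrite cards2 eq_sym e1n /= in smh' smt.
have t1 : 0 < sm K w' t := sm_ge1 gt gon.
have t2 : 1 < sm K w' t by move: smt t1; case: (sm K w' t) => [|[|]].
have := allodd e; rewrite eh /= => /negbFE oe.
case/negP: nok; rewrite (okE w' ehx); case: ifP => pe; first by rewrite even_plain in oe.
apply/or4P; case eA: (va K w' e h); last by apply: Or43; rewrite smh'.
by apply: Or44; rewrite vat' // oe -vah' // eA.
Qed.

Definition on w x : {set E} := [set e in at_ K x | va K w e x].

Lemma sm_on w x : sm K w x = #|on w x|.
Proof.
apply: sm_card; first by apply/subsetP => e; rewrite inE => /andP[].
by move=> e ex; rewrite inE ex.
Qed.

Lemma sm_at2 w x e1 e2 : at_ K x = [set e1; e2] -> e1 != e2 ->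
  sm K w x = va K w e1 x + va K w e2 x.
Proof. by move=> ax ne; rewrite /sm ax big_setU1 ?inE //= big_set1. Qed.

Lemma sm_at3 w x e1 e2 e3 : at_ K x = [set e1; e2; e3] -> e1 != e2 -> e1 != e3 -> e2 != e3 ->
  sm K w x = va K w e1 x + va K w e2 x + va K w e3 x.
Proof.
move=> ax n12 n13 n23; rewrite /sm ax -setUA big_setU1 /=; last by rewrite !inE negb_or n12.
by rewrite big_setU1 ?inE //= big_set1 addnA.
Qed.

Lemma ends_side e1 e2 x y z : e1 \in es K -> e2 \in es K -> joins K e1 x y ->
  joins K e2 x z -> side y = side z.
Proof.
move=> k1 k2 j1 j2; have := joins_side wfK k1 j1; rewrite (joins_side wfK k2 j2).
by case: (side y); case: (side z).
Qed.

Definition conn_in (A : {set V}) : rel V :=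
  [rel x y | [&& x \in A, y \in A & edge_rel K predT x y]].

Lemma toggle_conn (A : {set V}) x y : connect (conn_in A) x y ->
  exists f : E -> bool, (forall e, f e -> [&& e \in es K, src K e \in A & dst K e \in A]) /\
    forall z, tg K f z = (z == x) (+) (z == y).
Proof.
case/connectP => p; elim: p x => [|x' p IH] x /=.
  by move=> _ ->; exists (fun=> false); split => // z; rewrite /tg big1 // addbb.
case/andP => /and3P[xA x'A /edge_relP[e [eK _ exx]]] pth /(IH _ pth)[f [fA ft]].
exists (fun e' => f e' (+) (e' == e)); split.
  move=> e'; case: eqP => [->|_]; last by rewrite addbF; apply: fA.
  by move=> _; rewrite eK; case/joinsP: exx => -[<- <-]; rewrite xA x'A.
move=> z; rewrite tgD ft (tg1 wfK z eK exx).
by case: (z == x); case: (z == x'); case: (z == y).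
Qed.

(** The edges [g1], [g2] and a path inside [A] form a closed walk through [p]; flipping along it
    preserves all parities and changes at [p] only [g1] and [g2]. *)
Lemma flip_pair (A : {set V}) w p y1 y2 g1 g2 : p \notin A -> y1 \in A -> y2 \in A -> g1 != g2 ->
  g1 \in es K -> g2 \in es K -> joins K g1 p y1 -> joins K g2 p y2 ->
  connect (conn_in A) y1 y2 ->
  exists w', [/\ forall x, odd (sm K w' x) = odd (sm K w x),
    forall e, inc K p e -> w' e = w e (+) ((e == g1) || (e == g2))
    & forall e x, x \notin A -> x != p -> inc K x e -> w' e = w e].
Proof.
move=> pA y1A y2A ng k1 k2 j1 j2 /toggle_conn[f [fA ft]].
exists (fun e => w e (+) ((f e (+) (e == g1)) (+) (e == g2))); split.
- move=> x; rewrite odd_sm_flip !tgD ft (tg1 wfK x k1 j1) (tg1 wfK x k2 j2).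
  by case: (x == y1); case: (x == y2); case: (x == p); rewrite /= ?addbF ?addbT ?negbK.
- move=> e ie; have -> : f e = false.
    by apply/negP => /fA /and3P[_ sA dA]; case/orP: ie => /eqP E1; rewrite -E1 (negbTE pA) in sA dA.
  by case: (eqVneq e g1) => [->|]; rewrite ?(negbTE ng) //=.
move=> e x xA xp ie; have -> : f e = false.
  by apply/negP => /fA /and3P[_ sA dA]; case/orP: ie => /eqP E1; rewrite -E1 (negbTE xA) in sA dA.
have xy (y : V) : y \in A -> x != y by move=> yA; apply: contraNneq xA => ->.
have -> : (e == g1) = false.
  apply/eqP => eg; subst e; have := joins_or j1 ie; rewrite (negbTE xp) /=.
  by rewrite (negbTE (xy _ y1A)).
have -> : (e == g2) = false.
  apply/eqP => eg; subst e; have := joins_or j2 ie; rewrite (negbTE xp) /=.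
  by rewrite (negbTE (xy _ y2A)).
by rewrite /= addbF.
Qed.

End Config.

(** * End blocks of irreducible labelled graphs *)

Section Defs.
Variables (V E : finType).
Implicit Types (K : lgraph V E) (x y u v h : V) (e : E).

Definition pod K u v eu ev :=
  [/\ (eu \in at_ K u) && ~~ inc K v eu, (ev \in at_ K v) && ~~ inc K u ev,
      forall e, e \in at_ K u -> e != eu -> plain K e && joins K e u v
    & forall e, e \in at_ K v -> e != ev -> plain K e && joins K e v u].

(** The first two fields say that no reduction applies. The field [irr_thin] is instead inherited
    from the invariant [thin_inv]. *)
Record irreducible K : Prop := Irreducible {
  irr_relabel : forall e f x y, e \in es K -> f \in es K -> joins K e x y ->
    joins K f x y -> plain K f -> ~~ plain K e -> od K e;
  irr_pod : forall u v eu ev, ~ pod K u v eu ev;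
  irr_thin : forall e x y, e \in es K -> joins K e x y -> ~~ plain K e ->
    ~~ thick K e -> 2 < #|at_ K x| \/ 2 < #|at_ K y|
}.
End Defs.

Section EndBlock.
Variables (V E : finType) (side : V -> bool).
Variable (K : lgraph V E).
Hypothesis wfK : wf side K.
Hypothesis irrK : irreducible K.
Hypothesis nK : ~ kprop K.
Implicit Types (w : E -> bool) (x y u v h : V) (e : E).

Hypothesis two_nbrs : forall x y, x \in vs K -> exists e z,
  [/\ e \in at_ K x, joins K e x z & z != y].

(** [Y] stands for an end block without its cut vertex [r], or for all vertices but [r] if there is
    no cut vertex; [l] is the distance from [r]. *)
Variables (r : V) (Y : {set V}) (l : V -> nat).
Hypothesis rK : r \in vs K.
Hypothesis YK : Y \subset vs K.
Hypothesis rY : r \notin Y.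
Hypothesis Ycl : forall e x y, e \in es K -> joins K e x y -> x \in Y -> y \in Y \/ y = r.
Hypothesis l0 : forall x, x \in vs K -> (l x == 0) = (x == r).
Hypothesis ll : forall x, x \in vs K -> x != r ->
  exists e y, [/\ e \in es K, joins K e x y & l x = (l y).+1].
Hypothesis ladj : forall e x y, e \in es K -> joins K e x y ->
  l x = (l y).+1 \/ l y = (l x).+1.

Hypothesis lside : forall x, x \in vs K -> side x = odd (l x) (+) side r.

Definition deep h := h \in Y /\ forall y, y \in Y -> l y <= l h.
Definition up x e := [exists y, joins K e x y && (l y < l x)].

Lemma upP x e y : joins K e x y -> l y < l x -> up x e.
Proof. by move=> exy lt; apply/existsP; exists y; rewrite exy. Qed.

Lemma up_joins x e y : e \in es K -> up x e -> joins K e x y -> l x = (l y).+1.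
Proof.
move=> eK /existsP[z /andP[exz lt]] exy; rewrite (joins_inj wfK eK exy exz).
by case: (ladj eK exz) => // E1; move: lt; rewrite E1 ltnNge leqnSn.
Qed.

Lemma down_joins x e y : e \in es K -> ~~ up x e -> joins K e x y -> l y = (l x).+1.
Proof.
move=> eK nup exy; case: (ladj eK exy) => // E1.
by case/negP: nup; apply: upP exy _; rewrite E1.
Qed.

Lemma deep_vs h : deep h -> h \in vs K.
Proof. by case=> hY _; apply: (subsetP YK). Qed.

Lemma deep_nr h : deep h -> h != r.
Proof. by case=> hY _; apply: contraTneq hY => ->. Qed.

Lemma deep_lvl h e u : deep h -> e \in es K -> joins K e h u -> l h = (l u).+1.
Proof.
move=> [hY hmax] eK ehu; case: (ladj eK ehu) => // lu.
have [uY|ur] := Ycl eK ehu hY; first by have := hmax u uY; rewrite lu ltnn.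
by move: lu; have [_ uK] := joins_vs wfK eK ehu; have := l0 uK; rewrite ur eqxx => /eqP ->.
Qed.

(** If [r] were adjacent to a deepest [h], then [h] would have level 1 and [r] as its only
    neighbour, against [two_nbrs]. *)
Lemma deep_nbr h e u : deep h -> e \in es K -> joins K e h u ->
  [/\ u \in Y, u \in vs K, l h = (l u).+1 & u != r].
Proof.
move=> dh eK ehu; have lu := deep_lvl dh eK ehu; have [_ uK] := joins_vs wfK eK ehu.
have ur : u != r.
  apply/eqP => ur; have [e' [z [e'h ehz /negP[]]]] := two_nbrs r (deep_vs dh).
  have [_ zK] := joins_vs wfK (at_es e'h) ehz.
  rewrite -l0 //; have := deep_lvl dh (at_es e'h) ehz; rewrite lu => -[<-].
  by rewrite l0 // ur.
by split=> //; case: (Ycl eK ehu dh.1) => // /eqP; rewrite (negbTE ur).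
Qed.

Lemma deep_up h e : deep h -> e \in at_ K h -> up h e.
Proof.
move=> dh eh; have [u ehu] := at_joins eh; apply: (upP ehu).
by rewrite (deep_lvl dh (at_es eh) ehu).
Qed.

Lemma up_not_deep h x e y : deep h -> e \in es K -> joins K e x y -> l y < l x -> y != h.
Proof.
move=> dh eK exy lt; apply: contraTneq lt => yh.
by rewrite yh joinsC in exy; rewrite yh (deep_lvl dh eK exy) ltnNge leqnSn.
Qed.

Lemma up_exists x : x \in vs K -> x != r -> exists2 e, e \in at_ K x & up x e.
Proof.
move=> xK xr; have [e [y [eK exy lxy]]] := ll xK xr.
by exists e; [apply: joins_at exy | apply: upP exy _; rewrite lxy].
Qed.

(* The edges in [Fo] can be prescribed without disconnecting the complement of [h]. *)
Definition spared h (Fo : pred E) := forall x, x \in vs K -> x != h -> x != r ->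
  exists e, [/\ e \in at_ K x, up x e & ~~ Fo e].

Lemma spared_low h Fo : deep h -> spared h Fo ->
  forall x, x \in vs K -> x \notin [set h] -> x != r ->
  exists e y, [/\ predC Fo e, e \in es K, joins K e x y, y \notin [set h] & l y < l x].
Proof.
move=> dh sp x xK; rewrite inE => xh xr; have [e [ex /existsP[y /andP[exy lt]] Fe]] := sp x xK xh xr.
exists e, y; split=> //; first exact: at_es ex.
by rewrite inE; apply: up_not_deep dh (at_es ex) exy lt.
Qed.

(** Every vertex other than [h] still descends to [r] outside [Fo], and the descent never enters [h]
    because [h] is deepest. *)
Lemma nonprop_one h Fo w : deep h -> spared h Fo ->
  exists w', [/\ forall e, Fo e -> w' e = w e,
    forall e, e \in at_ K h -> w' e = w e,
    sm K w' h = sm K w h,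
    forall x, x \in vs K -> side x != side h -> odd (sm K w' x) = odd (sm K w h)
    & exists e x, [/\ e \in es K, joins K e h x & ~~ ok K w' e]].
Proof.
move=> dh sp.
have [||||w' [w1 w2 w3 w4 w5]] := nonprop_extend wfK (Z := [set h]) (h := h) (w := w) nK _ _ rK _ (spared_low dh sp).
- by rewrite sub1set deep_vs.
- by rewrite inE.
- by rewrite inE eq_sym deep_nr.
- by move=> z; rewrite inE => ->.
exists w'; split=> //.
- by move=> e Fe; apply: w1; rewrite /= Fe.
- by move=> e; rewrite inE => /andP[_]; apply: w2; rewrite inE.
- by rewrite w3 ?inE.
move=> x xK xh; rewrite w4 ?(negbTE xh) ?addbF //.
by apply: contraNneq xh => ->.
Qed.

(* The forced edges make the sums of both neighbours of [h] too large for a conflict. *)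
Lemma degree_two_config h (v w : V) (ev ew gv gw : E) : deep h -> v != w ->
  at_ K h = [set ev; ew] -> joins K ev h v -> joins K ew h w ->
  (thick K ev \/ (gv \in at_ K v /\ gv \notin at_ K h)) ->
  (thick K ew \/ (gw \in at_ K w /\ gw \notin at_ K h)) ->
  spared h (pred2 gv gw) -> False.
Proof.
move=> dh nvw ath jv jw dv dw sp.
have evh : ev \in at_ K h by rewrite ath !inE eqxx.
have ewh : ew \in at_ K h by rewrite ath !inE eqxx orbT.
have nev : ev != ew.
  by apply: contraNneq nvw => eE; rewrite -eE in jw; apply/eqP; exact: (joins_inj wfK (at_es evh) jv jw).
pose d := od K ev != od K ew.
(* With these values at [h] both edges have value [d] at their other ends, and the sum of [h] has
   parity [d]; it is at most 1 if one of the edges is plain. *)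
pose b e := d (+) od K e.
pose wt e := if e \in at_ K h then pv K e h (b e)
  else if inc K v e then pv K e v true else pv K e w true.
have [w' [w1 w2 w3 w4 [e [x [eK ehx nok]]]]] := nonprop_one wt dh sp.
have vah f : f \in at_ K h -> va K w' f h = b f.
  by move=> fh; apply: va_pv; rewrite w2 // /wt fh.
have smh : sm K w' h = b ev + b ew.
  rewrite /sm ath big_setU1 ?inE //= big_set1 !vah //.
have odh : odd (sm K w' h) = d.
  by rewrite smh /b /d; case: (od K ev); case: (od K ew).
(* The sum of [u] has parity [d] and contains [d] from [f] and 1 from the forced edge, so it is at
   least [d + 2]. *)
have key f u g : f \in at_ K h -> joins K f h u -> g \in at_ K u -> g \notin at_ K h ->
    va K w' g u -> d.+1 < sm K w' u.
  move=> fh fhu gu gh gon.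
  have fu : f \in at_ K u by exact: joins_atr (at_es fh) fhu.
  have vfu : va K w' f u = d.
    by rewrite (va_other wfK w' (at_es fh) fhu) vah // /b -addbA addbb addbF.
  have par : odd (sm K w' u) = d.
    rewrite w4 -?w3 //; first by have [] := joins_vs wfK (at_es fh) fhu.
    by rewrite (joins_side wfK (at_es fh) fhu); case: (side u).
  have fg : f != g by apply: contraNneq gh => <-.
  move: par vfu; case: (d) => par vfu.
    by have := sm_ge2 fg fu gu vfu gon; move: par; case: (sm K w' u) => [|[|[|]]].
  by have := sm_ge1 gu gon; move: par; case: (sm K w' u) => [|[|]].
have fin f u : f \in at_ K h -> joins K f h u -> d.+1 < sm K w' u -> ok K w' f.
  move=> fh fhu lt; rewrite (okE w' fhu); case: ifP => pf.
    have : sm K w' h <= 1; last first.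
      by move=> h1; apply: contraTneq lt => <-; rewrite -leqNgt (leq_trans h1).
    move: fh; rewrite smh ath in_set2 /b /d => /orP[] /eqP fE; rewrite fE in pf;
      by rewrite (even_plain wfK pf); case: (od K _).
  apply/or4P/Or44.
  by rewrite (va_other wfK w' (at_es fh) fhu) vah // /b -addbA addbb addbF.
move/negP: nok; apply; have eh := joins_at eK ehx.
move: (eh); rewrite ath in_set2 => /orP[] /eqP eE; subst e.
  case: dv => [/(ok_thick wfK w') //|[gvv gvh]]; apply: (fin _ _ eh jv).
  apply: (key _ _ gv eh jv gvv gvh); apply: va_pv.
  by rewrite w1 /= ?eqxx // /wt (negbTE gvh); move: gvv; rewrite inE => /andP[_ ->].
case: dw => [/(ok_thick wfK w') //|[gww gwh]]; apply: (fin _ _ eh jw).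
apply: (key _ _ gw eh jw gww gwh); apply: va_pv.
rewrite w1 /= ?eqxx ?orbT // /wt (negbTE gwh); case: ifP => // gv'.
have [y gwy] := at_joins gww.
have := joins_or gwy gv'; rewrite (negbTE nvw) /= => /eqP yv.
have := joins_side wfK (at_es gww) gwy; rewrite -yv.
have := joins_side wfK (at_es evh) jv; rewrite (joins_side wfK (at_es ewh) jw).
by case: (side v); case: (side w).
Qed.
Lemma deg2_fin h (ev ew : E) w f u : at_ K h = [set ev; ew] -> ev != ew ->
  (forall e, e \in at_ K h -> va K w e h = (od K ev != od K ew) (+) od K e) ->
  f \in at_ K h -> joins K f h u -> (od K ev != od K ew).+1 < sm K w u -> ok K w f.
Proof.
move=> ath ne vah fh fhu lt.
have evh : ev \in at_ K h by rewrite ath !inE eqxx.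
have ewh : ew \in at_ K h by rewrite ath !inE eqxx orbT.
rewrite (okE w fhu); case: ifP => pf.
  have : sm K w h <= 1; last first.
    by move=> h1; apply: contraTneq lt => <-; rewrite -leqNgt (leq_trans h1).
  rewrite (sm_at2 _ ath ne) !vah //.
  move: fh; rewrite ath in_set2 => /orP[] /eqP fE; rewrite fE in pf;
    by rewrite (even_plain wfK pf); case: (od K _).
apply/or4P/Or44.
by rewrite (va_other wfK w (at_es fh) fhu) vah // -addbA addbb addbF.
Qed.

(** * Twins: two deepest vertices of degree two with the same neighbours *)

Hypothesis noncut : forall x r', x \in Y -> r' \in vs K -> r' != x ->
  exists l' : V -> nat, forall y, y \in vs K -> y != x -> y != r' ->
  exists e z, [/\ e \in es K, joins K e y z, z != x & l' z < l' y].

(** A 4-cycle [h], [v], [c], [v'] in which [v] and [v'] have just one further edge each, leading up.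
    Forcing further edges at [v] and at [v'] then either takes an edge up or isolates [c], so
    [degree_two_config] does not apply. *)
Record twin (h c v v' : V) (ev ev' gv gv' uv uv' : E) (p p' : V) : Prop := Twin {
  tw_h : deep h;
  tw_c : deep c;
  tw_hc : h != c;
  tw_v : v != v';
  tw_ath : at_ K h = [set ev; ev'];
  tw_atc : at_ K c = [set gv; gv'];
  tw_atv : at_ K v = [set ev; gv; uv];
  tw_atv' : at_ K v' = [set ev'; gv'; uv'];
  tw_ev : joins K ev h v;
  tw_ev' : joins K ev' h v';
  tw_gv : joins K gv c v;
  tw_gv' : joins K gv' c v';
  tw_uv : joins K uv v p;
  tw_uv' : joins K uv' v' p';
  tw_p : l v = (l p).+1;
  tw_p' : l v' = (l p').+1
}.

Lemma twin_sym h c v v' ev ev' gv gv' uv uv' p p' :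
  twin h c v v' ev ev' gv gv' uv uv' p p' -> twin h c v' v ev' ev gv' gv uv' uv p' p.
Proof. by case=> *; split=> //; rewrite 1?eq_sym // setUC. Qed.

Section Twin.
Variables (h c v v' : V) (ev ev' gv gv' uv uv' : E) (p p' : V).
Hypothesis tw : twin h c v v' ev ev' gv gv' uv uv' p p'.

Let dh := tw_h tw.
Let dc := tw_c tw.

Let evh : ev \in at_ K h. Proof. by rewrite (tw_ath tw) !inE eqxx. Qed.
Let ev'h : ev' \in at_ K h. Proof. by rewrite (tw_ath tw) !inE eqxx ?orbT. Qed.
Let gvc : gv \in at_ K c. Proof. by rewrite (tw_atc tw) !inE eqxx. Qed.
Let gv'c : gv' \in at_ K c. Proof. by rewrite (tw_atc tw) !inE eqxx ?orbT. Qed.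
Let evv : ev \in at_ K v. Proof. by rewrite (tw_atv tw) !inE eqxx ?orbT. Qed.
Let gvv : gv \in at_ K v. Proof. by rewrite (tw_atv tw) !inE eqxx ?orbT. Qed.
Let uvv : uv \in at_ K v. Proof. by rewrite (tw_atv tw) !inE eqxx ?orbT. Qed.
Let ev'v' : ev' \in at_ K v'. Proof. by rewrite (tw_atv' tw) !inE eqxx ?orbT. Qed.
Let gv'v' : gv' \in at_ K v'. Proof. by rewrite (tw_atv' tw) !inE eqxx ?orbT. Qed.
Let uv'v' : uv' \in at_ K v'. Proof. by rewrite (tw_atv' tw) !inE eqxx ?orbT. Qed.

Let lhv : l h = (l v).+1. Proof. exact: deep_lvl dh (at_es evh) (tw_ev tw). Qed.
Let lhv' : l h = (l v').+1. Proof. exact: deep_lvl dh (at_es ev'h) (tw_ev' tw). Qed.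
Let lcv : l c = (l v).+1. Proof. exact: deep_lvl dc (at_es gvc) (tw_gv tw). Qed.

Let hK := deep_vs dh.
Let cK := deep_vs dc.
Let vK : v \in vs K. Proof. by have [] := joins_vs wfK (at_es evh) (tw_ev tw). Qed.
Let v'K : v' \in vs K. Proof. by have [] := joins_vs wfK (at_es ev'h) (tw_ev' tw). Qed.
Let pK : p \in vs K. Proof. by have [] := joins_vs wfK (at_es uvv) (tw_uv tw). Qed.
Let p'K : p' \in vs K. Proof. by have [] := joins_vs wfK (at_es uv'v') (tw_uv' tw). Qed.
Let vY : v \in Y. Proof. by have [] := deep_nbr dh (at_es evh) (tw_ev tw). Qed.
Let v'Y : v' \in Y. Proof. by have [] := deep_nbr dh (at_es ev'h) (tw_ev' tw). Qed.

Let sv : side v = ~~ side h.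
Proof. by rewrite (joins_side wfK (at_es evh) (tw_ev tw)) negbK. Qed.
Let sv' : side v' = ~~ side h.
Proof. by rewrite (joins_side wfK (at_es ev'h) (tw_ev' tw)) negbK. Qed.
Let sc : side c = side h.
Proof. by rewrite (joins_side wfK (at_es gvc) (tw_gv tw)) sv negbK. Qed.
Let sp : side p = side h.
Proof.
have := joins_side wfK (at_es uvv) (tw_uv tw); rewrite sv.
by case: (side h); case: (side p).
Qed.

Let lneq x y : l x <> l y -> x != y. Proof. by move=> lxy; apply/eqP => xy; rewrite xy in lxy. Qed.
Let hv : h != v. Proof. by apply: lneq; rewrite lhv => /eqP; rewrite eqn_leq ltnn. Qed.
Let hv' : h != v'. Proof. by apply: lneq; rewrite lhv' => /eqP; rewrite eqn_leq ltnn. Qed.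
Let cv : c != v. Proof. by apply: lneq; rewrite lcv => /eqP; rewrite eqn_leq ltnn. Qed.
Let cv' : c != v'. Proof. by apply: lneq; rewrite lcv -lhv lhv' => /eqP; rewrite eqn_leq ltnn. Qed.
Let ph : p != h. Proof. by apply: lneq; rewrite lhv (tw_p tw); exact: neqSS. Qed.
Let pc : p != c. Proof. by apply: lneq; rewrite lcv (tw_p tw); exact: neqSS. Qed.
Let pv_ : p != v. Proof. by apply: lneq; rewrite (tw_p tw); exact: neqS. Qed.
Let pv' : p != v'.
Proof. by apply/eqP => pE; move: sp; rewrite pE sv'; case: (side h). Qed.

Let not_inc e x y z : joins K e x y -> z != x -> z != y -> ~~ inc K z e.
Proof. by move=> j zx zy; apply/negP => /(joins_or j); rewrite (negbTE zx) (negbTE zy). Qed.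
Let eneq e f x : inc K x e -> ~~ inc K x f -> e != f.
Proof. by move=> ie; apply: contraNneq => <-. Qed.
Let at_inc e x : e \in at_ K x -> inc K x e. Proof. by rewrite inE => /andP[]. Qed.

Let n_evev' : ev != ev'.
Proof.
by apply: (eneq (at_inc evv)); apply: (not_inc (tw_ev' tw)); rewrite ?(tw_v tw) // eq_sym.
Qed.
Let n_gvgv' : gv != gv'.
Proof.
by apply: (eneq (at_inc gvv)); apply: (not_inc (tw_gv' tw)); rewrite ?(tw_v tw) // eq_sym.
Qed.
Let n_evgv : ev != gv.
Proof. by apply: (eneq (at_inc evh)); apply: (not_inc (tw_gv tw)); rewrite ?(tw_hc tw). Qed.
Let n_ev'gv' : ev' != gv'.
Proof. by apply: (eneq (at_inc ev'h)); apply: (not_inc (tw_gv' tw)); rewrite ?(tw_hc tw). Qed.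
Let n_evuv : ev != uv.
Proof. by apply: (eneq (at_inc evh)); apply: (not_inc (tw_uv tw)) => //; rewrite eq_sym. Qed.
Let n_gvuv : gv != uv.
Proof. by apply: (eneq (at_inc gvc)); apply: (not_inc (tw_uv tw)) => //; rewrite eq_sym. Qed.
Let hp' : h != p'. Proof. by apply: lneq; rewrite lhv' (tw_p' tw) => /esym; exact: neqSS. Qed.
Let cp' : c != p'. Proof. by apply: lneq; rewrite lcv -lhv lhv' (tw_p' tw) => /esym; exact: neqSS. Qed.
Let n_ev'uv' : ev' != uv'.
Proof. by apply: (eneq (at_inc ev'h)); apply: (not_inc (tw_uv' tw)) => //. Qed.
Let n_gv'uv' : gv' != uv'.
Proof. by apply: (eneq (at_inc gv'c)); apply: (not_inc (tw_uv' tw)) => //. Qed.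

Definition Ztw : {set V} := [set h; c; v; v'].

Lemma inZtw x : (x \in Ztw) = [|| x == h, x == c, x == v | x == v'].
Proof. by rewrite !inE -!orbA. Qed.

Lemma Ztw_sub : Ztw \subset vs K.
Proof. by apply/subsetP => x; rewrite inZtw => /or4P[] /eqP ->. Qed.

Lemma rZtw : r \notin Ztw.
Proof.
have YZ x : x \in Y -> r != x by move=> xY; apply: contraNneq rY => ->.
by rewrite inZtw !negb_or !YZ // ?dh.1 ?dc.1.
Qed.

Lemma Ztw_nbr e x y : e \in es K -> joins K e x y -> x \in Ztw ->
  y \in Ztw \/ (e = uv /\ x = v /\ y = p) \/ (e = uv' /\ x = v' /\ y = p').
Proof.
move=> eK exy; have ex := joins_at eK exy.
have J f z : joins K f x z -> e = f -> y = z.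
  by move=> jf ef; rewrite -ef in jf; apply: (joins_inj wfK eK exy jf).
rewrite inZtw => /or4P[] /eqP xE; subst x.
- move: ex; rewrite (tw_ath tw) in_set2 => /orP[] /eqP ef; left; rewrite inZtw.
    by rewrite (J _ _ (tw_ev tw) ef) eqxx !orbT.
  by rewrite (J _ _ (tw_ev' tw) ef) eqxx !orbT.
- move: ex; rewrite (tw_atc tw) in_set2 => /orP[] /eqP ef; left; rewrite inZtw.
    by rewrite (J _ _ (tw_gv tw) ef) eqxx !orbT.
  by rewrite (J _ _ (tw_gv' tw) ef) eqxx !orbT.
- move: ex; rewrite (tw_atv tw) in_set3 => /or3P[] /eqP ef.
  + left; rewrite inZtw; have := tw_ev tw; rewrite joinsC => /J ->; rewrite ?eqxx //.
  + left; rewrite inZtw; have := tw_gv tw; rewrite joinsC => /J ->; rewrite ?eqxx ?orbT //.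
  by right; left; split=> //; split=> //; apply: J (tw_uv tw) ef.
move: ex; rewrite (tw_atv' tw) in_set3 => /or3P[] /eqP ef.
- left; rewrite inZtw; have := tw_ev' tw; rewrite joinsC => /J ->; rewrite ?eqxx //.
- left; rewrite inZtw; have := tw_gv' tw; rewrite joinsC => /J ->; rewrite ?eqxx ?orbT //.
by right; right; split=> //; split=> //; apply: J (tw_uv' tw) ef.
Qed.

Lemma Ztw_low x : x \in vs K -> x \notin Ztw -> x != r ->
  exists e y, [/\ predT e, e \in es K, joins K e x y, y \notin Ztw & l y < l x].
Proof.
move=> xK xZ xr; have [e [y [eK exy lxy]]] := ll xK xr.
exists e, y; split=> //; last by rewrite lxy.
apply/negP => yZ; move: (exy); rewrite joinsC => eyx.
case: (Ztw_nbr eK eyx yZ) => [|[[_ [yE xE]]|[_ [yE xE]]]]; first by rewrite (negbTE xZ).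
  by move: lxy; rewrite xE yE (tw_p tw) => /neqSS.
by move: lxy; rewrite xE yE (tw_p' tw) => /neqSS.
Qed.

(* Otherwise the edges around [h], [c], [v], [v'] can be weighted so that only [h] is wrong. *)
Lemma twin_even : od K ev (+) od K ev' = od K gv (+) od K gv'.
Proof.
apply/eqP; apply: contraT => kne; exfalso.
pose d := od K ev != od K ev'.
(* All edges are on at [v] and [v'] except those to [h], which have value [d] there. Both sums
   become [d + 2], [h] gets parity [d], and [c] gets the opposite parity because of [kne]. *)
pose wt e := if inc K v e then pv K e v (if e == ev then d else true)
  else pv K e v' (if e == ev' then d else true).
have vav w e : w e = wt e -> e \in at_ K v -> va K w e v = if e == ev then d else true.
  by move=> we ie; apply: va_pv; rewrite we /wt at_inc.
have nv e : e \in at_ K v' -> ~~ inc K v e.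
  move=> ev1; apply/negP => iv; have [y j] := at_joins ev1.
  have := joins_or j iv; rewrite (negbTE (tw_v tw)) /= => /eqP vy.
  by have := joins_side wfK (at_es ev1) j; rewrite -vy sv sv'; case: (side h).
have vav' w e : w e = wt e -> e \in at_ K v' -> va K w e v' = if e == ev' then d else true.
  by move=> we ie; apply: va_pv; rewrite we /wt (negbTE (nv e ie)).
have sums w : (forall e x, x \in Ztw -> inc K x e -> w e = wt e) ->
  [/\ sm K w v = d.+2, sm K w v' = d.+2, odd (sm K w h) = d,
      odd (sm K w c) = ~~ d & forall e, e \in at_ K h -> va K w e h = d (+) od K e].
  move=> we.
  have wv e : e \in at_ K v -> w e = wt e.
    by move=> ie; apply: (we e v); [rewrite inZtw eqxx !orbT | apply: at_inc].
  have wv' e : e \in at_ K v' -> w e = wt e.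
    by move=> ie; apply: (we e v'); [rewrite inZtw eqxx !orbT | apply: at_inc].
  have vh : va K w ev h = d (+) od K ev.
    have := tw_ev tw; rewrite joinsC => /(va_other wfK w (at_es evh)) ->.
    by rewrite vav ?eqxx // wv.
  have vh' : va K w ev' h = d (+) od K ev'.
    have := tw_ev' tw; rewrite joinsC => /(va_other wfK w (at_es ev'h)) ->.
    by rewrite vav' ?eqxx // wv'.
  have vc : va K w gv c = ~~ od K gv.
    have := tw_gv tw; rewrite joinsC => /(va_other wfK w (at_es gvc)) ->.
    by rewrite vav ?wv // eq_sym (negbTE n_evgv).
  have vc' : va K w gv' c = ~~ od K gv'.
    have := tw_gv' tw; rewrite joinsC => /(va_other wfK w (at_es gv'c)) ->.
    by rewrite vav' ?wv' // eq_sym (negbTE n_ev'gv').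
  split.
  - rewrite (sm_at3 _ (tw_atv tw)) // !vav ?wv // eqxx.
    by rewrite ![_ == ev]eq_sym (negbTE n_evgv) (negbTE n_evuv) -addnA addn2.
  - rewrite (sm_at3 _ (tw_atv' tw)) // !vav' ?wv' // eqxx.
    by rewrite ![_ == ev']eq_sym (negbTE n_ev'gv') (negbTE n_ev'uv') -addnA addn2.
  - rewrite (sm_at2 _ (tw_ath tw)) // vh vh' /d.
    by case: (od K ev); case: (od K ev').
  - rewrite (sm_at2 _ (tw_atc tw)) // vc vc' /d; move: kne.
    by case: (od K ev); case: (od K ev'); case: (od K gv); case: (od K gv').
  by move=> e; rewrite (tw_ath tw) in_set2 => /orP[] /eqP ->.
have [s1 s2 s3 s4 _] := sums wt (fun _ _ _ _ => erefl).
have [||w' [w1 w2 w3 w4 [e [x [eK ehx nok]]]]] := nonprop_extend wfK (h := h) (w := wt) nK Ztw_sub _ rK rZtw Ztw_low.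
- by rewrite inZtw eqxx.
- move=> z; rewrite inZtw => /or4P[] /eqP -> //; rewrite ?eqxx // => _.
  + by rewrite s3 s4 sc eqxx addbT.
  + by rewrite s1 s3 sv /=; case: (side h); case: (d).
  by rewrite s2 s3 sv' /=; case: (side h); case: (d).
have [t1 t2 t3 t4 t5] := sums w' w2.
have eh := joins_at eK ehx; case/negP: nok.
apply: (deg2_fin (tw_ath tw) n_evev' t5 eh ehx); rewrite -/d.
move: (eh); rewrite (tw_ath tw) in_set2 => /orP[] /eqP ef; subst e.
  by rewrite (joins_inj wfK eK ehx (tw_ev tw)) t1.
by rewrite (joins_inj wfK eK ehx (tw_ev' tw)) t2.
Qed.

Let k := od K ev (+) od K ev'.
(** At [v] everything is on; at [v'] the edge up is off and the other two have value [k]. By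
    [twin_even] this [k] makes the sums of [h] and [c] equal to 1, so that within [Ztw] only [v] can
    be the wrong vertex. *)
Let wtA e := if inc K v e then pv K e v true else pv K e v' (k && (e != uv')).
Let agreeA (w : E -> bool) := forall e x, x \in Ztw -> inc K x e -> w e = wtA e.

Let nv e : e \in at_ K v' -> ~~ inc K v e.
Proof.
move=> ev1; apply/negP => iv; have [y j] := at_joins ev1.
have := joins_or j iv; rewrite (negbTE (tw_v tw)) /= => /eqP vy.
by have := joins_side wfK (at_es ev1) j; rewrite -vy sv sv'; case: (side h).
Qed.

Lemma twinA_sums w : agreeA w ->
  [/\ sm K w v = 3, sm K w v' = k + k, sm K w h = 1, sm K w c = 1
    & forall e, e \in at_ K v -> va K w e v] /\ va K w uv' v' = false.
Proof.
move=> we.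
have vav e : e \in at_ K v -> va K w e v.
  move=> ie; apply: va_pv; rewrite (we e v) /wtA ?at_inc //.
  by rewrite inZtw eqxx !orbT.
have vav' e : e \in at_ K v' -> va K w e v' = k && (e != uv').
  move=> ie; apply: va_pv; rewrite (we e v') /wtA ?(negbTE (nv ie)) ?at_inc //.
  by rewrite inZtw eqxx !orbT.
have vh : va K w ev h = ~~ od K ev.
  have := tw_ev tw; rewrite joinsC => /(va_other wfK w (at_es evh)) ->.
  by rewrite vav.
have vh' : va K w ev' h = k (+) od K ev'.
  have := tw_ev' tw; rewrite joinsC => /(va_other wfK w (at_es ev'h)) ->.
  by rewrite vav' // n_ev'uv' andbT.
have vc : va K w gv c = ~~ od K gv.
  have := tw_gv tw; rewrite joinsC => /(va_other wfK w (at_es gvc)) ->.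
  by rewrite vav.
have vc' : va K w gv' c = k (+) od K gv'.
  have := tw_gv' tw; rewrite joinsC => /(va_other wfK w (at_es gv'c)) ->.
  by rewrite vav' // n_gv'uv' andbT.
split; last by rewrite vav' // eqxx andbF.
split=> //.
- by rewrite (sm_at3 _ (tw_atv tw)) // !vav.
- by rewrite (sm_at3 _ (tw_atv' tw)) // !vav' // n_ev'uv' n_gv'uv' eqxx !andbT andbF addn0.
- rewrite (sm_at2 _ (tw_ath tw)) // vh vh' /k.
  by case: (od K ev); case: (od K ev').
rewrite (sm_at2 _ (tw_atc tw)) // vc vc' /k twin_even.
by case: (od K gv); case: (od K gv').
Qed.

Lemma twinA_ok w e : agreeA w -> e \in at_ K v ->
  ok K w e \/ [/\ e = uv, plain K uv & sm K w p = 3].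
Proof.
move=> we ie; have [[s1 s2 s3 s4 s5] _] := twinA_sums we.
have [y j] := at_joins ie.
case pe: (plain K e); last first.
  by left; apply: (ok_rest j); rewrite ?pe // s1; case: (va _ _ _ _).
move: (ie); rewrite (tw_atv tw) in_set3 => /or3P[] /eqP eE; subst e.
- left; rewrite (okE w (tw_ev tw)) s1 s3; case: ifP => // _.
  by rewrite s5 //= !orbT.
- left; rewrite (okE w (tw_gv tw)) s1 s4; case: ifP => // _.
  by rewrite s5 //= !orbT.
have yp : y = p by apply: (joins_inj wfK (at_es ie) j (tw_uv tw)).
case: (eqVneq (sm K w p) 3) => [->|ne]; first by right.
by left; rewrite (okE w (tw_uv tw)) pe s1 eq_sym.
Qed.

(** Some edge at [v] has to fail. Since [v] has sum 3 while [h] and [c] have sum 1, and the other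
    edges at [v] always contribute 2, this can only be a plain edge [uv]. *)
Lemma twinA_fin w : agreeA w ->
  (forall x, x \in vs K -> x != v -> odd (sm K w x) = (side x != side v)) ->
  plain K uv /\ sm K w p = 3.
Proof.
move=> we par; have [e [x [y [eK exy nok pxy]]]] := nonprop_bad w nK.
have [xK yK] := joins_vs wfK eK exy.
suff ev1 : e \in at_ K v.
  by case: (twinA_ok we ev1) => [okk|[_ ? ?] //]; rewrite okk in nok.
have [<-|xv] := eqVneq x v; first exact: joins_at exy.
have [<-|yv] := eqVneq y v; first exact: joins_atr exy.
move: pxy; rewrite !par // (joins_side wfK eK exy).
by case: (side y); case: (side v).
Qed.

Let twinA_par w x : agreeA w -> x \in Ztw -> x != v ->
  odd (sm K w x) = odd (sm K w v) (+) (side x == side v).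
Proof.
move=> we; have [[s1 s2 s3 s4 s5] _] := twinA_sums we.
rewrite inZtw => /or4P[] /eqP ->; rewrite ?eqxx // => _; rewrite s1.
- by rewrite s3 sv; case: (side h).
- by rewrite s4 sv sc; case: (side h).
by rewrite s2 sv sv' eqxx; case: (k).
Qed.

Let vZ : v \in Ztw. Proof. by rewrite inZtw eqxx !orbT. Qed.

Lemma twinA_exists : exists w, [/\ agreeA w,
  forall x, x \in vs K -> x != v -> odd (sm K w x) = (side x != side v)
  & plain K uv /\ sm K w p = 3].
Proof.
have [|w' [w1 w2 w3 w4 _]] := nonprop_extend wfK (h := v) (w := wtA) nK Ztw_sub vZ rK rZtw Ztw_low.
  by move=> z zZ zv; apply: twinA_par.
have ag : agreeA w' by move=> e x xZ ie; apply: (w2 e x).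
have par x : x \in vs K -> x != v -> odd (sm K w' x) = (side x != side v).
  have [[s1 _ _ _ _] _] := twinA_sums (w := wtA) (fun _ _ _ _ => erefl).
  by move=> xK xv; rewrite w4 // s1.
exists w'; split=> //; exact: twinA_fin.
Qed.

Lemma twin_plain : plain K uv.
Proof. by have [w [_ _ []]] := twinA_exists. Qed.

Let ne_p_Z : p \notin Ztw.
Proof. by rewrite inZtw !negb_or ph pc pv_ pv'. Qed.

(** Otherwise [p] lies in [Y] and is no cut vertex, so the edges at [p] can be prescribed as well,
    with [p'] as the new root. Keeping only [uv] on gives [p] the sum 1, whereas [twinA_fin]
    requires 3. *)
Lemma twin_p_ne : p != p' -> p = r.
Proof.
move=> pp'; apply/eqP; apply: contraT => pr; exfalso.
have pY : p \in Y.
  by case: (Ycl (at_es uvv) (tw_uv tw) vY) => // /eqP; rewrite (negbTE pr).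
have p'p : p' != p by rewrite eq_sym.
have [l' low'] := noncut pY p'K p'p.
pose Z := p |: Ztw.
pose wt e := if (e \in at_ K p) && ~~ (e == uv) then pv K e p false else wtA e.
have agr w : (forall e x, x \in Z -> inc K x e -> w e = wt e) -> agreeA w.
  move=> ww e x xZ ie; rewrite (ww e x) //; last by rewrite in_setU1 xZ orbT.
  rewrite /wt; case: ifP => // /andP[ep eu].
  have [y j] := at_joins ep.
  have xy : y = x by have := joins_or j ie; case: eqP => [xp|_ /eqP //]; rewrite xp (negbTE ne_p_Z) in xZ.
  rewrite joinsC xy in j.
  case: (Ztw_nbr (at_es ep) j xZ) => [|[[eE _]|[_ [_ pE]]]]; first by rewrite (negbTE ne_p_Z).
    by rewrite eE eqxx in eu.
  by rewrite pE eqxx in pp'.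
have smp w : (forall e x, x \in Z -> inc K x e -> w e = wt e) -> sm K w p = 1.
  move=> ww; have [[_ _ _ _ s5] _] := twinA_sums (agr w ww).
  have uvp : uv \in at_ K p := joins_atr (at_es uvv) (tw_uv tw).
  rewrite -(cards1 uv); apply: sm_card; first by rewrite sub1set.
  move=> e ep; rewrite inE; case: eqP => [->|eu].
    by rewrite (va_other wfK w (at_es uvv) (tw_uv tw)) s5 // (even_plain wfK twin_plain).
  apply: va_pv; rewrite (ww e p); [|by rewrite setU11 | exact: at_inc ep].
  by rewrite /wt ep; move/eqP: eu => ->.
have agw : agreeA wt by apply: agr.
have smw := smp wt (fun _ _ _ _ => erefl).
have sZ : Z \subset vs K by rewrite subUset sub1set pK Ztw_sub.
have p'Z : p' \notin Z.
  rewrite in_setU1 negb_or p'p inZtw !negb_or (eq_sym p' h) hp' (eq_sym p' c) cp' /=.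
  apply/andP; split; apply/eqP => pE.
    by have := joins_side wfK (at_es uv'v') (tw_uv' tw); rewrite pE sv sv'; case: (side h).
  by have := joins_side wfK (at_es uv'v') (tw_uv' tw); rewrite pE sv'; case: (side h).
have low x : x \in vs K -> x \notin Z -> x != p' ->
    exists e y, [/\ predT e, e \in es K, joins K e x y, y \notin Z & l' y < l' x].
  rewrite in_setU1 negb_or => xK /andP[xp xZ] xp'.
  have [e [z [eK exz zp lz]]] := low' x xK xp xp'.
  exists e, z; split=> //; rewrite in_setU1 (negbTE zp) /=; apply/negP => zZ.
  rewrite joinsC in exz; case: (Ztw_nbr eK exz zZ) => [|[[_ [_ xE]]|[_ [_ xE]]]].
  - by rewrite (negbTE xZ).
  - by rewrite xE eqxx in xp.
  by rewrite xE eqxx in xp'.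
have vZ' : v \in Z by rewrite in_setU1 vZ orbT.
have [[s1 _ _ _ _] _] := twinA_sums agw.
have [|w' [w1 w2 w3 w4 _]] := nonprop_extend wfK (h := v) (w := wt) nK sZ vZ' p'K p'Z low.
  move=> z; rewrite in_setU1 => /orP[/eqP -> _|zZ zv]; last exact: twinA_par.
  by rewrite smw s1 sp sv; case: (side h).
have [|_] := twinA_fin (agr w' w2).
  by move=> x xK xv; rewrite w4 // s1.
by rewrite (smp w' w2).
Qed.

Section SameTop.
Hypothesis pp' : p' = p.
Hypothesis plain' : plain K uv'.

(** The opposite pattern outside: now [h], [c] and [v'] are off, again an odd number, and the only
    edge that can fail is [uv']. It fails only if the sum of [p] is [k + k], and this is positive
    because [uv] is on at [p]. *)
Lemma twinB_fin w : agreeA w ->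
  (forall x, x \in vs K -> x \notin Ztw -> odd (sm K w x) = side x (+) ~~ side v) ->
  sm K w p = 2.
Proof.
move=> we par; have [[s1 s2 s3 s4 s5] s6] := twinA_sums we.
have Zpar x : x \in Ztw -> odd (sm K w x) = (x != v').
  rewrite inZtw => /or4P[] /eqP ->; rewrite ?s1 ?s2 ?s3 ?s4 ?hv' ?cv' ?(tw_v tw) // eqxx.
  by case: (k).
have main e x y : e \in es K -> joins K e x y -> ~~ ok K w e ->
    odd (sm K w x) = odd (sm K w y) -> x \in Ztw -> sm K w p = 2.
  move=> eK exy nok pxy xZ.
  case: (Ztw_nbr eK exy xZ) => [yZ|[[eE [xE yE]]|[eE [xE yE]]]].
  - have ev1 : e \in at_ K v.
      move: pxy; rewrite !Zpar // => pxy.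
      have := joins_side wfK eK exy.
      move: (xZ) (yZ); rewrite !inZtw => /or4P[] /eqP xE /or4P[] /eqP yE;
        rewrite ?xE ?yE ?sc ?sv ?sv' => sxy;
        try (by case: (side h) sxy);
        try (by rewrite -xE; apply: joins_at eK exy);
        try (by rewrite -yE; apply: joins_atr eK exy);
        by move: pxy; rewrite xE yE ?hv' ?cv' eqxx.
    case: (twinA_ok we ev1) => [okk|[eE _ _]]; first by rewrite okk in nok.
    have := joins_inc (tw_uv tw); rewrite -eE => iv.
    have := joins_atr (at_es uvv) (tw_uv tw); rewrite -eE => /at_inc /(joins_or exy).
    by case/orP => /eqP pE; move: xZ yZ; rewrite -pE (negbTE ne_p_Z).
  - move: pxy; rewrite xE yE s1 par ?pK //= sp sv negbK addbb //.
  move: nok; rewrite eE (okE w (tw_uv' tw)) plain' negbK s2 pp' => /eqP kE.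
  have uvp : uv \in at_ K p := joins_atr (at_es uvv) (tw_uv tw).
  have : 0 < sm K w p.
    apply: (sm_ge1 uvp).
    by rewrite (va_other wfK w (at_es uvv) (tw_uv tw)) s5 // (even_plain wfK twin_plain).
  by rewrite -kE; case: (k).
have [e [x [y [eK exy nok pxy]]]] := nonprop_bad w nK.
have [xK yK] := joins_vs wfK eK exy.
case xZ: (x \in Ztw); first exact: main eK exy nok pxy xZ.
case yZ: (y \in Ztw); first by apply: main eK _ nok (esym pxy) yZ; rewrite joinsC.
move: pxy; rewrite !par ?xZ ?yZ // (joins_side wfK eK exy).
by case: (side y); case: (side v).
Qed.

Let A := vs K :\: (p |: Ztw).

Let inA x : (x \in A) = [&& x != p, x \notin Ztw & x \in vs K].
Proof. by rewrite in_setD in_setU1 negb_or -andbA. Qed.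

Let A_nbr e x z : e \in es K -> joins K e x z -> x \in A -> z \in A \/ z = p.
Proof.
move=> eK exz; rewrite !inA => /and3P[xp xZ xK].
have [->|zp] := eqVneq z p; first by right.
have [_ ->] := joins_vs wfK eK exz; left; rewrite andbT /=; apply/negP => zZ.
rewrite joinsC in exz; case: (Ztw_nbr eK exz zZ) => [|[[_ [_ xE]]|[_ [_ xE]]]].
- by rewrite (negbTE xZ).
- by rewrite xE eqxx in xp.
by rewrite xE pp' eqxx in xp.
Qed.

Let p_edge e : e \in at_ K p -> e != uv -> e != uv' -> exists2 y, joins K e p y & y \in A.
Proof.
move=> ep eu eu'; have [y j] := at_joins ep; exists y => //.
have eK := at_es ep; have [_ yK] := joins_vs wfK eK j.
rewrite inA yK eq_sym (joins_neq wfK eK j) andbT /=; apply/negP => yZ.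
rewrite joinsC in j; case: (Ztw_nbr eK j yZ) => [|[[eE _]|[eE _]]].
- by rewrite (negbTE ne_p_Z).
- by rewrite eE eqxx in eu.
by rewrite eE eqxx in eu'.
Qed.

Let uvp : uv \in at_ K p. Proof. exact: joins_atr (at_es uvv) (tw_uv tw). Qed.
Let uv_on w : agreeA w -> va K w uv p.
Proof.
move=> we; have [[_ _ _ _ s5] _] := twinA_sums we.
by rewrite (va_other wfK w (at_es uvv) (tw_uv tw)) s5 // (even_plain wfK twin_plain).
Qed.
Let uv'_off w : agreeA w -> va K w uv' p = false.
Proof.
move=> we; have [_ s6] := twinA_sums we.
by rewrite -pp' (va_other wfK w (at_es uv'v') (tw_uv' tw)) s6 // (even_plain wfK plain').
Qed.
Let pA : p \notin A. Proof. by rewrite inA eqxx. Qed.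
Let ZA x : x \in Ztw -> x \notin A. Proof. by rewrite inA => ->; rewrite andbF. Qed.
Let Zp x : x \in Ztw -> x != p. Proof. by apply: contraTneq => ->. Qed.
Let csym : connect_sym (conn_in K A).
Proof.
apply: sym_connect_sym => x y; rewrite /conn_in /= andbCA; congr (_ && (_ && _)).
by apply/edge_relP/edge_relP => -[e [e1 e2 e3]]; exists e; rewrite joinsC.
Qed.

Let on_p w g : agreeA w -> g \in on K w p :\ uv ->
  exists y, [/\ g \in es K, joins K g p y & y \in A].
Proof.
move=> we; rewrite !inE -/(_ \in at_ K p) => /andP[gu /andP[/andP[gK ip] gon]].
have gp : g \in at_ K p by rewrite inE gK.
have [|y j yA] := p_edge gp gu; last by exists y.
by apply: contraTneq gon => ->; rewrite uv'_off.
Qed.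

(* Both parity patterns leave only one bad value for the sum of [p]. If the two further edges on
   at [p] lead into one component below [p] they can be switched off; otherwise, for the other
   pattern, two edges into a component without on-edges can be switched on. *)
Lemma twin_same_top : False.
Proof.
have [w [we par [_ s3]]] := twinA_exists.
have onu w1 : agreeA w1 -> uv \in on K w1 p by move=> w1e; rewrite inE uvp uv_on.
have /cards2P[g1 [g2 [ng onE]]] : #|on K w p :\ uv| == 2.
  by have := cardsD1 uv (on K w p); rewrite onu // -sm_on s3 add1n => -[<-].
have g1o : g1 \in on K w p :\ uv by rewrite onE !inE eqxx.
have g2o : g2 \in on K w p :\ uv by rewrite onE !inE eqxx orbT.
have [y1 [g1K j1 y1A]] := on_p we g1o.
have [y2 [g2K j2 y2A]] := on_p we g2o.
case cy: (connect (conn_in K A) y1 y2).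
  have [w' [q1 q2 q3]] := flip_pair wfK w pA y1A y2A ng g1K g2K j1 j2 cy.
  have we' : agreeA w'.
    by move=> e x xZ ie; rewrite (q3 e x) ?ZA ?Zp // (we e x).
  have [|_] := twinA_fin we'; first by move=> x xK xv; rewrite q1 par.
  suff -> : sm K w' p = 1 by [].
  rewrite -(cards1 uv); apply: sm_card; first by rewrite sub1set.
  move=> e ep; rewrite inE /va q2 ?at_inc //.
  have [->|eu] := eqVneq e uv.
    have [u1 u2] : uv != g1 /\ uv != g2.
      by split; apply/eqP => uE; [move: g1o | move: g2o]; rewrite -uE !inE eqxx.
    by rewrite (negbTE u1) (negbTE u2) addbF; exact: uv_on.
  have := onE; move/setP/(_ e); rewrite !inE eu -/(_ \in _) /= => eE.
  move: ep; rewrite inE => /andP[eK ie]; move: eE; rewrite eK ie /= => <-.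
  by rewrite -addbA [X in _ (+) X]addbC /va addbA addbb.
have [|w' [_ q2 q3 q4]] := nonprop_extend_gen wfK (F0 := predT) (r := r) (l := l) (f := ~~ side v) (w := wtA) nK Ztw_sub rK rZtw Ztw_low.
  have [[s1 s2 s3' s4 s5] _] := twinA_sums (w := wtA) (fun _ _ _ _ => erefl).
  have wr z : z \in Ztw -> odd (sm K wtA z) (+) (side z (+) ~~ side v) = (z != v).
    rewrite inZtw => /or4P[] /eqP ->.
    - by rewrite s3' sv hv negbK addbb.
    - by rewrite s4 sv sc cv negbK addbb.
    - by rewrite s1 eqxx; case: (side v).
    rewrite s2 sv' sv eq_sym (tw_v tw) negbK.
    by case: (k); case: (side h).
  rewrite (eq_bigr (fun z => z != v)) //.
  rewrite /Ztw -!setUA !big_setU1 ?big_set1 /=; first last.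
  - by rewrite !inE !negb_or (tw_hc tw) hv hv'.
  - by rewrite !inE negb_or cv cv'.
  - by rewrite inE (tw_v tw).
  by rewrite hv cv eqxx eq_sym (tw_v tw).
have we' : agreeA w' by move=> e x xZ ie; apply: (q2 e x).
have s2 := twinB_fin we' q4.
have /cards1P[g onE'] : #|on K w' p :\ uv| == 1.
  by have := cardsD1 uv (on K w' p); rewrite onu // -sm_on s2 add1n => -[<-].
have go : g \in on K w' p :\ uv by rewrite onE' !inE eqxx.
have [y [gK j yA]] := on_p we' go.
(* The vertices [y1] and [y2] lie in different components of [A], so one of them is outside the
   component that [g] enters. *)
have [y0 y0A y0y] : exists2 y0, y0 \in A & ~~ connect (conn_in K A) y0 y.
  case c1: (connect (conn_in K A) y1 y); last by exists y1; rewrite ?c1.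
  exists y2 => //; apply/negP => c2; move/negP: cy; apply.
  by apply: connect_trans c1 _; rewrite csym.
pose C := [set x in A | connect (conn_in K A) y0 x].
(* The component [C] is joined to the rest only through [p], by at least two edges, and all of these
   are off. *)
have C2 : 1 < #|cut K C|.
  apply: (wf_cut wfK).
  - by apply/subsetP => x; rewrite inE inA => /andP[/and3P[]].
  - by apply/set0Pn; exists y0; rewrite inE y0A connect0.
  by apply/eqP => CE; have := pK; rewrite -CE inE (negbTE pA).
have cutC e : e \in cut K C -> exists x, [/\ e \in es K, joins K e p x, x \in C & e != uv /\ e \notin on K w' p].
  case/(cutP wfK) => x [z [eK exz xC]]; rewrite inE => /andP[zC zK].
  have xA : x \in A by move: xC; rewrite inE => /andP[].
  have zp : z = p.
    case: (A_nbr eK exz xA) => // zA; case/negP: zC; rewrite inE zA.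
    move: xC; rewrite inE => /andP[_ cx]; apply: connect_trans cx (connect1 _).
    by rewrite /conn_in /= xA zA; apply/edge_relP; exists e.
  rewrite zp joinsC in exz; exists x; split=> //.
  have eu : e != uv.
    apply/eqP => eE; subst e; have := joins_inj wfK eK exz (etrans (joinsC K uv p v) (tw_uv tw)).
    by move=> xv; move: xA; rewrite xv inA vZ andbF.
  split=> //; apply/negP => eo.
  have : e \in on K w' p :\ uv by rewrite in_setD1 eu.
  rewrite onE' in_set1 => /eqP eg; subst e.
  have xy := joins_inj wfK eK exz j; subst x.
  by move: xC; rewrite inE (negbTE y0y) andbF.
have [g3 g3C] : exists g3, g3 \in cut K C by apply/set0Pn; rewrite -card_gt0 ltnW.
have [g4 g4C n43] := other_in g3 C2.
have [x3 [k3 j3 x3C [u3 o3]]] := cutC _ g3C.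
have [x4 [k4 j4 x4C [u4 o4]]] := cutC _ g4C.
have inC x : (x \in C) = (x \in A) && connect (conn_in K A) y0 x by rewrite in_set.
move: (x3C) (x4C); rewrite !inC => /andP[x3A c3] /andP[x4A c4].
have c34 : connect (conn_in K A) x3 x4 by apply: connect_trans c4; rewrite csym.
rewrite eq_sym in n43.
have [w2 [t1 t2 t3]] := flip_pair wfK w' pA x3A x4A n43 k3 k4 j3 j4 c34.
have we2 : agreeA w2.
  by move=> e x xZ ie; rewrite (t3 e x) ?ZA ?Zp // (we' e x).
have s2' : sm K w2 p = 2 by apply: twinB_fin => // x xK xv; rewrite t1 q4.
suff : 2 < sm K w2 p by rewrite s2'.
have <- : #|[set uv; g3; g4]| = 3.
  by rewrite -setUA cardsU1 cards2 n43 !inE negb_or eq_sym u3 eq_sym u4.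
have on3 e : e \in at_ K p -> e \notin on K w' p -> (e == g3) || (e == g4) -> va K w2 e p.
  move=> ep; rewrite inE ep /va (t2 e (at_inc ep)) /= => nw ->.
  by move: nw; case: (w' e); case: (_ && _).
apply: sm_ge.
  apply/subsetP => e; rewrite in_set3 => /or3P[] /eqP -> //.
    exact: joins_at k3 j3.
  exact: joins_at k4 j4.
move=> e; rewrite in_set3 => /or3P[] /eqP ->; first exact: uv_on.
  by apply: on3; rewrite ?eqxx //; exact: joins_at k3 j3.
by apply: on3; rewrite ?eqxx ?orbT //; exact: joins_at k4 j4.
Qed.
End SameTop.

End Twin.
(** Distinct [p] and [p'] would both have to equal [r], by [twin_p_ne] applied from either side. *)
Lemma no_twin h c v v' ev ev' gv gv' uv uv' p p' :
  ~ twin h c v v' ev ev' gv gv' uv uv' p p'.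
Proof.
move=> tw; have tw' := twin_sym tw.
have [pp|pp] := eqVneq p' p; first exact: (twin_same_top tw pp (twin_plain tw')).
have p'r := twin_p_ne tw' pp; rewrite eq_sym in pp.
by have pr := twin_p_ne tw pp; rewrite p'r pr eqxx in pp.
Qed.

(** * Forced edges, vertices of degree two and tight vertices *)

Lemma inc_at e x : e \in at_ K x -> inc K x e. Proof. by rewrite inE => /andP[]. Qed.

Lemma at_two x : x \in vs K -> 1 < #|at_ K x|.
Proof.
move=> xK; have [e [z [ex exz zx]]] := two_nbrs x xK.
apply: (card_at_ge2 wfK) => //; apply/eqP => vE.
by have [_] := joins_vs wfK (at_es ex) exz; rewrite vE inE (negbTE zx).
Qed.

Lemma deep_of h x : deep h -> x \in Y -> l x = l h -> deep x.
Proof. by move=> [_ hm] xY lx; split=> // y /hm; rewrite lx. Qed.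

Lemma deep_l h c : deep h -> deep c -> l c = l h.
Proof. by move=> [hY hm] [cY cm]; apply/eqP; rewrite eqn_leq hm ?cm. Qed.

Lemma child_deep h u g c : deep h -> u \in Y -> l h = (l u).+1 -> g \in es K ->
  joins K g u c -> ~~ up u g -> deep c.
Proof.
move=> dh uY lu gK guc nup; have lc := down_joins gK nup guc.
apply: (deep_of dh); last by rewrite lu.
case: (Ycl gK guc uY) => // cr; have [_ cK] := joins_vs wfK gK guc.
by move/eqP: cr; rewrite -l0 // lc.
Qed.

(* An edge at [u] that may be prescribed: either [u] keeps another edge upwards, or the edge leads
   down to a deepest vertex, which keeps another neighbour. *)
Definition good_force h u g := [/\ g \in at_ K u, g \notin at_ K h
  & (up u g /\ exists g', [/\ g' \in at_ K u, up u g' & g' != g])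
    \/ (~~ up u g /\ exists2 c, deep c & joins K g u c)].

Lemma up_not_at h x e : deep h -> x != h -> e \in at_ K x -> up x e -> e \notin at_ K h.
Proof.
move=> dh xh ex ux; apply/negP => eh; have [y exy] := at_joins ex.
have := joins_or exy (inc_at eh); rewrite eq_sym (negbTE xh) /= => /eqP hy; subst y.
have := up_joins (at_es ex) ux exy; move: exy; rewrite joinsC => /(deep_lvl dh (at_es ex)) ->.
by move/neqSS.
Qed.

(** If [u] has two edges up, one of them can be spared. Otherwise an edge besides the one up and
    those at [h] leads down, to a vertex on the level of [h], which is again deepest. *)
Lemma force_exists h u : deep h -> u \in vs K -> u \in Y -> u != r -> u != h ->
  l h = (l u).+1 -> 1 < #|at_ K u :\: at_ K h| -> exists g, good_force h u g.
Proof.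
move=> dh uK uY ur uh lu c2; have [g0 g0u up0] := up_exists uK ur.
have g0h := up_not_at dh uh g0u up0.
case: (pickP [pred g | [&& g \in at_ K u, up u g & g != g0]]) => [g1 /and3P[g1u up1 n1]|none].
  by exists g0; split=> //; left; split=> //; exists g1.
have [g] := other_in g0 c2; rewrite inE => /andP[gh gu] gn.
have ngu : ~~ up u g by have := none g; rewrite /= gu gn andbT /= => ->.
have [c guc] := at_joins gu; exists g; split=> //; right; split=> //.
by exists c => //; apply: child_deep dh uY lu (at_es gu) guc ngu.
Qed.

Lemma not_forced h u g x e : deep h -> x != h -> l x <> l h \/ x \notin Y -> x != u ->
  e \in at_ K x -> up x e -> g \in at_ K h \/ good_force h u g -> e != g.
Proof.
move=> dh xh ndx xu ex ux [gh|[gu gh fg]].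
  by apply: contraTneq gh => <-; apply: up_not_at dh xh ex ux.
apply/eqP => eg; subst e; have [y guy] := at_joins gu.
have := joins_or guy (inc_at ex); rewrite (negbTE xu) /= => /eqP xy; subst y.
have lxu : l x = (l u).+1 by apply: up_joins (at_es ex) ux _; rewrite joinsC.
case: fg => [[upu _]|[_ [c dc guc]]].
  by have := up_joins (at_es gu) upu guy; rewrite lxu => /neqSS.
have xc := joins_inj wfK (at_es gu) guy guc; subst c.
by case: ndx => [[]|/negP[]]; [apply: deep_l | case: dc].
Qed.

Lemma forced_self h u g : deep h -> u \in vs K -> u != r -> u != h ->
  g \in at_ K h \/ good_force h u g -> exists e, [/\ e \in at_ K u, up u e & e != g].
Proof.
move=> dh uK ur uh gg; have [e eu ue] := up_exists uK ur.
case: gg => [gh|[gu gh [[upg [g' [g'u upg' ng]]]|[nup _]]]].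
- by exists e; split=> //; apply: contraTneq gh => <-; apply: up_not_at dh uh eu ue.
- by exists g'.
by exists e; split=> //; apply: contraNneq nup => <-.
Qed.

(** A forced edge is the edge up of a vertex other than [v], [v'] only if that vertex is deepest. So
    the only danger is a deepest vertex all of whose edges are forced, which the last hypothesis
    excludes. *)
Lemma spared2 h v v' g g' : deep h -> v \in vs K -> v' \in vs K ->
  l h = (l v).+1 -> l h = (l v').+1 -> v != v' ->
  g \in at_ K h \/ good_force h v g -> g' \in at_ K h \/ good_force h v' g' ->
  (forall c, deep c -> c != h -> exists e, [/\ e \in at_ K c, e != g & e != g']) ->
  spared h (pred2 g g').
Proof.
move=> dh vK v'K lv lv' nv fg fg' Hc x xK xh xr.
case dx: ((x \in Y) && (l x == l h)).
  case/andP: dx => xY /eqP lx; have dx := deep_of dh xY lx.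
  have [e [ex n1 n2]] := Hc x dx xh; exists e; split=> //; first exact: deep_up.
  by rewrite /= (negbTE n1).
have ndx : l x <> l h \/ x \notin Y.
  by case: (x \in Y) dx => /= [/eqP|_]; [left|right].
have [xv|xv] := eqVneq x v.
  subst x; have [e [ev ue ne]] := forced_self dh vK xr xh fg.
  exists e; split=> //=; rewrite (negbTE ne) /=.
  exact: (not_forced dh xh ndx nv ev ue fg').
have [xv'|xv'] := eqVneq x v'.
  subst x; have [e [ev ue ne]] := forced_self dh v'K xr xh fg'.
  exists e; split=> //=; rewrite (negbTE ne) orbF.
  exact: (not_forced dh xh ndx xv ev ue fg).
have [e ex ue] := up_exists xK xr; exists e; split=> //=.
by rewrite negb_or (not_forced dh xh ndx xv ex ue fg) (not_forced dh xh ndx xv' ex ue fg').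
Qed.

(** If every choice of forced edges isolates a second vertex [c], then exchanging one of the two
    edges still gives the same [c]. So the choices are unique, [v] and [v'] have degree three, and a
    twin arises. *)
Lemma no_degree_two h : deep h -> #|at_ K h| <> 2.
Proof.
move=> dh /eqP/cards2P[ev [ev' [ne ath]]].
have evh : ev \in at_ K h by rewrite ath !inE eqxx.
have ev'h : ev' \in at_ K h by rewrite ath !inE eqxx orbT.
have [v jv] := at_joins evh; have [v' jv'] := at_joins ev'h.
have hK := deep_vs dh.
have nv : v != v'.
  have [e [z [eh ehz zv]]] := two_nbrs v hK; apply: contraNneq zv => vE.
  move: eh; rewrite ath in_set2 => /orP[] /eqP eE; subst e; apply/eqP.
    exact: (joins_inj wfK (at_es evh) ehz jv).
  by rewrite vE; exact: (joins_inj wfK (at_es ev'h) ehz jv').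
have [vY vK lv vr] := deep_nbr dh (at_es evh) jv.
have [v'Y v'K lv' v'r] := deep_nbr dh (at_es ev'h) jv'.
have vh : v != h by apply/eqP => E1; move: lv; rewrite E1 => /neqS.
have v'h : v' != h by apply/eqP => E1; move: lv'; rewrite E1 => /neqS.
have incv : ~~ inc K v ev'.
  by apply/negP => /(joins_or jv'); rewrite (negbTE vh) (negbTE nv).
have incv' : ~~ inc K v' ev.
  by apply/negP => /(joins_or jv); rewrite (negbTE v'h) eq_sym (negbTE nv).
(* A neighbour of degree two behind a non-thick edge would form a pod with [h] if the edge is plain,
   and contradict [irr_thin] if it is thin. *)
have atI f f' u : f \in at_ K h -> f' \in at_ K h -> at_ K h = [set f; f'] -> joins K f h u ->
    ~~ inc K u f' -> ~~ thick K f -> u \in vs K -> 1 < #|at_ K u :\: at_ K h|.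
  move=> fh f'h ath' jf nf' tf uK.
  have fu : f \in at_ K u := joins_atr (at_es fh) jf.
  have -> : at_ K u :\: at_ K h = at_ K u :\ f.
    apply/setP => e; rewrite in_setD in_setD1 ath' in_set2 negb_or.
    have [->|_] := eqVneq e f' => //=; last by rewrite andbT.
    rewrite andbF; apply/esym/negbTE; apply/negP => /andP[_].
    by rewrite inE (negbTE nf') andbF.
  suff : 2 < #|at_ K u| by rewrite (cardsD1 f) fu.
  rewrite ltn_neqAle at_two // andbT eq_sym; apply/negP => c2.
  have [f2 f2u f2f] : exists2 f2, f2 \in at_ K u & f2 != f by apply: other_in; apply: at_two.
  have atu : at_ K u = [set f; f2].
    apply/esym/eqP; rewrite eqEcard (eqP c2) cards2 eq_sym f2f leqnn andbT.
    by apply/subsetP => e; rewrite in_set2 => /orP[] /eqP ->.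
  case pf: (plain K f).
    apply: (irr_pod irrK (u := h) (v := u) (eu := f') (ev := f2)); split.
    - by rewrite f'h nf'.
    - rewrite f2u /=; apply/negP => ih; have : f2 \in at_ K h by rewrite inE (at_es f2u) ih.
      rewrite ath' in_set2 (negbTE f2f) /= => /eqP f2E.
      by move: nf'; rewrite -f2E (inc_at f2u).
    - by move=> e; rewrite ath' in_set2 => /orP[/eqP -> _|->]; rewrite ?pf ?jf.
    by move=> e; rewrite atu in_set2 => /orP[/eqP -> _|->]; rewrite // pf joinsC jf.
  have := irr_thin irrK (at_es fh) jf; rewrite pf tf => /(_ isT isT)[].
    by rewrite ath' cards2; case: (_ != _).
  by rewrite (eqP c2).
have Hdummy e0 g c : e0 \in at_ K h -> deep c -> c != h -> exists e, [/\ e \in at_ K c, e != e0 & e != g].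
  move=> e0h dc ch; have [e ec eg] := other_in g (at_two (deep_vs dc)).
  exists e; split=> //; apply/eqP => E1; subst e.
  by have := up_not_at dh ch ec (deep_up dc ec); rewrite e0h.
(* A thick edge never fails and needs no forced edge; an edge at [h] itself then serves as a
   dummy. *)
case tv: (thick K ev); case tv': (thick K ev').
- apply: (degree_two_config (gv := ev) (gw := ev') dh nv ath jv jv'); rewrite ?tv ?tv'; auto.
  apply: (spared2 (v := v) (v' := v')) => //; auto.
- have [|g' fg'] := force_exists dh v'K v'Y v'r v'h lv'.
    by apply: (atI ev' ev) => //; rewrite ?tv' // setUC.
  have [g'v g'h _] := fg'.
  apply: (degree_two_config (gv := ev) (gw := g') dh nv ath jv jv'); rewrite ?tv; auto.
  by apply: (spared2 (v := v) (v' := v')) => //; auto.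
- have [|g fg] := force_exists dh vK vY vr vh lv.
    by apply: (atI ev ev') => //; rewrite ?tv.
  have [gv gh _] := fg.
  apply: (degree_two_config (gv := g) (gw := ev') dh nv ath jv jv'); rewrite ?tv'; auto.
  apply: (spared2 (v := v) (v' := v')) => //; auto.
  by move=> c dc ch; have [e [? ? ?]] := Hdummy ev' g c ev'h dc ch; exists e.
have c2 : 1 < #|at_ K v :\: at_ K h| by apply: (atI ev ev') => //; rewrite ?tv.
have c2' : 1 < #|at_ K v' :\: at_ K h| by apply: (atI ev' ev) => //; rewrite ?tv' // setUC.
have [g fg] := force_exists dh vK vY vr vh lv c2.
have [g' fg'] := force_exists dh v'K v'Y v'r v'h lv' c2'.
(* The two forced edges can only fail by isolating a second vertex of degree two. *)
have pair g1 g2 : good_force h v g1 -> good_force h v' g2 ->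
    exists c, [/\ deep c, c != h, at_ K c = [set g1; g2], joins K g1 c v & joins K g2 c v'].
  move=> f1 f2; have [g1v g1h _] := f1; have [g2v g2h _] := f2.
  case: (pickP [pred c | [&& c \in Y, l c == l h, c != h & at_ K c \subset [set g1; g2]]]) => [c|none]; last first.
    case: (degree_two_config (gv := g1) (gw := g2) dh nv ath jv jv'); rewrite ?tv ?tv'; auto.
    apply: (spared2 (v := v) (v' := v')) => //; auto.
    move=> c dc ch; have := none c; rewrite /= dc.1 (deep_l dh dc) eqxx ch /= => /negbT.
    by case/subsetPn => e ec; rewrite in_set2 negb_or => /andP[n1 n2]; exists e.
  case/and4P => cY /eqP lc ch sub; have dc := deep_of dh cY lc; exists c.
  have n12 : g1 != g2.
    apply/eqP => E1; have [y j] := at_joins g1v.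
    have := joins_or j; rewrite E1 => /(_ _ (inc_at g2v)); rewrite eq_sym (negbTE nv) /= => /eqP yv.
    have := joins_side wfK (at_es g1v) j; rewrite -yv.
    by rewrite (ends_side wfK (at_es evh) (at_es ev'h) jv jv'); case: (side v').
  have atc : at_ K c = [set g1; g2].
    apply/eqP; rewrite eqEcard sub cards2 n12; exact: at_two (deep_vs dc).
  have cv u : l h = (l u).+1 -> c != u by move=> lu; apply/eqP => E1; move: lu; rewrite -lc E1 => /neqS.
  split=> //.
    have [y j] := at_joins g1v; have : g1 \in at_ K c by rewrite atc !inE eqxx.
    by move/inc_at/(joins_or j); rewrite (negbTE (cv v lv)) /= => /eqP ->; rewrite joinsC.
  have [y j] := at_joins g2v; have : g2 \in at_ K c by rewrite atc !inE eqxx orbT.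
  by move/inc_at/(joins_or j); rewrite (negbTE (cv v' lv')) /= => /eqP ->; rewrite joinsC.
have [c [dc ch atc gc g'c]] := pair g g' fg fg'.
have [gv gh ff] := fg; have [g'v g'h ff'] := fg'.
have nup u f x : f \in es K -> joins K f x u -> deep x -> ~~ up u f.
  move=> fK jf dx; apply/negP => uf; have := deep_lvl dx fK jf.
  by rewrite joinsC in jf; rewrite (up_joins fK uf jf) => /neqSS.
have struct u f g1 (uK : u \in vs K) (uY : u \in Y) (ur : u != r) (uh : u != h) (lu : l h = (l u).+1)
    (fh : f \in at_ K h) (jf : joins K f h u) (one : forall e, e \in at_ K h -> inc K u e -> e = f)
    (fg1 : good_force h u g1) (g1c : joins K g1 c u) (uniq : forall g2, good_force h u g2 -> g2 = g1) :
    exists ue p, [/\ at_ K u = [set f; g1; ue], joins K ue u p & l u = (l p).+1].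
  have [g1u g1h _] := fg1.
  have [ue ueu upu] := up_exists uK ur.
  have ueh := up_not_at dh uh ueu upu.
  have [p jp] := at_joins ueu; exists ue, p; split=> //; last exact: up_joins (at_es ueu) upu jp.
  apply/setP => e; rewrite in_set3; apply/idP/idP => [eu|]; last first.
    by case/or3P => /eqP -> //; exact: joins_atr (at_es fh) jf.
  case eh: (e \in at_ K h); first by rewrite (one e) ?eqxx ?inc_at.
  apply/or3P; have [->|eg] := eqVneq e g1; first exact: Or32.
  have [->|eue] := eqVneq e ue; first exact: Or33.
  case: (boolP (up u e)) => ue'.
    have : good_force h u e by split; rewrite ?eh //; left; split=> //; exists ue; rewrite eq_sym.
    by move/uniq => E1; rewrite E1 eqxx in eg.
  have [c' ec'] := at_joins eu.
  have : good_force h u e.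
    split; rewrite ?eh //; right; split=> //; exists c' => //.
    exact: child_deep dh uY lu (at_es eu) ec' ue'.
  by move/uniq => E1; rewrite E1 eqxx in eg.
have inc2 e u : e \in at_ K h -> inc K u e -> (u == v -> e = ev) /\ (u == v' -> e = ev').
  rewrite ath in_set2 => /orP[] /eqP -> iu; split=> // /eqP uE; subst u.
    by rewrite iu in incv'.
  by rewrite iu in incv.
have gK := at_es gv; have g'K := at_es g'v.
have uniq1 g2 : good_force h v g2 -> g2 = g.
  move=> f2; have [c' [dc' c'h atc' j1 j2]] := pair g2 g' f2 fg'.
  have cc : c' = c by apply: (joins_inj wfK g'K (x := v')); rewrite joinsC.
  have : g2 \in at_ K c by rewrite -cc atc' !inE eqxx.
  rewrite atc in_set2 => /orP[/eqP //|/eqP E1]; subst g2.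
  by rewrite joinsC in j1; rewrite joinsC in j2;
    have := joins_or j1 (inc_at g'v); rewrite eq_sym (negbTE nv) /= => /eqP E1;
    move: lv'; rewrite E1 -(deep_l dh dc') => /neqS.
have uniq2 g2 : good_force h v' g2 -> g2 = g'.
  move=> f2; have [c' [dc' c'h atc' j1 j2]] := pair g g2 fg f2.
  have cc : c' = c by apply: (joins_inj wfK gK (x := v)); rewrite joinsC.
  have : g2 \in at_ K c by rewrite -cc atc' !inE eqxx orbT.
  rewrite atc in_set2 => /orP[/eqP E1|/eqP //]; subst g2.
  by rewrite joinsC in j1; rewrite joinsC in j2;
    have := joins_or j2 (inc_at gv); rewrite (negbTE nv) /= => /eqP E1;
    move: lv; rewrite E1 -(deep_l dh dc') => /neqS.
have [uv [p [atv juv lp]]] := struct v ev g vK vY vr vh lv evh jv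
  (fun e eh ie => (inc2 e v eh ie).1 (eqxx v)) fg gc uniq1.
have [uv' [p' [atv' juv' lp']]] := struct v' ev' g' v'K v'Y v'r v'h lv' ev'h jv'
  (fun e eh ie => (inc2 e v' eh ie).2 (eqxx v')) fg' g'c uniq2.
apply: (@no_twin h c v v' ev ev' g g' uv uv' p p'); split=> //.
by rewrite eq_sym.
Qed.

(* [h] gets sum 2 or 0, according to the sum of the end of [eps]. *)
Lemma no_tight h u eps : deep h -> 2 < #|at_ K h| -> eps \in at_ K h -> ~~ inc K u eps ->
  (forall e, e \in at_ K h -> e != eps -> plain K e && joins K e h u) -> False.
Proof.
move=> dh D3 epsh nueps tight.
have c2 : 1 < #|at_ K h :\ eps| by move: D3; rewrite (cardsD1 eps) epsh.
have [e1 e1D] : exists e1, e1 \in at_ K h :\ eps by apply/set0Pn; rewrite -card_gt0 ltnW.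
have [e2 e2D n21] := other_in e1 c2.
move: e1D e2D; rewrite !in_setD1 => /andP[e1n e1h] /andP[e2n e2h].
have /andP[p1 j1] := tight e1 e1h e1n; have /andP[p2 j2] := tight e2 e2h e2n.
have [uY uK lu ur] := deep_nbr dh (at_es e1h) j1.
have uh : u != h by apply/eqP => E1; move: lu; rewrite E1 => /neqS.
have [w0 jw] := at_joins epsh.
have [wY wK lw wr] := deep_nbr dh (at_es epsh) jw.
have uw : u != w0.
  apply: contraNneq nueps => ->; move: jw; rewrite joinsC; exact: joins_inc.
have cu : 1 < #|at_ K u :\: at_ K h|.
  rewrite ltnNge; apply/negP => c1; have [ue ueu upu] := up_exists uK ur.
  have ueh := up_not_at dh uh ueu upu.
  have uniq e : e \in at_ K u -> e \notin at_ K h -> e = ue.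
    move=> eu eh; have /card_le1P := c1 => /(_ ue); rewrite inE ueu ueh /= => /(_ isT e).
    by rewrite in_setD eu eh inE => /esym /eqP.
  apply: (irr_pod irrK (u := h) (v := u) (eu := eps) (ev := ue)); split=> //.
  - by rewrite epsh.
  - by rewrite ueu; move: ueh; rewrite inE (at_es ueu).
  move=> e eu ne; case eh: (e \in at_ K h); last by rewrite (uniq e) ?eh ?eqxx // in ne.
  have neps : e != eps by apply: contraNneq nueps => <-; apply: inc_at.
  by rewrite joinsC; apply: tight.
have [g fg] := force_exists dh uK uY ur uh lu cu; have [gu gh _] := fg.
have sp : spared h (pred2 g eps).
  apply: (spared2 (v := u) (v' := w0)) => //; auto.
  move=> c dc ch; have [e ec eg] := other_in g (at_two (deep_vs dc)).
  exists e; split=> //; apply/eqP => E1; subst e.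
  by have := up_not_at dh ch ec (deep_up dc ec); rewrite epsh.
pose S12 : {set E} := [set e1; e2].
have S12h : S12 \subset at_ K h by apply/subsetP => e; rewrite in_set2 => /orP[] /eqP ->.
have S12c : #|S12| = 2 by rewrite cards2 eq_sym n21.
have e1u : e1 \in at_ K u := joins_atr (at_es e1h) j1.
have e2u : e2 \in at_ K u := joins_atr (at_es e2h) j2.
(* The conclusion records how [eps] can still fail: it is not plain and [h] has sum 0, or it is
   plain and [w0] has the same sum as [h]. The edges to [u] cannot fail, as the forced edge puts [u]
   above [h]. *)
have main (b : bool) w : (forall x, x \in vs K -> x != h -> odd (sm K w x) = (side x == side h)) ->
    (forall e, e \in at_ K h -> va K w e h = b && (e \in S12)) -> va K w g u ->
    (~~ b && ~~ plain K eps) || (plain K eps && (sm K w w0 == b.*2)).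
  move=> par vah gon.
  have smh : sm K w h = b.*2.
    case: b vah => vah; first by rewrite (sm_card S12h vah) S12c.
    have -> : false.*2 = #|@set0 E| by rewrite cards0.
    apply: sm_card; first exact: sub0set.
    by move=> e eh; rewrite vah //= in_set0.
  have smu : b.*2 < sm K w u.
    case: b vah smh => vah smh; last by apply: sm_ge1 gon.
    have von e : e \in S12 -> plain K e -> joins K e h u -> va K w e u.
      move=> eS pe je; have eh := subsetP S12h e eS.
      by rewrite (va_other wfK w (at_es eh) je) vah // eS (even_plain wfK pe).
    have : #|[set g; e1; e2]| <= sm K w u.
      apply: sm_ge; first by apply/subsetP => e; rewrite in_set3 => /or3P[] /eqP ->.
      move=> e; rewrite in_set3 => /or3P[] /eqP -> //; apply: von => //; by rewrite !inE eqxx ?orbT.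
    have ng e : e \in at_ K h -> g != e by move=> eh; apply: contraNneq gh => ->.
    by rewrite -setUA cardsU1 cards2 eq_sym n21 !inE negb_or !ng.
  have [e [x [y [eK exy nok pxy]]]] := nonprop_bad w nK.
  have [xK yK] := joins_vs wfK eK exy.
  have eh : e \in at_ K h.
    have [<-|xh] := eqVneq x h; first exact: joins_at exy.
    have [<-|yh] := eqVneq y h; first exact: joins_atr exy.
    move: pxy; rewrite !par // (joins_side wfK eK exy).
    by case: (side y); case: (side h).
  have [eE|ne] := eqVneq e eps; last first.
    have /andP[pe je] := tight e eh ne.
    by move: nok; rewrite (okE w je) pe smh negbK => /eqP E1; rewrite -E1 ltnn in smu.
  subst e; case pe: (plain K eps).
    by move: nok; rewrite (okE w jw) pe smh negbK eq_sym => ->; rewrite orbT.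
  rewrite /= orbF andbT; apply: contraNN nok => bt.
  apply: (ok_rest jw); rewrite ?pe // vah // smh bt /=.
  by rewrite !inE ![eps == _]eq_sym (negbTE e1n) (negbTE e2n).
pose wt e := if e \in at_ K h then pv K e h (e \in S12) else pv K e u true.
have smh : sm K wt h = 2.
  by rewrite (sm_card S12h) // => e eh; apply: va_pv; rewrite /wt eh.
have [||||w' [w1 w2 w3 w4 _]] := nonprop_extend wfK (Z := [set h]) (h := h) (w := wt) nK _ _ rK _ (spared_low dh sp).
- by rewrite sub1set deep_vs.
- by rewrite inE.
- by rewrite inE eq_sym deep_nr.
- by move=> z; rewrite inE => ->.
rewrite smh /= in w4.
have vah e : e \in at_ K h -> va K w' e h = true && (e \in S12).
  by move=> eh; apply: va_pv; rewrite (w2 e h) ?set11 ?inc_at // /wt eh.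
have gon : va K w' g u.
  by apply: va_pv; rewrite w1 /wt ?(negbTE gh) //= eqxx.
have := main true w' w4 vah gon; rewrite /= => /andP[peps /eqP s2].
(* Switching off [e1] and [e2], which both join [h] and [u], preserves all parities and the sum of
   [w0]; a failure in both weightings would require this sum to be 2 and 0 at once. *)
pose w'' e := w' e (+) ((e == e1) (+) (e == e2)).
have h12 e : (e == e1) (+) (e == e2) = (e \in S12).
  by rewrite in_set2; have [->|] := eqVneq e e1; rewrite //= eq_sym (negbTE n21).
have par x : x \in vs K -> x != h -> odd (sm K w'' x) = (side x == side h).
  move=> xK xh; rewrite odd_sm_flip tgD (tg1 wfK x (at_es e1h) j1) (tg1 wfK x (at_es e2h) j2).
  by rewrite addbb addbF w4.
have := main false w'' par; case/(_ _ _)/orP => //.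
- by move=> e eh; have := vah e eh; rewrite /va /w'' h12 /= => <-; case: (w' e); case: (_ && _).
- rewrite /va /w''; have ng e : e \in at_ K h -> g != e by move=> eh; apply: contraNneq gh => ->.
  by rewrite (negbTE (ng e1 e1h)) (negbTE (ng e2 e2h)) /= addbF.
- by rewrite peps.
rewrite peps /= (eq_sm (w' := w')) ?s2 // => e ew; rewrite /w'' h12.
case eS: (e \in S12); last by rewrite addbF.
have eu : joins K e h u by move: eS; rewrite in_set2 => /orP[] /eqP ->.
have := joins_or eu (inc_at ew); rewrite ![w0 == _]eq_sym (negbTE uw) orbF => /eqP hw.
by move: lw; rewrite hw => /neqS.
Qed.

(** At each [u] in [P] one edge up is reserved for correcting parities and all other edges not at
    [Z] are off, so the sum of [u] is known up to one bit. The deepest vertices outside [Z] need an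
    edge avoiding [P], as all their edges into [P] may be fixed. *)
Lemma bits_extend (Z P : {set V}) z0 w :
  (forall z, z \in Z -> deep z) -> z0 \in Z ->
  (forall u, u \in P -> [/\ u \in Y, u \in vs K, u != r & l z0 = (l u).+1]) ->
  (forall x, deep x -> x \notin Z -> exists e y, [/\ e \in at_ K x, joins K e x y & y \notin P]) ->
  (forall z, z \in Z -> z != z0 -> odd (sm K w z) != odd (sm K w z0)) ->
  exists w', [/\ forall z e, z \in Z -> e \in at_ K z -> w' e = w e,
    forall u, u \in P -> exists b : bool,
      sm K w' u = \sum_(e in at_ K u | [exists z in Z, inc K z e]) va K w e u + b,
    forall u, u \in vs K -> side u != side z0 -> odd (sm K w' u) = odd (sm K w z0)
    & exists e x, [/\ e \in es K, joins K e z0 x & ~~ ok K w' e]].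
Proof.
move=> Zd z0Z HP Hx Zpar; have d0 := Zd z0 z0Z.
have lZ z : z \in Z -> l z = l z0 by move=> zZ; apply: deep_l => //; apply: Zd.
have ZP z : z \in Z -> z \notin P.
  by move=> zZ; apply/negP => /HP[_ _ _]; rewrite lZ // => /neqS.
have [b Hb] : exists b : V -> E, forall u, u \in P -> (b u \in at_ K u) && up u (b u).
  apply: (@fin_all_exists V (fun=> E) (fun u e => u \in P -> (e \in at_ K u) && up u e)) => u.
  case uP: (u \in P); last first.
    have [e [_ [_ _ _]]] := two_nbrs r rK.
    by exists e.
  have [_ uK ur _] := HP u uP; have [e eu ue] := up_exists uK ur.
  by exists e; rewrite eu.
pose touch e := [exists z in Z, inc K z e].
pose wt e := if touch e then w e
  else if [pick u in P | inc K u e] is Some u then pv K e u false else false.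
(* The edges that remain free: at an end in [P] only the reserved edge may be toggled. *)
pose F0 e := [forall u in P, inc K u e ==> (e == b u)].
have touchP z e : z \in Z -> e \in at_ K z -> touch e.
  by move=> zZ ez; apply/existsP; exists z; rewrite zZ inc_at.
have smwt z : z \in Z -> sm K wt z = sm K w z.
  by move=> zZ; apply: eq_sm => e ez; rewrite /wt (touchP z e).
have noadj u u' e : u \in P -> u' \in P -> e \in es K -> joins K e u u' -> False.
  move=> /HP[_ _ _ lu] /HP[_ _ _ lu'] eK j; move: lu'; rewrite lu => -[luu].
  by case: (ladj eK j); rewrite luu => /neqS.
have low x : x \in vs K -> x \notin Z -> x != r ->
    exists e y, [/\ F0 e, e \in es K, joins K e x y, y \notin Z & l y < l x].
  move=> xK xZ xr.
  have lowZ e y : e \in es K -> joins K e x y -> l y < l x -> y \notin Z.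
    move=> eK exy lt; apply/negP => yZ.
    by have := up_not_deep (Zd y yZ) eK exy lt; rewrite eqxx.
  case xP: (x \in P).
    have /andP[bx ub] := Hb x xP; have [y j] := at_joins bx.
    have lxy := up_joins (at_es bx) ub j.
    exists (b x), y; split=> //; [|exact: at_es bx|by apply: lowZ (at_es bx) j _; rewrite lxy|by rewrite lxy].
    apply/forallP => u; apply/implyP => uP; apply/implyP => iu.
    have := joins_or j iu; case: eqP => [-> //|_ /= /eqP uy]; subst u.
    by case: (noadj _ _ _ xP uP (at_es bx) j).
  case dx: ((x \in Y) && (l x == l z0)).
    case/andP: dx => xY /eqP lx; have dx := deep_of d0 xY lx.
    have [e [y [ex j yP]]] := Hx x dx xZ.
    have lxy := deep_lvl dx (at_es ex) j.
    exists e, y; split=> //; [|exact: at_es ex|by apply: lowZ (at_es ex) j _; rewrite lxy|by rewrite lxy].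
    apply/forallP => u; apply/implyP => uP; apply/implyP => iu.
    by have := joins_or j iu => /orP[] /eqP uE; [rewrite -uE uP in xP | rewrite -uE uP in yP].
  have [e [y [eK j lxy]]] := ll xK xr.
  exists e, y; split=> //; [|by apply: lowZ eK j _; rewrite lxy|by rewrite lxy].
  apply/forallP => u; apply/implyP => uP; apply/implyP => iu.
  have := joins_or j iu => /orP[] /eqP uE; first by rewrite -uE uP in xP.
  subst y; have [uY uK ur lu] := HP u uP.
  rewrite joinsC in j; case: (Ycl eK j uY) => [xY|xE]; last by rewrite xE eqxx in xr.
  by move: dx; rewrite xY lxy lu eqxx.
have ZK : Z \subset vs K by apply/subsetP => z /Zd /deep_vs.
have rZ : r \notin Z by apply/negP => /Zd /deep_nr; rewrite eqxx.
have [|w' [w1 w2 w3 w4 w5]] := nonprop_extend wfK (h := z0) (w := wt) nK ZK z0Z rK rZ low.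
  move=> z zZ zz; rewrite !smwt // (lside (deep_vs (Zd z zZ))) (lside (deep_vs d0)) lZ // eqxx addbT.
  by have := Zpar z zZ zz; case: (odd _); case: (odd _).
have wZ z e : z \in Z -> e \in at_ K z -> w' e = w e.
  by move=> zZ ez; rewrite (w2 e z) ?inc_at // /wt (touchP z e).
exists w'; split=> //.
  move=> u uP; have /andP[bu ub] := Hb u uP; have [_ uK ur lu] := HP u uP.
  exists (va K w' (b u) u); rewrite /sm (bigID touch) /=; congr (_ + _).
    apply: eq_bigr => e /andP[eu /existsP[z /andP[zZ iz]]].
    by rewrite /va (wZ z e) // inE iz (at_es eu).
  rewrite (bigD1 (b u)) /=; last first.
    rewrite bu; apply/negP => /existsP[z /andP[zZ iz]].
    have uz : u != z by apply: contraTneq uP => ->; apply: ZP.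
    have := up_not_at (Zd z zZ) uz bu ub; by rewrite inE iz (at_es bu).
  rewrite big1 ?addn0 // => e /andP[/andP[eu nt] eb].
  have -> // : va K w' e u = false.
  have nF : ~~ F0 e.
    by apply/negP => /forallP /(_ u); rewrite uP inc_at // (negbTE eb).
  apply: va_pv; rewrite w1 // /wt (negbTE nt).
  case: pickP => [u' /andP[u'P iu']|/(_ u)]; last by rewrite uP inc_at.
  have [-> //|uu] := eqVneq u' u; have [y j] := at_joins eu.
  have := joins_or j iu'; rewrite (negbTE uu) /= => /eqP uE; subst y.
  by case: (noadj _ _ _ uP u'P (at_es eu) j).
move=> u uK su; rewrite w4 ?smwt //; last by apply: contraNneq su => ->.
by rewrite (negbTE su) addbF.
Qed.

Definition Qp z u : {set E} := [set e in at_ K z | plain K e && joins K e z u].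
Definition Eb z u : {set E} := [set e in at_ K z | joins K e z u].
Definition Nb z : {set V} := [set u | Eb z u != set0].
Definition Pn z : {set V} := [set u | Qp z u != set0].

Lemma deep_deg z : deep z -> 2 < #|at_ K z|.
Proof.
move=> dz; rewrite ltn_neqAle at_two ?deep_vs // andbT eq_sym.
by apply/eqP; apply: no_degree_two.
Qed.

(** Otherwise at most one edge at [z] is not a plain edge to [u], which is the situation of
    [no_tight]. *)
Lemma not_tight z u : deep z -> #|Qp z u|.+2 <= #|at_ K z|.
Proof.
move=> dz; have D3 := deep_deg dz.
have Qs : Qp z u \subset at_ K z by apply/subsetP => e; rewrite inE => /andP[].
have := cardsID (Qp z u) (at_ K z); rewrite (setIidPr Qs) => <-.
rewrite -addn2 leq_add2l ltnNge; apply/negP => le1.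
have [e [y [ez j yu]]] := two_nbrs u (deep_vs dz).
have eD : e \in at_ K z :\: Qp z u.
  rewrite in_setD ez andbT inE ez /=; apply/negP => /andP[_ j'].
  by move: yu; rewrite (joins_inj wfK (at_es ez) j j') eqxx.
have uniq f : f \in at_ K z -> f != e -> plain K f && joins K f z u.
  move=> fz fe; apply: contraTT le1 => nf; rewrite -ltnNge (cardsD1 e) eD ltnS card_gt0.
  by apply/set0Pn; exists f; rewrite in_setD1 fe in_setD fz andbT inE fz.
apply: (no_tight dz D3 ez _ uniq); apply/negP => iu.
have := joins_or j iu; rewrite [u == y]eq_sym (negbTE yu) orbF => /eqP uz.
have [f fz fe] := other_in e (at_two (deep_vs dz)).
have /andP[_ jf] := uniq f fz fe.
by have := joins_neq wfK (at_es fz) jf; rewrite uz eqxx.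
Qed.

Lemma odd_parallel z u e : u \in Pn z -> e \in at_ K z -> joins K e z u -> ~~ plain K e -> od K e.
Proof.
rewrite inE => /set0Pn[f]; rewrite inE => /and3P[fz pf jf] ez j npe.
exact: (irr_relabel irrK (at_es ez) (at_es fz) j jf pf npe).
Qed.

Lemma Pn_lvl z u : deep z -> u \in Pn z -> [/\ u \in Y, u \in vs K, u != r & l z = (l u).+1].
Proof.
move=> dz; rewrite inE => /set0Pn[f]; rewrite inE => /and3P[fz _ jf].
by have [] := deep_nbr dz (at_es fz) jf.
Qed.

(* All edges at [z0] are on at [z0], and its plain neighbours get smaller sums. *)
Lemma full_config (Z : {set V}) z0 w :
  (forall z, z \in Z -> deep z) -> z0 \in Z ->
  (forall x, deep x -> x \notin Z -> exists e y, [/\ e \in at_ K x, joins K e x y & y \notin Pn z0]) ->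
  (forall z, z \in Z -> z != z0 -> odd (sm K w z) != odd (sm K w z0)) ->
  (forall e, e \in at_ K z0 -> va K w e z0) ->
  (forall u, u \in Pn z0 -> \sum_(e in at_ K u | [exists z in Z, inc K z e]) va K w e u + 1 < #|at_ K z0|) ->
  False.
Proof.
move=> Zd z0Z Hx Zpar on0 bound; have d0 := Zd z0 z0Z.
have [w' [w1 w2 w3 [e [x [eK j nok]]]]] :=
  bits_extend Zd z0Z (fun u => @Pn_lvl z0 u d0) Hx Zpar.
have smz : sm K w' z0 = #|at_ K z0|.
  apply: sm_card => // f fz; rewrite fz -(on0 f fz) /va (w1 z0 f) //.
have ez := joins_at eK j.
case/negP: nok; rewrite (okE w' j) smz; case: ifP => pe.
  have xP : x \in Pn z0 by rewrite inE; apply/set0Pn; exists e; rewrite inE ez pe.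
  have [b sE] := w2 x xP; have := bound x xP; rewrite neq_ltn orbC sE => lt.
  by rewrite (leq_ltn_trans _ lt) // leq_add2l; case: (b).
apply/or4P/Or43; apply: leq_trans (deep_deg d0).
by case: (va _ _ _ _).
Qed.

(** Turn all edges of [z] on. A plain neighbour [u] then receives only the plain edges, since
    non-plain edges parallel to them are odd and so off at [u]; even with the extra bit its sum
    stays below the degree of [z], by [not_tight]. Used in the contrapositive: some other deepest
    vertex has all its neighbours in [Pn z]. *)
Lemma full_alone z : deep z ->
  (forall x, deep x -> x != z -> exists e y, [/\ e \in at_ K x, joins K e x y & y \notin Pn z]) -> False.
Proof.
move=> dz Hx; pose w e := pv K e z true.
have von e : va K w e z by apply: va_pv.
apply: (@full_config [set z] z w).
- by move=> z' /set1P ->.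
- exact: set11.
- by move=> x dx; rewrite in_set1; apply: Hx.
- by move=> z' /set1P ->; rewrite eqxx.
- by [].
move=> u uP; rewrite addn1; apply: leq_trans (not_tight u dz); rewrite !ltnS.
rewrite -sum1_card big_mkcond [X in _ <= X]big_mkcond /=; apply: leq_sum => e _.
case: ifP => // /andP[eu /existsP[z' /andP[/set1P -> iz]]].
have ez : e \in at_ K z by rewrite inE (at_es eu) iz.
have uz : u != z.
  by have [_ _ _ lu] := Pn_lvl dz uP; apply/eqP => E1; move: lu; rewrite E1 => /neqS.
have j : joins K e z u.
  have [y j] := at_joins ez; have := joins_or j (inc_at eu).
  by rewrite (negbTE uz) /= => /eqP ->.
rewrite (va_other wfK w (at_es ez) j) von; case pe: (plain K e).
  by rewrite inE ez pe j; case: (od K e).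
by rewrite (odd_parallel uP ez j) ?pe.
Qed.

(** * Captives: deepest vertices with one common neighbourhood *)

Section Captives.
Variables (Z P : {set V}).
Hypothesis Zd : forall z, z \in Z -> deep z.
Hypothesis ZP : forall z, z \in Z -> Pn z = P.
Hypothesis ZN : forall z e u, z \in Z -> e \in at_ K z -> joins K e z u -> u \in P.
Hypothesis Zx : forall x, deep x -> x \notin Z ->
  exists e y, [/\ e \in at_ K x, joins K e x y & y \notin P].

Let lvlP z u : z \in Z -> u \in P -> [/\ u \in Y, u \in vs K, u != r & l z = (l u).+1].
Proof. by move=> zZ uP; apply: Pn_lvl (Zd zZ) _; rewrite ZP. Qed.

Let ZnP z : z \in Z -> z \notin P.
Proof. by move=> zZ; apply/negP => /(lvlP zZ)[_ _ _ /neqS]. Qed.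

Let zu z u : z \in Z -> u \in P -> u != z.
Proof. by move=> /ZnP zP uP; apply: contraNneq zP => <-. Qed.

Let uend e := if src K e \in P then src K e else dst K e.

Let uendE z e u : z \in Z -> e \in at_ K z -> joins K e z u -> uend e = u.
Proof.
move=> zZ ez j; have uP := ZN zZ ez j; have zP := ZnP zZ.
by rewrite /uend; case/joinsP: j => -[zE uE]; rewrite -uE -zE ?uP ?(negbTE zP).
Qed.

Let one_z z z' e : z \in Z -> z' \in Z -> e \in at_ K z -> inc K z' e -> z = z'.
Proof.
move=> zZ z'Z ez iz'; have [u j] := at_joins ez.
case/orP: (joins_or j iz') => /eqP // zE.
by have := ZN zZ ez j; rewrite -zE (negbTE (ZnP z'Z)).
Qed.

Let odE z e : z \in Z -> e \in at_ K z -> od K e = ~~ plain K e.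
Proof.
move=> zZ ez; have [u j] := at_joins ez; have uP := ZN zZ ez j.
case pe: (plain K e); first by rewrite (even_plain wfK pe).
by apply: (@odd_parallel z u); rewrite ?ZP ?pe.
Qed.

Let at_u z e u : z \in Z -> u \in P -> e \in at_ K u -> inc K z e -> e \in at_ K z /\ joins K e z u.
Proof.
move=> zZ uP eu iz; have ez : e \in at_ K z by rewrite inE (at_es eu) iz.
split=> //; have [y j] := at_joins ez; have := joins_or j (inc_at eu).
by rewrite (negbTE (zu zZ uP)) /= => /eqP ->.
Qed.

(** Edges at [z0] are given by their values at [z0], whose sum is to be exact. For the other
    captives only the parity matters, so their edges are given by the values at the end in [P],
    where sums are to be bounded. *)
Let wZ z0 (S0 B : pred E) e := if inc K z0 e then pv K e z0 (S0 e) else pv K e (uend e) (B e).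

Let va_u z0 S0 B z e u : z0 \in Z -> z \in Z -> z != z0 -> e \in at_ K z -> joins K e z u ->
  va K (wZ z0 S0 B) e u = B e.
Proof.
move=> z0Z zZ zz ez j; apply: va_pv; rewrite /wZ; case: ifP => [i0|_].
  by rewrite (one_z zZ z0Z ez i0) eqxx in zz.
by rewrite (uendE zZ ez j).
Qed.

Let va_z z0 S0 B z e : z0 \in Z -> z \in Z -> z != z0 -> e \in at_ K z ->
  va K (wZ z0 S0 B) e z = B e (+) od K e.
Proof.
move=> z0Z zZ zz ez; have [u j] := at_joins ez; move: (j); rewrite joinsC => j'.
by rewrite (va_other wfK _ (at_es ez) j') (va_u S0 B z0Z zZ zz ez j).
Qed.

Let va_0 z0 S0 B e : e \in at_ K z0 -> va K (wZ z0 S0 B) e z0 = S0 e.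
Proof. by move=> e0; apply: va_pv; rewrite /wZ inc_at. Qed.

Let ol z : {set E} := [set e in at_ K z | ~~ plain K e].
Let pl z : {set E} := [set e in at_ K z | plain K e].

Let card_pl_ol z : #|at_ K z| = #|pl z| + #|ol z|.
Proof.
rewrite -(cardsID [set e | plain K e] (at_ K z)); congr (_ + _); apply: eq_card => e.
  by rewrite !inE.
by rewrite !inE andbC.
Qed.

Lemma tg_card f x : tg K f x = odd #|[set e in at_ K x | f e]|.
Proof.
rewrite -sum1_card (big_morph odd oddD (erefl _)) /tg big_mkcond [RHS]big_mkcond /=.
by apply: eq_bigr => e _; rewrite inE; case: (e \in at_ K x); case: (f e).
Qed.

Let par_z z0 S0 B z : z0 \in Z -> z \in Z -> z != z0 ->
  odd (sm K (wZ z0 S0 B) z) = tg K B z (+) odd #|ol z|.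
Proof.
move=> z0Z zZ zz; rewrite odd_sm -tg_card /tg -big_split /=.
by apply: eq_bigr => e ez; rewrite va_z // (odE zZ).
Qed.

(** [full_config] in terms of [B]: a neighbour receives the plain edges from [z0] and the edges in
    [B] from the other captives. The parity at such a captive is shifted by its non-plain edges, all
    of which are odd. *)
Lemma captive_full z0 (B : pred E) : z0 \in Z ->
  (forall z, z \in Z -> z != z0 -> tg K B z (+) odd #|ol z| != odd #|at_ K z0|) ->
  (forall u, u \in P ->
     #|Qp z0 u| + #|[set e in at_ K u | B e && ~~ inc K z0 e]| + 1 < #|at_ K z0|) -> False.
Proof.
move=> z0Z Hpar Hb; pose w := wZ z0 predT B.
have sm0 : sm K w z0 = #|at_ K z0|.
  by apply: sm_card => // e ez; rewrite va_0 // ez.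
apply: (@full_config Z z0 w) => //.
- by rewrite ZP.
- by move=> z zZ zz; rewrite par_z // sm0 Hpar.
- by move=> e ez; rewrite va_0.
move=> u; rewrite ZP // => uP; apply: leq_ltn_trans (Hb u uP); rewrite leq_add2r.
rewrite -!sum1_card big_mkcond [X in _ <= X + _]big_mkcond [X in _ <= _ + X]big_mkcond.
rewrite -big_split /=; apply: leq_sum => e _.
case: ifP => // /andP[eu /existsP[z /andP[zZ iz]]].
have [ez j] := at_u zZ uP eu iz.
have [zE|zz] := eqVneq z z0; last first.
  rewrite (va_u _ _ z0Z zZ zz ez j) [e \in [set _ in _ | _]]inE eu /=.
  have -> : inc K z0 e = false by apply/negP => /(one_z zZ z0Z ez)/eqP; rewrite (negbTE zz).
  rewrite andbT.
  by case: (B e); rewrite ?addn1.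
subst z; rewrite (va_other wfK w (at_es ez) j) va_0 //= (odE z0Z ez) negbK.
case pe: (plain K e) => //; have -> : e \in Qp z0 u by rewrite inE ez pe j.
by [].
Qed.

(* [z0] gets sum 1 and all its neighbours get odd sums at least 3. *)
Lemma captive_gamma z0 us e0 (B : pred E) : z0 \in Z -> us \in P -> e0 \in Qp z0 us ->
  (forall z, z \in Z -> z != z0 -> tg K B z = odd #|ol z|) ->
  (forall u, u \in P -> exists f1 f2, [/\ f1 != f2,
     (u = us /\ f1 = e0) \/ (exists z, [/\ z \in Z, z != z0, f1 \in Eb z u & B f1])
     & (exists z, [/\ z \in Z, z != z0, f2 \in Eb z u & B f2])]) -> False.
Proof.
move=> z0Z usP e0Q Hpar Hu; pose w := wZ z0 (pred1 e0) B.
move: e0Q; rewrite inE => /and3P[e0z pe0 j0].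
have d0 := Zd z0Z.
have sm0 : sm K w z0 = 1.
  rewrite -(cards1 e0); apply: sm_card; first by rewrite sub1set.
  by move=> e ez; rewrite va_0 // inE.
have [|w' [w1 _ w3 [e [u [eK j nok]]]]] := bits_extend (w := w) Zd z0Z (fun u => @lvlP z0 u z0Z) Zx.
  by move=> z zZ zz; rewrite par_z // sm0 Hpar // addbb.
have sm0' : sm K w' z0 = 1.
  by rewrite -sm0; apply: eq_sm => f fz; apply: w1 fz.
have ez := joins_at eK j; have uP := ZN z0Z ez j.
have [_ uK _ _] := lvlP z0Z uP.
have pu : odd (sm K w' u).
  rewrite w3 // ?sm0 //; rewrite (joins_side wfK eK j); by case: (side u).
have [f1 [f2 [nf h1 h2]]] := Hu u uP.
have onP f : (exists z, [/\ z \in Z, z != z0, f \in Eb z u & B f]) -> f \in at_ K u /\ va K w' f u.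
  move=> [z [zZ zz]]; rewrite inE => /andP[fz fj] Bf; split; first exact: joins_atr (at_es fz) fj.
  by rewrite /va (w1 z f) // -/(va K w f u) (va_u _ _ z0Z zZ zz fz fj).
have [f2u o2] := onP f2 h2.
have [f1u o1] : f1 \in at_ K u /\ va K w' f1 u.
  case: h1 => [[uE fE]|]; last exact: onP.
  subst f1 u; split; first exact: joins_atr (at_es e0z) j0.
  by rewrite (va_other wfK w' (at_es e0z) j0) (even_plain wfK pe0) addbF /va (w1 z0 e0) // -/(va K w e0 z0) va_0 //= eqxx.
have s2 := sm_ge2 nf f1u f2u o1 o2.
have s3 : 2 < sm K w' u by move: pu s2; case: (sm K w' u) => [|[|[|]]].
case/negP: nok; rewrite (okE w' j) sm0'; case: ifP => _; first by apply: contraTneq s3 => <-.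
by apply/or4P/Or44; apply: leq_trans s3; case: (va _ _ _ u).
Qed.

Let pl_sum z : z \in Z -> #|pl z| = \sum_(u in P) #|Qp z u|.
Proof.
move=> zZ; rewrite -sum1_card (partition_big uend (mem P)) /=; last first.
  move=> e; rewrite inE => /andP[ez _]; have [u j] := at_joins ez.
  by rewrite (uendE zZ ez j); apply: ZN zZ ez j.
apply: eq_bigr => u uP; rewrite -sum1_card; apply: eq_bigl => e; rewrite !inE -/(e \in at_ K z).
apply/andP/and3P => [[/andP[/andP[eK ie] pe] /eqP ue]|[/andP[eK ie] pe j]].
  have ez : e \in at_ K z by rewrite inE eK.
  by have [u' j] := at_joins ez; rewrite (uendE zZ ez j) in ue; subst u'; split=> //; rewrite eK.
have ez : e \in at_ K z by rewrite inE eK.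
by rewrite (uendE zZ ez j) eqxx eK ie pe.
Qed.

Let at_sum z : z \in Z -> #|at_ K z| = \sum_(u in P) #|Eb z u|.
Proof.
move=> zZ; rewrite -sum1_card (partition_big uend (mem P)) /=; last first.
  move=> e ez; have [u j] := at_joins ez.
  by rewrite (uendE zZ ez j); apply: ZN zZ ez j.
apply: eq_bigr => u uP; rewrite -sum1_card; apply: eq_bigl => e; rewrite [RHS]inE.
apply/andP/andP => [[ez /eqP ue]|[ez j]].
  by have [u' j] := at_joins ez; rewrite (uendE zZ ez j) in ue; subst u'.
by rewrite (uendE zZ ez j) eqxx.
Qed.

Let Qp_ex z u : z \in Z -> u \in P -> exists e, e \in Qp z u.
Proof. by move=> zZ; rewrite -(ZP zZ) inE => /set0Pn. Qed.

Let Qp_Eb z u : Qp z u \subset Eb z u.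
Proof. by apply/subsetP => e; rewrite !inE => /and3P[-> _ ->]. Qed.

Let Eb_neq z z' u u' f f' : z \in Z -> z' \in Z -> z != z' -> f \in Eb z u -> f' \in Eb z' u' -> f != f'.
Proof.
move=> zZ z'Z zz; rewrite !inE -!/(_ \in at_ K _) => /andP[fz _] /andP[fz' _].
apply: contraNneq zz => fE; apply/eqP; apply: (@one_z z z' f) => //.
  by rewrite inE.
by rewrite fE; case/andP: fz'.
Qed.

Let P_two : Z != set0 -> exists u1 u2, [/\ u1 \in P, u2 \in P & u1 != u2].
Proof.
case/set0Pn => z zZ; have zK := deep_vs (Zd zZ).
have [e1 [u1 [e1z j1 _]]] := two_nbrs z zK.
have [e2 [u2 [e2z j2 n]]] := two_nbrs u1 zK.
by exists u1, u2; rewrite eq_sym n (ZN zZ e1z j1) (ZN zZ e2z j2).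
Qed.

(** With the other parity at [z1] its edges could all be off in [P]. So one edge of [z1] has to be
    turned on there, and this would be possible at any neighbour where [not_tight] is strict. *)
Lemma captive_pair_step z0 z1 : z0 != z1 -> Z = [set z0; z1] ->
  odd #|ol z1| = odd #|at_ K z0| /\ forall u, u \in P -> #|at_ K z0| = #|Qp z0 u| + 2.
Proof.
move=> nz ZE; have z0Z : z0 \in Z by rewrite ZE !inE eqxx.
have z1Z : z1 \in Z by rewrite ZE !inE eqxx orbT.
have zE z : z \in Z -> z != z0 -> z = z1 by rewrite ZE in_set2 => /orP[/eqP -> /eqP|/eqP].
have par : odd #|ol z1| = odd #|at_ K z0|.
  apply/eqP; apply: contraT => np; exfalso; apply: (@captive_full z0 pred0 z0Z).
    by move=> z zZ zz; rewrite (zE z zZ zz) /tg big1.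
  move=> u uP; rewrite [X in _ + X + _](eq_card (B := set0)) ?cards0; last first.
    by move=> e; rewrite [RHS]in_set0 in_set; case: (e \in at_ K u).
  by rewrite addn0 addn1; apply: not_tight (Zd z0Z).
split=> // u uP; apply/eqP; rewrite eqn_leq addn2 (not_tight u (Zd z0Z)) andbT leqNgt.
apply/negP => lt; have [es1 es1Q] := Qp_ex z1Z uP.
move: (es1Q); rewrite inE => /and3P[e1z _ j1].
apply: (@captive_full z0 (pred1 es1) z0Z).
  move=> z zZ zz; rewrite (zE z zZ zz) (tg1 wfK _ (at_es e1z) j1) eqxx [z1 == u]eq_sym (negbTE (zu z1Z uP)) par.
  by case: (odd _).
move=> u' u'P; case: (eqVneq u' u) => [->|uu].
  apply: leq_ltn_trans lt; rewrite addn1 ltnS -[X in _ <= X]addn1 leq_add2l.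
  rewrite -(cards1 es1); apply: subset_leq_card; apply/subsetP => e.
  by rewrite !inE => /andP[_ /andP[]].
rewrite [X in _ + X + _](eq_card (B := set0)) ?cards0; last first.
  move=> e; rewrite [RHS]inE; apply/negP; rewrite inE => /andP[eu /andP[/eqP eE _]]; subst e.
  have := joins_or j1 (inc_at eu); rewrite (negbTE uu) orbF => /eqP uz.
  by move: u'P; rewrite uz (negbTE (ZnP z1Z)).
by rewrite addn0 addn1; apply: not_tight (Zd z0Z).
Qed.


(** Equality in [not_tight] at every neighbour determines the numbers of plain edges. In the few
    cases left by [captive_pair_arith] the vertex [z1] has an even number of plain edges, and
    [captive_gamma] applies with all edges of [z1] on in [P]. *)
Lemma captive_pair z0 z1 : z0 != z1 -> Z = [set z0; z1] -> False.
Proof.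
move=> nz ZE; have z0Z : z0 \in Z by rewrite ZE !inE eqxx.
have z1Z : z1 \in Z by rewrite ZE !inE eqxx orbT.
have zE z : z \in Z -> z != z0 -> z = z1 by rewrite ZE in_set2 => /orP[/eqP -> /eqP|/eqP].
have [p01 D0E] := captive_pair_step nz ZE.
have [p10 D1E] : odd #|ol z0| = odd #|at_ K z1| /\ forall u, u \in P -> #|at_ K z1| = #|Qp z1 u| + 2.
  by apply: captive_pair_step; rewrite 1?eq_sym // setUC.
have Zn : Z != set0 by apply/set0Pn; exists z0.
have [u1 [u2 [u1P u2P u12]]] := P_two Zn.
have P2 : 1 < #|P|.
  have <- : #|[set u1; u2]| = 2 by rewrite cards2 u12.
  by apply: subset_leq_card; apply/subsetP => u; rewrite in_set2 => /orP[] /eqP ->.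
have plE z : z \in Z -> (forall u, u \in P -> #|at_ K z| = #|Qp z u| + 2) ->
    #|pl z| = #|P| * (#|at_ K z| - 2).
  move=> zZ DE; rewrite pl_sum // -sum_nat_const; apply: eq_bigr => u uP.
  by rewrite (DE u uP) addnK.
have [] := captive_pair_arith P2 (deep_deg (Zd z0Z)) (deep_deg (Zd z1Z)) _ _ p01 p10.
- by rewrite -(plE z0) // -card_pl_ol.
- by rewrite -(plE z1) // -card_pl_ol.
rewrite -(plE z1) // => evp cases.
(* One neighbour [us] is helped by the edge [e0] from [z0]; all others need two edges from [z1]. If
   [z1] has degree 3 and there are two neighbours, one of them carries at least two of its edges. *)
have [us usP big] : exists2 us, us \in P & forall u, u \in P -> u != us -> 1 < #|Eb z1 u|.
  case: cases => [D4|[s2 D3]].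
    exists u1 => // u uP _; apply: leq_trans (subset_leq_card (Qp_Eb z1 u)).
    by have := D1E u uP; rewrite D4 addn2 => -[<-].
  have PE : P = [set u1; u2].
    apply/esym/eqP; rewrite eqEcard s2 cards2 u12 andbT.
    by apply/subsetP => u; rewrite in_set2 => /orP[] /eqP ->.
  have := at_sum z1Z; rewrite D3 PE big_setU1 ?inE //= big_set1 => sE.
  case: (leqP 2 #|Eb z1 u1|) => c1.
    by exists u2; rewrite -?PE // => u; rewrite PE in_set2 => /orP[/eqP ->|->].
  exists u1; rewrite -?PE // => u; rewrite PE in_set2 => /orP[->|/eqP -> _] //.
  by move: sE c1; case: #|Eb z1 u1| => [|[|]] //; case: #|Eb z1 u2| => [|[|]].
have [e0 e0Q] := Qp_ex z0Z usP.
apply: (@captive_gamma z0 us e0 predT) => //.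
  move=> z zZ zz; rewrite (zE z zZ zz) tg_card.
  have -> : [set e in at_ K z1 | predT e] = at_ K z1 by apply/setP => e; rewrite inE andbT.
  by rewrite card_pl_ol oddD (negbTE evp).
have z10 : z1 != z0 by rewrite eq_sym.
move=> u uP; have [uE|uu] := eqVneq u us.
  subst u; have [f fQ] := Qp_ex z1Z uP; exists e0, f.
  have fE := subsetP (Qp_Eb z1 us) f fQ; have e0E := subsetP (Qp_Eb z0 us) e0 e0Q.
  split; [exact: (Eb_neq z0Z z1Z nz e0E fE) | by left | by exists z1].
have [f1 [f2 [f1E f2E nf]]] := two_of (big u uP uu).
by exists f1, f2; split=> //; [right|]; exists z1.
Qed.

(** If every captive is exceptional ([ex]), there are no non-plain edges and all degrees are odd, so
    [captive_full] works with [B] empty. Otherwise [B] consists of all edges except one edge [c z]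
    for each captive with an odd number of plain edges, which repairs its parity. The omitted edge
    has a parallel one or, failing that, goes to [us]. So neighbours other than [us] keep edges from
    both [z1] and [y2], and [us] has [e0] from [y0] and, as [z1] is not exceptional, an edge from
    [z1]. *)
Lemma captive_many : 2 < #|Z| -> False.
Proof.
move=> Z3; pose ex z := [forall u in P, #|Eb z u| <= 1] && odd #|pl z|.
have olE z : z \in Z -> (forall u, u \in P -> #|Eb z u| <= 1) -> #|ol z| = 0.
  move=> zZ H1; apply/eqP; rewrite cards_eq0; apply/eqP/setP => e; rewrite [RHS]in_set0.
  apply/negP; rewrite inE => /andP[ez npe]; have [u j] := at_joins ez.
  have uP := ZN zZ ez j; have [f fQ] := Qp_ex zZ uP.
  have := H1 u uP; rewrite (cardsD1 f) (subsetP (Qp_Eb z u) f fQ) ltnS leqn0 cards_eq0.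
  move/eqP/setP/(_ e); rewrite in_setD1 in_set0 [e \in Eb _ _]inE ez j andbT.
  have -> // : e != f by apply: contraNneq npe => ->; move: fQ; rewrite inE => /and3P[].
have [z0 z0Z] : exists z0, z0 \in Z by apply/set0Pn; rewrite -card_gt0; apply: leq_trans Z3.
case: (pickP [pred z in Z | ~~ ex z]) => [z1 /andP[z1Z nex]|allex]; last first.
  have exP z : z \in Z -> (forall u, u \in P -> #|Eb z u| <= 1) /\ odd #|pl z|.
    move=> zZ; have := allex z; rewrite /= zZ => /negbFE /andP[/forallP H1 op].
    by split=> // u uP; have := H1 u; rewrite uP.
  apply: (@captive_full z0 pred0 z0Z).
    move=> z zZ zz; rewrite (olE z zZ (exP z zZ).1) /tg big1 //.
    by rewrite card_pl_ol (olE z0 z0Z (exP z0 z0Z).1) addn0 (exP z0 z0Z).2.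
  move=> u uP; rewrite [X in _ + X + _](eq_card (B := set0)) ?cards0; last first.
    by move=> e; rewrite [RHS]in_set0 in_set; case: (e \in at_ K u).
  by rewrite addn0 addn1; apply: not_tight (Zd z0Z).
have c1 : 1 < #|Z :\ z1| by move: Z3; rewrite (cardsD1 z1) z1Z.
have [y0 [y2 [y0D y2D y02]]] := two_of c1.
move: y0D y2D; rewrite !in_setD1 => /andP[y01 y0Z] /andP[y21 y2Z].
have Zn : Z != set0 by apply/set0Pn; exists z0.
have [us [_ [usP _ _]]] := P_two Zn.
pose alt z (e : E) := [exists u, [exists e', [&& e' != e, e \in Eb z u & e' \in Eb z u]]].
have [c Hc] : exists c : V -> E, forall z, z \in Z -> (c z \in at_ K z) /\
    (alt z (c z) \/ ((forall u, u \in P -> #|Eb z u| <= 1) /\ c z \in Eb z us)).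
  apply: (@fin_all_exists V (fun=> E) (fun z e => z \in Z -> e \in at_ K z /\
    (alt z e \/ ((forall u, u \in P -> #|Eb z u| <= 1) /\ e \in Eb z us)))) => z.
  case zZ: (z \in Z); last by have [e _] := Qp_ex z0Z usP; exists e.
  case: (pickP [pred u in P | 1 < #|Eb z u|]) => [u /andP[uP E2]|none].
    have [f1 [f2 [f1E f2E nf]]] := two_of E2; exists f1 => _.
    split; first by move: f1E; rewrite inE => /andP[].
    by left; apply/existsP; exists u; apply/existsP; exists f2; rewrite eq_sym nf f1E f2E.
  have [e eQ] := Qp_ex zZ usP; have eE := subsetP (Qp_Eb z us) e eQ.
  exists e => _; split; first by move: eE; rewrite inE => /andP[].
  by right; split=> // u uP; rewrite leqNgt; have := none u; rewrite /= uP /= => ->.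
pose C e := [exists z in Z, (e == c z) && odd #|pl z|].
have Cz z e : z \in Z -> e \in at_ K z -> C e = (e == c z) && odd #|pl z|.
  move=> zZ ez; apply/existsP/idP => [[z' /and3P[z'Z /eqP eE op]]|h1]; last by exists z; rewrite zZ.
  have zz : z = z' by apply: (one_z zZ z'Z ez); rewrite eE; apply: inc_at; case: (Hc z' z'Z).
  by rewrite eE zz eqxx op.
have [e0 e0Q] := Qp_ex y0Z usP.
have give z u : z \in Z -> u \in P -> u != us \/ ~~ ex z -> exists2 f, f \in Eb z u & ~~ C f.
  move=> zZ uP cond; have [f0 f0Q] := Qp_ex zZ uP; have f0E := subsetP (Qp_Eb z u) f0 f0Q.
  have EbA f u' : f \in Eb z u' -> f \in at_ K z by rewrite inE => /andP[].
  case Cf: (C f0); last by exists f0; rewrite ?Cf.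
  move: Cf; rewrite (Cz z) ?(EbA f0 u) // => /andP[/eqP fc op].
  case: (Hc z zZ) => cz [/existsP[u' /existsP[e' /and3P[ne cE e'E]]]|[le1 cE]].
    have uu : u' = u.
      move: cE f0E; rewrite fc !inE -!/(_ \in at_ K _) => /andP[_ j1] /andP[_ j2].
      exact: (joins_inj wfK (at_es cz) j1 j2).
    subst u'; exists e' => //; rewrite (Cz z) ?(EbA e' u) //.
    by rewrite (negbTE ne).
  exfalso; have uu : u = us.
    move: cE f0E; rewrite fc !inE -!/(_ \in at_ K _) => /andP[_ j1] /andP[_ j2].
    exact: (joins_inj wfK (at_es cz) j2 j1).
  case: cond => [|/negP[]]; first by rewrite uu eqxx.
  by rewrite /ex op andbT; apply/forallP => u'; apply/implyP; apply: le1.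
apply: (@captive_gamma y0 us e0 (fun e => ~~ C e)) => //.
  move=> z zZ zz; transitivity (tg K (fun e => true (+) ((e == c z) && odd #|pl z|)) z).
    by apply: eq_bigr => e ez; rewrite (Cz z).
  rewrite tgD; have -> : tg K (fun=> true) z = odd #|at_ K z|.
    by rewrite tg_card; congr odd; apply: eq_card => e; rewrite !inE andbT.
  have -> : tg K (fun e => (e == c z) && odd #|pl z|) z = odd #|pl z|.
    have [cz _] := Hc z zZ.
    by rewrite /tg (bigD1 (c z)) //= eqxx big1 ?addbF // => e /andP[_ /negbTE ->].
  by rewrite card_pl_ol oddD; case: (odd #|pl z|); case: (odd _).
move=> u uP; have [uE|uu] := eqVneq u us.
  subst u; have [f fE nC] := give z1 us z1Z usP (or_intror nex).
  have e0E := subsetP (Qp_Eb y0 us) e0 e0Q.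
  exists e0, f; split; [exact: (Eb_neq y0Z z1Z y01 e0E fE) | by left |].
  by exists z1; split=> //; rewrite eq_sym.
have [f1 f1E nC1] := give z1 u z1Z uP (or_introl uu).
have [f2 f2E nC2] := give y2 u y2Z uP (or_introl uu).
exists f1, f2; split; first by rewrite (Eb_neq z1Z y2Z _ f1E f2E) // eq_sym.
  by right; exists z1; split=> //; rewrite eq_sym.
by exists y2; split=> //; rewrite eq_sym.
Qed.

Lemma captives_false : 1 < #|Z| -> False.
Proof.
move=> Z2; have [/captive_many //|] := ltnP 2 #|Z|.
move=> Zle; have /cards2P[z0 [z1 [nz ZE]]] : #|Z| == 2 by rewrite eqn_leq Zle.
exact: captive_pair nz ZE.
Qed.
End Captives.

Lemma Pn_Nb z : Pn z \subset Nb z.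
Proof.
apply/subsetP => u; rewrite !inE => /set0Pn[e]; rewrite inE => /and3P[ez _ j].
by apply/set0Pn; exists e; rewrite inE ez.
Qed.

Lemma Nb_joins z e u : e \in at_ K z -> joins K e z u -> u \in Nb z.
Proof. by move=> ez j; rewrite inE; apply/set0Pn; exists e; rewrite inE ez. Qed.

Lemma escapes x (P : {set V}) : ~~ (Nb x \subset P) ->
  exists e y, [/\ e \in at_ K x, joins K e x y & y \notin P].
Proof.
case/subsetPn => u; rewrite inE => /set0Pn[e]; rewrite inE => /andP[ex j] uP.
by exists e, u.
Qed.

(** By [full_alone] each deepest [z] has another deepest vertex with all neighbours in [Pn z]. Hence
    a smallest neighbourhood [P] of a deepest vertex consists of plain neighbours, for every vertex
    that has it, and at least two vertices have it. *)
Theorem no_end_block : Y != set0 -> False.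
Proof.
case/set0Pn => y yY.
have [h0 dh0] : exists h0, deep h0.
  have [h0 h0Y hm] := @arg_maxnP _ y (mem Y) l yY; exists h0; split=> //.
have DY x : (x \in Y) && (l x == l h0) -> deep x.
  by case/andP => xY /eqP; apply: deep_of.
have h0D : (h0 \in Y) && (l h0 == l h0) by rewrite dh0.1 eqxx.
have [h /DY dh hmin] := @arg_minnP _ h0 (fun x => (x \in Y) && (l x == l h0)) (fun x => #|Nb x|) h0D.
have min x : deep x -> #|Nb h| <= #|Nb x|.
  by move=> dx; apply: hmin; rewrite dx.1 (deep_l dh0 dx) eqxx.
have noalone z : deep z -> exists x, [/\ deep x, x != z & Nb x \subset Pn z].
  move=> dz; case: (pickP [pred x | [&& x \in Y, l x == l h0, x != z & Nb x \subset Pn z]]).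
    by move=> x /and4P[xY lx xz sub]; exists x; split=> //; apply: DY; rewrite xY.
  move=> none; case: (full_alone dz) => x dx xz; apply: escapes; apply/negP => sub.
  by have := none x; rewrite /= dx.1 (deep_l dh0 dx) eqxx xz sub.
have [c [dc ch sub]] := noalone h dh.
pose P := Pn h.
have NhP : Nb h = P.
  apply/esym/eqP; rewrite eqEcard Pn_Nb.
  exact: leq_trans (min c dc) (subset_leq_card sub).
have NP x : deep x -> Nb x \subset P -> Nb x = P.
  by move=> dx sx; apply/eqP; rewrite eqEcard sx -NhP min.
pose Z := [set z in Y | (l z == l h0) && (Nb z == P)].
have ZdN z : z \in Z -> deep z /\ Nb z = P.
  by rewrite inE => /and3P[zY lz /eqP NE]; split=> //; apply: DY; rewrite zY.
have inZ z : deep z -> Nb z = P -> z \in Z.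
  by move=> dz NE; rewrite inE dz.1 (deep_l dh0 dz) NE !eqxx.
apply: (@captives_false Z P).
- by move=> z /ZdN[].
- move=> z /ZdN[dz NE]; rewrite -NE; apply/eqP; rewrite eqEcard Pn_Nb.
  have [x [dx _ sx]] := noalone z dz.
  by rewrite NE -NhP; apply: leq_trans (min x dx) (subset_leq_card sx).
- by move=> z e u /ZdN[dz <-] ez j; apply: Nb_joins ez j.
- move=> x dx xZ; apply: escapes; apply: contraNN xZ => sx.
  by apply: inZ => //; apply: NP.
have hZ : h \in Z by apply: inZ.
have cZ : c \in Z by apply: inZ => //; apply: NP.
by rewrite (cardsD1 h) hZ ltnS card_gt0; apply/set0Pn; exists c; rewrite in_setD1 ch.
Qed.

End EndBlock.

(** * Irreducible labelled graphs *)

Section Crux.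
Variables (V E : finType) (side : V -> bool).
Implicit Types (K : lgraph V E).

Lemma eq_ok K (w w' : E -> bool) e : w =1 w' -> ok K w e = ok K w' e.
Proof.
move=> ww; rewrite /ok /va !(ww e).
by rewrite !(eq_sm (K := K) (w := w) (w' := w')).
Qed.

Lemma kpropP K : reflect (kprop K) [exists w : {ffun E -> bool}, [forall e in es K, ok K w e]].
Proof.
apply: (iffP existsP) => [[w /forall_inP H]|[w H]]; first by exists w.
exists [ffun e => w e]; apply/forall_inP => e eK.
by rewrite (@eq_ok _ _ w) ?H // => f; rewrite ffunE.
Qed.

Section Irr.
Variable (K : lgraph V E).
Hypothesis wfK : wf side K.

Definition closed_at (r : V) (Y : {set V}) :=
  [&& r \in vs K, Y \subset vs K, Y != set0, r \notin Y
    & [forall e in es K, forall x, forall y, joins K e x y ==> (x \in Y) ==> (y \in r |: Y)]].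

Lemma closed_atP r Y e x y : closed_at r Y -> e \in es K -> joins K e x y -> x \in Y ->
  y \in Y \/ y = r.
Proof.
case/and5P => _ _ _ _ /forall_inP H eK j xY.
have /forallP /(_ x) /forallP /(_ y) := H e eK; rewrite j xY in_setU1 /= => /orP[/eqP|]; by auto.
Qed.

(** If deleting [x] disconnected the graph, a part [C] without [r] would be attached only to [x],
    and [C :&: Y] would be closed at [x] and smaller than [Y]. *)
Lemma min_closed_noncut r (Y : {set V}) : closed_at r Y ->
  (forall r' Y', closed_at r' Y' -> #|Y| <= #|Y'|) ->
  forall x r', x \in Y -> r' \in vs K -> r' != x ->
  exists l' : V -> nat, forall y, y \in vs K -> y != x -> y != r' ->
  exists e z, [/\ e \in es K, joins K e y z, z != x & l' z < l' y].
Proof.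
move=> cY minY x r' xY r'K r'x; have /and5P[rK YK Yn rY _] := cY.
have xK : x \in vs K := subsetP YK x xY.
have xr : x != r by apply: contraNneq rY => <-.
have r'A : r' \in vs K :\ x by rewrite in_setD1 r'x.
have [|l' [_ low _]] := @rel_levels V (edge_rel K predT) (vs K :\ x) r' r'A; last first.
  exists l' => y yK yx yr'; have [|z] := low y _ yr'; first by rewrite in_setD1 yx.
  rewrite in_setD1 => /andP[zx zK] /andP[/edge_relP[e [eK _ j]] lt].
  by exists e, z; rewrite joinsC.
move=> S SA r'S SnA.
case: (pickP [pred p : V * V | [&& p.1 \in S, p.2 \in (vs K :\ x) :\: S & edge_rel K predT p.1 p.2]]).
  by move=> [y z] /and3P[*]; exists y, z.
move=> none; exfalso.
have nbr C e y z : (C = S \/ C = (vs K :\ x) :\: S) -> e \in es K -> joins K e y z -> y \in C ->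
    z \in C \/ z = x.
  move=> CE eK j yC; have [zx|zx] := eqVneq z x; [by right | left].
  have [yK zK] := joins_vs wfK eK j.
  case: CE => CE; subst C.
    apply: contraT => zS; have := none (y, z); rewrite /= yC in_setD zS in_setD1 zx zK /=.
    by move=> /edge_relP[]; exists e.
  rewrite in_setD in_setD1 zx zK /= andbT; apply/negP => zS.
  have := none (z, y); rewrite /= zS yC /= => /edge_relP[]; exists e; by rewrite joinsC.
have key C : (C = S \/ C = (vs K :\ x) :\: S) -> C != set0 -> r \notin C -> False.
  move=> CE Cn rC.
  have CA : C \subset vs K :\ x by case: CE => ->; rewrite ?subsetDl.
  have CK : C \subset vs K := subset_trans CA (subsetDl _ _).
  have xC : x \notin C by apply/negP => /(subsetP CA); rewrite !inE eqxx.
  have CYn : C :&: Y != set0.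
    have [|e] := cut_nonempty wfK CK Cn.
      by apply/eqP => CE'; rewrite CE' xK in xC.
    case/(cutP wfK) => y [z [eK j yC]]; rewrite in_setD => /andP[zC _].
    case: (nbr C e y z CE eK j yC) => [|zx]; first by rewrite (negbTE zC).
    subst z; rewrite joinsC in j.
    case: (closed_atP cY eK j xY) => [yY|yr]; first by apply/set0Pn; exists y; rewrite in_setI yC.
    by rewrite -yr yC in rC.
  have cl : closed_at x (C :&: Y).
    apply/and5P; split=> //.
    - exact: subset_trans (subsetIl _ _) CK.
    - by rewrite in_setI negb_and xC.
    apply/forall_inP => e eK; apply/forallP => y; apply/forallP => z.
    apply/implyP => j; apply/implyP; rewrite in_setI => /andP[yC yY].
    rewrite in_setU1 in_setI; case: (nbr C e y z CE eK j yC) => [zC|->]; last by rewrite eqxx.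
    case: (closed_atP cY eK j yY) => [zY|zr]; first by rewrite zC zY orbT.
    by rewrite -zr zC in rC.
  have := minY _ _ cl; rewrite leqNgt => /negP[].
  rewrite [X in _ < X](cardsD1 x) xY ltnS; apply: subset_leq_card.
  apply/subsetP => y; rewrite in_setI in_setD1 => /andP[yC ->]; rewrite andbT.
  by apply: contraNneq xC => <-.
case rS: (r \in S).
  apply: (key ((vs K :\ x) :\: S)); [by right| |by rewrite in_setD rS].
  by rewrite setD_eq0; apply: contraNN SnA => sub; rewrite eqEsubset SA.
by apply: (key S); [left | apply/set0Pn; exists r' | rewrite rS].
Qed.

(** All vertices but one form a closed set, so a smallest closed pair exists; it satisfies the
    hypotheses of [no_end_block]. *)
Theorem irreducible_kprop : irreducible K -> 2 < #|vs K| -> kprop K.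
Proof.
move=> irr v3; case: (kpropP K) => // nK; exfalso.
have two_nbrs x y : x \in vs K -> exists e z, [/\ e \in at_ K x, joins K e x z & z != y].
  move=> xK; case: (pickP [pred e in at_ K x | ~~ joins K e x y]) => [e /andP[ex nj]|none].
    by have [z j] := at_joins ex; exists e, z; split=> //; apply: contraNneq nj => <-.
  case: (case_one_nbr wfK (h := x) (t := y) nK xK v3) => e ex.
  by have := none e; rewrite /= ex /= => /negbFE.
have [r0 r0K] : exists r0, r0 \in vs K by apply/set0Pn; rewrite -card_gt0; apply: leq_trans v3.
have cl0 : closed_at r0 (vs K :\ r0).
  apply/and5P; split=> //.
  - exact: subsetDl.
  - by rewrite -card_gt0; move: v3; rewrite (cardsD1 r0) r0K; case: #|_|.
  - by rewrite !inE eqxx.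
  apply/forall_inP => e eK; apply/forallP => y; apply/forallP => z.
  apply/implyP => j; apply/implyP => _; have [_ zK] := joins_vs wfK eK j.
  by rewrite in_setU1 in_setD1 zK; case: eqP.
have [[r Y] /= cY minY] := @arg_minnP _ (r0, vs K :\ r0) (fun p => closed_at p.1 p.2) (fun p => #|p.2|) cl0.
have /and5P[rK YK Yn rY _] := cY.
have [l [l0 ll ladj lside]] := lvl_exist wfK rK.
apply: (@no_end_block V E side K wfK irr nK two_nbrs r Y l) => //.
- by move=> e x y eK j xY; apply: closed_atP cY eK j xY.
- by apply: (min_closed_noncut cY) => r' Y'; apply: (minY (r', Y')).
Qed.
End Irr.
End Crux.

(** * Reductions *)

Lemma exists_subset (T : finType) (A : {set T}) n : n <= #|A| ->
  exists2 B : {set T}, B \subset A & #|B| = n.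
Proof.
elim: n => [_|n IH lt]; first by exists set0; rewrite ?sub0set ?cards0.
have [B BA Bn] := IH (ltnW lt).
have [x] : exists x, x \in A :\: B.
  by apply/set0Pn; rewrite -card_gt0 cardsD (setIidPr BA) Bn subn_gt0.
rewrite in_setD => /andP[xB xA]; exists (x |: B); first by rewrite subUset sub1set xA.
by rewrite cardsU1 xB Bn.
Qed.

Section EndCond.
Variables (pl th : bool) (sa : nat) (al x : bool).
(** The condition on an outer edge of a pod when [g] edges of the bundle are on: [sa] and [al] are
    the sum and the value at the far end, [x] is the value at the pod, and [x + g] the sum of the
    pod vertex. *)
Definition end_ok g :=
  if pl then sa != x + g else [|| th, odd sa != odd (x + g), al.+1 < sa | x.+1 < x + g].

(** A plain edge forbids a single sum. A non-plain edge forbids at most the values of one parity,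
    and never 2, since the bundle then contributes enough at the pod. *)
Lemma end_ok_excl : exists k, forall g, g <= 2 -> g != k -> end_ok g.
Proof.
rewrite /end_ok; case: pl.
  exists (sa - x) => g _; apply: contraNneq => ->; by rewrite addKn.
exists (nat_of_bool (odd sa != x)) => -[|[|[|]]] // _.
- by case: x; case: (odd sa) => //= _; rewrite ?orbT.
- by case: x; case: (odd sa) => //= _; rewrite ?orbT.
by rewrite addn2 ltnSn !orbT.
Qed.

Lemma end_ok_bad (g : bool) : (pl -> x = al) -> ~~ end_ok g ->
  [/\ ~~ th || pl, sa <= al.+1 & odd sa = x (+) g].
Proof.
rewrite /end_ok; case: pl => [/(_ isT) <-|_]; rewrite ?orbT ?orbF.
  by rewrite negbK => /eqP ->; split=> //; case: x; case: g.
rewrite !negb_or !negbK -!leqNgt => /and4P[-> /eqP -> -> _]; split=> //.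
by rewrite oddD; case: x; case: g.
Qed.
End EndCond.

Section Reduce.
Variables (V E : finType) (side : V -> bool).
Implicit Types (K : lgraph V E) (w : E -> bool) (x y u v a b : V) (e : E).

Definition thin K e := ~~ plain K e && ~~ thick K e.

(* A thin edge between vertices of degree 2 could neither be contracted nor be used by
   [degree_two_config]; hence the reductions maintain this invariant. *)
Record thin_inv K : Prop := ThinInv {
  inv_high : forall r, r \in vs K -> 2 < #|at_ K r| ->
    forall e x y, e \in es K -> thin K e -> joins K e x y -> 2 < #|at_ K x| \/ 2 < #|at_ K y|;
  inv_low : (forall x, x \in vs K -> #|at_ K x| <= 2) ->
    (forall e f, e \in es K -> f \in es K -> thin K e -> thin K f -> e = f) /\
    (forall e f, e \in es K -> f \in es K -> thin K e -> ~~ thick K f)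
}.

Definition relabel K e : lgraph V E :=
  LGraph (vs K) (es K) (src K) (dst K) (fun f => plain K f || (f == e))
    (fun f => thick K f && (f != e)) (od K).

(* Suppresses the pod [u], [v]; the new edge from [a] to [b] keeps the name [eu]. *)
Definition contract K u v eu ev a b : lgraph V E :=
  LGraph (vs K :\: [set u; v]) (eu |: (es K :\: (at_ K u :|: at_ K v)))
    (fun e => if e == eu then a else src K e)
    (fun e => if e == eu then b else dst K e)
    (fun e => (e != eu) && plain K e)
    (fun e => if e == eu then [|| thick K eu, thick K ev | 2 < #|at_ K u|] else thick K e)
    (fun e => if e == eu then ~~ (od K eu (+) od K ev) else od K e).

(** Keeps the whole sequence of reductions, so that it can be undone step by step. *)
Inductive reducible_to_pair : lgraph V E -> Prop :=
| RPair K : wf side K -> #|vs K| = 2 -> (forall e, e \in es K -> plain K e) ->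
    reducible_to_pair K
| RRelabel K e f x y : wf side K -> e \in es K -> f \in es K -> joins K e x y ->
    joins K f x y -> plain K f -> ~~ plain K e -> ~~ od K e ->
    reducible_to_pair (relabel K e) -> reducible_to_pair K
| RContract K u v eu ev a b : wf side K -> pod K u v eu ev -> joins K eu u a -> joins K ev v b ->
    reducible_to_pair (contract K u v eu ev a b) -> reducible_to_pair K.

Section Relabel.
Variables (K : lgraph V E) (e f : E) (x y : V).
Hypothesis wfK : wf side K.
Hypothesis eK : e \in es K.
Hypothesis fK : f \in es K.
Hypothesis je : joins K e x y.
Hypothesis jf : joins K f x y.
Hypothesis pf : plain K f.
Hypothesis npe : ~~ plain K e.
Hypothesis ode : ~~ od K e.

Lemma relabel_wf : wf side (relabel K e).
Proof.
case: wfK => h1 h2 h3 h4 h5; split=> //= g /orP[/h4 /andP[/negbTE -> ->] //|/eqP ->].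
by rewrite eqxx andbF.
Qed.

(** The end sums differ because of [f]. If their parities agree they differ by at least 2, and the
    larger one exceeds by at least 2 the value of [e], which is the same at both ends as [e] is
    even. *)
Lemma relabel_kprop : kprop (relabel K e) -> kprop K.
Proof.
case=> w H; exists w => g gK; have := H g gK.
have [->|ge] := eqVneq g e; last by rewrite /ok /= (negbTE ge) orbF andbT.
move=> _; have : sm K w (src K f) != sm K w (dst K f).
  by have := H f fK; rewrite /ok /= pf.
have -> : (sm K w (src K f) != sm K w (dst K f)) = (sm K w x != sm K w y).
  by case/joinsP: jf => -[-> ->] //; rewrite eq_sym.
move=> ne; rewrite (okE w je) (negbTE npe).
have [//|pxy] := boolP (odd (sm K w x) != odd (sm K w y)); first by rewrite orbT.
have vxy : va K w e y = va K w e x by rewrite (va_other wfK w eK je) (negbTE ode) addbF.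
have lex : va K w e x <= sm K w x.
  by case vx: (va K w e x) => //; apply: sm_ge1 (joins_at eK je) vx.
have ley : va K w e x <= sm K w y.
  by rewrite -vxy; case vy: (va K w e y) => //; apply: sm_ge1 (joins_atr eK je) vy.
rewrite vxy negbK in pxy *; apply/or4P.
move: (sm K w x) (sm K w y) (va K w e x : nat) ne pxy lex ley => sx sy n ne /eqP pxy lex ley.
have : n.+1 < sx \/ n.+1 < sy by lia.
by case; [apply: Or43 | apply: Or44].
Qed.

Lemma relabel_inv : thin_inv K -> thin_inv (relabel K e).
Proof.
have th g : thin (relabel K e) g -> thin K g.
  by rewrite /thin /= negb_or negb_and negbK => /andP[/andP[-> /negbTE ->]]; rewrite orbF.
case=> h1 h2; split.
  move=> r rK dr g x' y' gK tg jg; exact: (h1 r rK dr g x' y' gK (th g tg) jg).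
move=> dd; have [i1 i2] := h2 dd; split.
  by move=> g g' gK g'K /th t1 /th t2; apply: i1.
by move=> g g' gK g'K /th t1 /=; rewrite (negbTE (i2 g g' gK g'K t1)).
Qed.
End Relabel.

Section Contract.
Variables (K : lgraph V E) (u v : V) (eu ev : E) (a b : V).
Hypothesis wfK : wf side K.
Hypothesis pd : pod K u v eu ev.
Hypothesis ja : joins K eu u a.
Hypothesis jb : joins K ev v b.
Let K' := contract K u v eu ev a b.

Let euu : eu \in at_ K u. Proof. by case: pd => /andP[]. Qed.
Let evv : ev \in at_ K v. Proof. by case: pd => _ /andP[]. Qed.
Let nveu : ~~ inc K v eu. Proof. by case: pd => /andP[]. Qed.
Let nuev : ~~ inc K u ev. Proof. by case: pd => _ /andP[]. Qed.
Let euK := at_es euu.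
Let evK := at_es evv.
Let uK : u \in vs K. Proof. by case: (joins_vs wfK euK ja). Qed.
Let vK : v \in vs K. Proof. by case: (joins_vs wfK evK jb). Qed.
Let aK : a \in vs K. Proof. by case: (joins_vs wfK euK ja). Qed.
Let bK : b \in vs K. Proof. by case: (joins_vs wfK evK jb). Qed.
Let neuv : eu != ev. Proof. by apply: contraNneq nveu => ->; move: evv; rewrite inE => /andP[]. Qed.
Let au : a != u. Proof. by rewrite eq_sym; exact: (joins_neq wfK euK ja). Qed.
Let bv : b != v. Proof. by rewrite eq_sym; exact: (joins_neq wfK evK jb). Qed.
Let av : a != v.
Proof. by apply: contraNneq nveu => <-; move: ja; rewrite joinsC; exact: joins_inc. Qed.
Let bu : b != u.
Proof. by apply: contraNneq nuev => <-; move: jb; rewrite joinsC; exact: joins_inc. Qed.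

Let iat e x : e \in at_ K x -> inc K x e. Proof. by rewrite inE => /andP[]. Qed.
Let Mu e : e \in at_ K u -> e != eu -> plain K e && joins K e u v.
Proof. by case: pd => _ _ h _; apply: h. Qed.
Let Mv e : e \in at_ K v -> e != ev -> plain K e && joins K e v u.
Proof. by case: pd => _ _ _ h; apply: h. Qed.

Let atuv : at_ K u :\ eu = at_ K v :\ ev.
Proof.
apply/setP => e; rewrite !in_setD1; apply/andP/andP => -[ne ex].
  have /andP[_ j] := Mu ex ne; split; last exact: joins_atr (at_es ex) j.
  by apply: contraNneq nuev => <-; apply: iat.
have /andP[_ j] := Mv ex ne; split; last exact: joins_atr (at_es ex) j.
by apply: contraNneq nveu => <-; apply: iat.
Qed.

Let vs3 : vs K != [set u].
Proof. by apply/eqP => E1; move: vK; rewrite E1 inE => /eqP vu; move: nveu; rewrite vu iat. Qed.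

Let bundle : exists2 e, e \in at_ K u & e != eu.
Proof. by apply: other_in; apply: (card_at_ge2 wfK). Qed.

Let uv : u != v.
Proof.
have [e ez ne] := bundle; have /andP[_ j] := Mu ez ne; exact: (joins_neq wfK (at_es ez) j).
Qed.

Let suv : side u = ~~ side v.
Proof. by have [e ez ne] := bundle; have /andP[_ j] := Mu ez ne; exact: (joins_side wfK (at_es ez) j). Qed.

Let ab_side : side a != side b.
Proof.
have := joins_side wfK euK ja; have := joins_side wfK evK jb; rewrite suv.
by case: (side v); case: (side a); case: (side b).
Qed.

Let inE' e : (e \in es K') = (e == eu) || [&& e \in es K, ~~ inc K u e & ~~ inc K v e].
Proof.
rewrite in_setU1 in_setD in_setU negb_or !inE; case: (e == eu) => //=.
by case: (e \in es K); rewrite ?andbF ?andbT.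
Qed.

Let vs'E x : (x \in vs K') = [&& x != u, x != v & x \in vs K].
Proof. by rewrite in_setD !inE negb_or -andbA. Qed.

Let other e : e \in es K -> e != eu -> e != ev -> inc K u e || inc K v e -> joins K e u v.
Proof.
move=> eK n1 n2 /orP[iu|iv].
  by have /andP[_] : plain K e && joins K e u v by apply: Mu => //; rewrite inE eK.
by have /andP[_] : plain K e && joins K e v u; [apply: Mv => //; rewrite inE eK | rewrite joinsC].
Qed.

Let a_in : a \in vs K'. Proof. by rewrite vs'E au av. Qed.
Let b_in : b \in vs K'. Proof. by rewrite vs'E bu bv. Qed.

Lemma contract_wf : wf side K'.
Proof.
have cases e : e \in es K' -> e != eu -> [/\ e \in es K, ~~ inc K u e & ~~ inc K v e].
  by rewrite inE' => /orP[->//|/and3P[]].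
split.
- move=> e eK'; rewrite /=; have [_|ne] := eqVneq e eu; first exact: a_in.
  have [eK iu iv] := cases e eK' ne; rewrite -/(vs K') vs'E (wf_src wfK) // andbT.
  by move: iu iv; rewrite /inc !negb_or ![src K e == _]eq_sym => /andP[-> _] /andP[->].
- move=> e eK'; rewrite /=; have [_|ne] := eqVneq e eu; first exact: b_in.
  have [eK iu iv] := cases e eK' ne; rewrite -/(vs K') vs'E (wf_dst wfK) // andbT.
  by move: iu iv; rewrite /inc !negb_or ![dst K e == _]eq_sym => /andP[_ ->] /andP[_ ->].
- move=> e eK'; rewrite /=; have [_|ne] := eqVneq e eu; first exact: ab_side.
  by have [eK _ _] := cases e eK' ne; exact: (wf_side wfK eK).
- by move=> e /= /andP[/negbTE -> /(wf_plain wfK)].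
move=> S SK' Sn SnK'.
(* Placing [u] and [v] on the side of [a] keeps [eu] out of the cut; [ev] crosses only if the
   contracted edge does. *)
pose T := if a \in S then S :|: [set u; v] else S.
have TS x : x != u -> x != v -> (x \in T) = (x \in S).
  by move=> xu xv; rewrite /T; case: ifP => // _; rewrite !inE (negbTE xu) (negbTE xv) /= orbF.
have uS : u \notin S by apply/negP => /(subsetP SK'); rewrite -/(vs K') vs'E eqxx.
have vS : v \notin S by apply/negP => /(subsetP SK'); rewrite -/(vs K') vs'E eqxx andbF.
have Tu : (u \in T) = (a \in S) by rewrite /T; case: ifP; rewrite ?(negbTE uS) // !inE eqxx ?orbT.
have Tv : (v \in T) = (a \in S) by rewrite /T; case: ifP; rewrite ?(negbTE vS) // !inE eqxx ?orbT.
have Ta : (a \in T) = (a \in S) by apply: TS.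
have Tb : (b \in T) = (b \in S) by apply: TS.
have SK : S \subset vs K by apply: subset_trans SK' (subsetDl _ _).
have cT : 1 < #|cut K T|.
  apply: (wf_cut wfK).
  - rewrite /T; case: ifP => // _; rewrite subUset SK; apply/subsetP => x.
    by rewrite in_set2 => /orP[] /eqP ->.
  - case/set0Pn: Sn => x xS; apply/set0Pn; exists x; rewrite TS //; [apply: contraNneq uS | apply: contraNneq vS];
      by move=> <-.
  apply: contraNneq SnK' => TE; rewrite eqEsubset SK' /=; apply/subsetP => x.
  by rewrite -/(vs K') vs'E => /and3P[xu xv xK]; rewrite -(TS x) // TE.
have jE e x y (S1 : {set V}) : joins K e x y -> ((src K e \in S1) != (dst K e \in S1)) = ((x \in S1) != (y \in S1)).
  by case/joinsP => -[-> ->] //; rewrite eq_sym.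
have cutE e : e != eu -> e != ev -> (e \in cut K T) -> e \in cut K' S.
  move=> n1 n2; rewrite inE => /andP[eK ne]; rewrite inE inE' (negbTE n1) /= eK /=.
  case iuv: (inc K u e || inc K v e).
    by move: ne; rewrite (jE _ _ _ _ (other eK n1 n2 iuv)) Tu Tv eqxx.
  move/negbT: iuv; rewrite negb_or => /andP[iu iv]; rewrite iu iv /=.
  move: ne iu iv; rewrite /inc !negb_or => ne /andP[su du] /andP[sv dv].
  by rewrite /= (negbTE n1) -(TS (src K e)) -1?(TS (dst K e)) // eq_sym.
have evT : ev \in cut K T -> eu \in cut K' S.
  by rewrite inE => /andP[_]; rewrite (jE _ _ _ _ jb) Tv Tb inE inE' /= !eqxx.
have euT : eu \notin cut K T by rewrite inE (jE _ _ _ _ ja) Tu Ta eqxx andbF.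
apply: leq_trans cT _.
have sub : (if ev \in cut K T then eu |: (cut K T :\ ev) else cut K T) \subset cut K' S.
  case: ifP => evc; apply/subsetP => e.
    rewrite in_setU1 in_setD1 => /orP[/eqP ->|/andP[n2 ec]]; first exact: evT.
    by apply: cutE => //; apply: contraNneq euT => <-.
  by move=> ec; apply: cutE => //; [apply: contraNneq euT => <- | apply: contraFneq evc => <-].
apply: leq_trans (subset_leq_card sub); case: ifP => // evc.
by rewrite cardsU1 in_setD1 (negbTE euT) andbF add1n (cardsD1 ev (cut K T)) evc.
Qed.

Let inc'E x e : e != eu -> inc K' x e = inc K x e.
Proof. by rewrite /inc /= => /negbTE ->. Qed.
Let inc'eu x : inc K' x eu = (x == a) || (x == b).
Proof. by rewrite /inc /= eqxx. Qed.

Let at_a : eu \in at_ K a. Proof. exact: joins_atr euK ja. Qed.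
Let at_b : ev \in at_ K b. Proof. exact: joins_atr evK jb. Qed.
Let ab : a != b. Proof. by apply: contraNneq ab_side => ->. Qed.

Let at'E x : x \in vs K' -> at_ K' x = if x == b then eu |: (at_ K b :\ ev) else at_ K x.
Proof.
rewrite vs'E => /and3P[xu xv xK].
have main e : e != eu -> e != ev -> (e \in at_ K' x) = (e \in at_ K x).
  move=> n1 n2; rewrite [LHS]inE [RHS]inE inE' inc'E // (negbTE n1) /=.
  case eK: (e \in es K) => //=; case ix: (inc K x e); rewrite ?andbF // andbT.
  apply/negPn; rewrite negb_and !negbK; apply/negP => iuv.
  have := joins_or (other eK n1 n2 iuv) ix; by rewrite (negbTE xu) (negbTE xv).
apply/setP => e; have [->|n1] := eqVneq e eu.
  rewrite [LHS]inE inE' eqxx /= inc'eu; case: (x =P b) => [->|xb]; first by rewrite setU11 orbT.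
  rewrite orbF; apply/eqP/idP => [->|]; first exact: at_a.
  by move/iat/(joins_or ja); rewrite (negbTE xu) => /eqP.
have [->|n2] := eqVneq e ev.
  rewrite [LHS]inE inE' eq_sym (negbTE neuv) /= (iat evv) !andbF /=.
  case: eqP => [_|xb]; first by rewrite in_setU1 in_setD1 eqxx eq_sym (negbTE neuv).
  by apply/esym/negP => /iat/(joins_or jb); rewrite (negbTE xv) => /eqP.
rewrite main //; case: eqP => // ->; by rewrite in_setU1 in_setD1 (negbTE n1) n2.
Qed.

Let eu_b : eu \notin at_ K b.
Proof. by apply/negP => /iat/(joins_or ja); rewrite (negbTE bu) eq_sym (negbTE ab). Qed.

Lemma contract_deg x : x \in vs K' -> #|at_ K' x| = #|at_ K x|.
Proof.
move=> xK'; rewrite at'E //; case: eqP => // ->.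
by rewrite cardsU1 in_setD1 (negbTE eu_b) andbF add1n [RHS](cardsD1 ev) at_b.
Qed.

(** The values at [a] and [b] are kept and give opposite values at [u] and [v], so the bundle is
    good; what remains free is the number [g] of its edges that are on. Each outer edge forbids at
    most one value. Two parallel edges allow three values of [g]; for a single edge, [ok] of the
    contracted edge leaves one of the two values. *)
Lemma contract_kprop : kprop K' -> kprop K.
Proof.
have ja' : joins K eu a u by rewrite joinsC.
have jb' : joins K ev b v by rewrite joinsC.
case=> w' H; pose al := va K' w' eu a; pose be := va K' w' eu b.
pose xu := al (+) od K eu; pose xv := be (+) od K ev.
have ab' : b == a = false by rewrite eq_sym (negbTE ab).
have beE : be = al (+) ~~ (od K eu (+) od K ev).
  by rewrite /be /al /va /= eqxx eqxx (negbTE ab) andbF addbF andbT.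
have xuv : xv = ~~ xu by rewrite /xv /xu beE; case: (al); case: (od K eu); case: (od K ev).
pose wt (G : {set E}) e := if e == eu then pv K eu a al else if e == ev then pv K ev b be
  else if e \in at_ K u then e \in G else w' e.
have wtsm G x : x \in vs K' -> sm K (wt G) x = sm K' w' x.
  move=> xK'; have main e : e \in at_ K' x -> e != eu -> va K (wt G) e x = va K' w' e x.
    move=> ex n1; rewrite /va /= (negbTE n1); congr (_ (+) _); rewrite /wt (negbTE n1).
    move: ex; rewrite inE inE' (negbTE n1) /= => /andP[/and3P[eK iu iv] _].
    have -> : (e == ev) = false by apply: contraNF iv => /eqP ->; apply: iat.
    by rewrite inE (negbTE iu) andbF.
  rewrite /sm at'E //; case: eqP => [xb|xb].
    subst x; rewrite (big_setD1 ev) //= big_setU1 /=; last by rewrite in_setD1 negb_and eu_b orbT.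
    congr (_ + _).
      rewrite (va_pv (b := be)) // /wt eq_sym (negbTE neuv) eqxx //.
    apply: eq_bigr => e eb; rewrite main //.
      by rewrite at'E // eqxx in_setU1 eb orbT.
    by apply: contraNneq eu_b => <-; move: eb; rewrite in_setD1 => /andP[].
  apply: eq_bigr => e ex; have [eE|ne] := eqVneq e eu; last first.
    by rewrite main // at'E //; move/eqP/negbTE: xb => ->.
  subst e; have xa : x = a.
    have := joins_or ja (iat ex); move: xK'; rewrite vs'E => /and3P[/negbTE -> _ _] /=.
    by move/eqP.
  by subst x; rewrite (va_pv (b := al)) // /wt eqxx.
have alle g : g <= #|at_ K u :\ eu| ->
    end_ok (plain K eu) (thick K eu) (sm K' w' a) al xu g ->
    end_ok (plain K ev) (thick K ev) (sm K' w' b) be xv g -> kprop K.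
  move=> gle oku okv; have [G GM Gg] := exists_subset gle.
  exists (wt G) => e eK.
  have vaM x f : f \in at_ K u :\ eu -> va K (wt G) f x = (f \in G).
    rewrite in_setD1 => /andP[n1 fu]; have /andP[pf _] := Mu fu n1.
    rewrite /va (even_plain wfK pf) addbF /wt (negbTE n1) fu.
    have -> // : (f == ev) = false by apply: contraNF nuev => /eqP <-; apply: iat.
  have smM x (D : {set E}) : D = at_ K u :\ eu -> \sum_(f in D) va K (wt G) f x = g.
    move=> ->; rewrite -Gg -sum1_card big_mkcond [RHS]big_mkcond /=; apply: eq_bigr => f _.
    case fM: (f \in at_ K u :\ eu); first by rewrite vaM //; case: (f \in G).
    by case fG: (f \in G) => //; rewrite (subsetP GM f fG) in fM.
  have smu : sm K (wt G) u = xu + g.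
    rewrite /sm (big_setD1 eu) //= smM //; congr (_ + _).
    rewrite (va_other wfK _ euK ja') (va_pv (b := al)) //.
    by rewrite /wt eqxx.
  have smv : sm K (wt G) v = xv + g.
    rewrite /sm (big_setD1 ev) //= smM ?atuv //; congr (_ + _).
    rewrite (va_other wfK _ evK jb') (va_pv (b := be)) //.
    by rewrite /wt eq_sym (negbTE neuv) eqxx.
  have [eE|n1] := eqVneq e eu.
    subst e; rewrite (okE _ ja') smu wtsm //.
    by move: oku; rewrite /end_ok (va_other wfK _ euK ja') (va_pv (b := al)) // /wt eqxx.
  have [eE|n2] := eqVneq e ev.
    subst e; rewrite (okE _ jb') smv wtsm //.
    by move: okv; rewrite /end_ok (va_other wfK _ evK jb') (va_pv (b := be)) // /wt eq_sym (negbTE neuv) eqxx.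
  case iuv: (inc K u e || inc K v e).
    have j := other eK n1 n2 iuv; have /andP[pe _] := Mu (joins_at eK j) n1.
    by rewrite (okE _ j) pe smu smv xuv eqn_add2r; case: (xu).
  move/negbT: iuv; rewrite negb_or => /andP[iu iv].
  have eK' : e \in es K' by rewrite inE' eK iu iv orbT.
  have := H e eK'; rewrite /ok /= (negbTE n1).
  have sK' : src K e \in vs K' by have := wf_src contract_wf eK'; rewrite /= (negbTE n1).
  have dK' : dst K e \in vs K' by have := wf_dst contract_wf eK'; rewrite /= (negbTE n1).
  rewrite !wtsm //.
  have vaE x : va K (wt G) e x = va K' w' e x.
    rewrite /va /= (negbTE n1); congr (_ (+) _); rewrite /wt (negbTE n1) (negbTE n2).
    by rewrite inE (negbTE iu) andbF.
  by rewrite !vaE.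
have pu : plain K eu -> xu = al by move=> pe; rewrite /xu (even_plain wfK pe) addbF.
have pv : plain K ev -> xv = be by move=> pe; rewrite /xv (even_plain wfK pe) addbF.
have [k1 e1] := end_ok_excl (plain K eu) (thick K eu) (sm K' w' a) al xu.
have [k2 e2] := end_ok_excl (plain K ev) (thick K ev) (sm K' w' b) be xv.
have M1 : 0 < #|at_ K u :\ eu|.
  by rewrite card_gt0; have [e ez ne] := bundle; apply/set0Pn; exists e; rewrite in_setD1 ne.
have le1 (g : bool) : g <= #|at_ K u :\ eu| by apply: leq_trans M1; case: g.
case: (ltnP 2 #|at_ K u|) => D3.
  have M2 : 1 < #|at_ K u :\ eu| by move: D3; rewrite (cardsD1 eu) euu.
  have [g g2 [n1 n2]] : exists2 g, g <= 2 & g != k1 /\ g != k2.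
    case: (boolP ((0 != k1) && (0 != k2))) => [/andP[]|c0]; first by exists 0.
    case: (boolP ((1 != k1) && (1 != k2))) => [/andP[]|c1]; first by exists 1.
    exists 2 => //; move: c0 c1; rewrite !negb_and !negbK => /orP[] /eqP <- /orP[] /eqP <- //.
  by apply: (alle g); [apply: leq_trans M2 | apply: e1 | apply: e2].
have pick1 k : exists g : bool, (g : nat) != k.
  by case: k => [|k]; [exists true | exists false].
have bl2 (g : bool) : g <= 2 by case: g.
have flipu : (forall g : bool, end_ok (plain K eu) (thick K eu) (sm K' w' a) al xu g) -> kprop K.
  by move=> Hu; have [g gk] := pick1 k2; apply: (alle g) => //; apply: e2.
have flipv : (forall g : bool, end_ok (plain K ev) (thick K ev) (sm K' w' b) be xv g) -> kprop K.
  by move=> Hv; have [g gk] := pick1 k1; apply: (alle g) => //; apply: e1.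
have thp e : thick K e -> plain K e = false.
  by move=> te; apply/negP => /(wf_plain wfK); rewrite te.
case tu: (thick K eu).
  by apply: flipu => g; rewrite /end_ok (thp _ tu) tu.
case tv: (thick K ev).
  by apply: flipv => g; rewrite /end_ok (thp _ tv) tv.
have euK' : eu \in es K' by rewrite inE' eqxx.
have := H eu euK'; rewrite /ok /= eqxx tu tv ltnNge D3 /= -/al -/be.
case/or3P => [par|lt|lt].
(* This [g] gives [u] a parity different from [a]; it works for [v] and [b] too, since [xv] is the
   negation of [xu] and the sums of [a] and [b] differ in parity. *)
- pose g := ~~ (odd (sm K' w' a) (+) xu).
  apply: (alle g) => //; apply/negPn/negP => /(end_ok_bad _)[] //.
    by move=> _ _; rewrite /g; case: (odd _); case: (xu).
  move=> _ _; rewrite xuv /g; move: par; by case: (odd _); case: (odd _); case: (xu).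
- apply: flipu => g; apply/negPn/negP => /(end_ok_bad pu)[_].
  by rewrite leqNgt lt.
- apply: flipv => g; apply/negPn/negP => /(end_ok_bad pv)[_].
  by rewrite leqNgt lt.
Qed.

Let joins'E e x y : e != eu -> joins K' e x y = joins K e x y.
Proof. by rewrite /joins /= => /negbTE ->. Qed.

Let es'K e : e \in es K' -> e != eu -> e \in es K.
Proof. by rewrite inE' => /orP[->//|/and3P[]]. Qed.

Let joins'_vs e x y : e \in es K' -> joins K' e x y -> (x \in vs K') /\ (y \in vs K').
Proof. exact: (joins_vs contract_wf). Qed.

Let thin'E e : e != eu -> thin K' e = thin K e.
Proof. by move=> ne; rewrite /thin /= ne (negbTE ne). Qed.

Let thin'eu : thin K' eu -> [/\ #|at_ K u| <= 2, ~~ thick K eu & ~~ thick K ev].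
Proof. by rewrite /thin /= !eqxx /= !negb_or -leqNgt => /and3P[-> -> ->]. Qed.

Let atv_card : #|at_ K v| = #|at_ K u|.
Proof. by rewrite (cardsD1 eu (at_ K u)) (cardsD1 ev (at_ K v)) euu evv atuv. Qed.

(** A new thin edge arises only from a pod with a single middle edge and no thick outer edge. The
    two extra hypotheses restrict the choice of such a pod: the new edge gets an end of degree above
    2 if there is such a vertex at all, and in a cycle plain outer edges are joined only while
    everything is plain. *)
Lemma contract_inv : thin_inv K ->
  (forall r, r \in vs K -> 2 < #|at_ K r| -> #|at_ K u| <= 2 -> ~~ thick K eu -> ~~ thick K ev ->
     2 < #|at_ K a| \/ 2 < #|at_ K b|) ->
  ((forall x, x \in vs K -> #|at_ K x| <= 2) -> plain K eu -> plain K ev ->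
     forall e, e \in es K -> plain K e) ->
  thin_inv K'.
Proof.
move=> [ih il] W1 W2; split.
  move=> r rK'; rewrite (contract_deg rK') => dr e x y eK' te j.
  have rK : r \in vs K by move: rK'; rewrite vs'E => /and3P[].
  have [xK' yK'] := joins'_vs eK' j; rewrite !contract_deg //.
  have [eE|ne] := eqVneq e eu; last first.
    rewrite joins'E // in j; rewrite thin'E // in te.
    exact: (ih r rK dr e x y (es'K eK' ne) te j).
  subst e; have [u2 t1 t2] := thin'eu te.
  have := W1 r rK dr u2 t1 t2.
  by move: j; rewrite /joins /= eqxx => /orP[] /andP[/eqP -> /eqP ->] //; case; auto.
move=> dd'.
have dd x : x \in vs K' -> #|at_ K x| <= 2 by move=> xK'; rewrite -contract_deg // dd'.
have nothin_low e : e \in es K' -> e != eu -> thin K e -> 2 < #|at_ K u| -> False.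
  move=> eK' ne te u3; have js := joins_src_dst K e.
  have [sK' dK'] : (src K e \in vs K') /\ (dst K e \in vs K').
    by apply: (joins'_vs (e := e)) => //; rewrite joins'E.
  by case: (ih u uK u3 e _ _ (es'K eK' ne) te js); rewrite ltnNge dd.
case: (ltnP 2 #|at_ K u|) => u3.
  have nothin e : e \in es K' -> ~~ thin K' e.
    move=> eK'; have [->|ne] := eqVneq e eu; first by rewrite /thin /= !eqxx u3 !orbT.
    by rewrite thin'E //; apply/negP => te; apply: nothin_low eK' ne te u3.
  by split=> e f eK' fK' te; rewrite (negbTE (nothin e eK')) in te.
have ddK x : x \in vs K -> #|at_ K x| <= 2.
  move=> xK; have [->//|xu] := eqVneq x u; have [->|xv] := eqVneq x v; first by rewrite atv_card.
  by apply: dd; rewrite vs'E xu xv.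
have [i1 i2] := il ddK.
case tuv: (thick K eu || thick K ev).
  have [f fK tf] : exists2 f, f \in es K & thick K f by case/orP: tuv; [exists eu | exists ev].
  have nothin e : e \in es K' -> ~~ thin K' e.
    move=> eK'; have [->|ne] := eqVneq e eu.
      by rewrite /thin /= !eqxx /= orbA tuv.
    rewrite thin'E //; apply/negP => te.
    by have := i2 e f (es'K eK' ne) fK te; rewrite tf.
  by split=> e g eK' gK' te; rewrite (negbTE (nothin e eK')) in te.
move/negbT: tuv; rewrite negb_or => /andP[tu tv].
have only e : e \in es K' -> e != eu -> plain K e.
  move=> eK' ne; have eK := es'K eK' ne.
  have nev : e != ev.
    by move: eK'; rewrite inE' (negbTE ne) /= => /and3P[_ _]; apply: contraNneq => ->; apply: iat.
  case pu: (plain K eu); case pv: (plain K ev); first exact: (W2 ddK pu pv e eK).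
  - apply: contraT => npe; have thv : thin K ev by rewrite /thin pv tv.
    have te : thin K e by rewrite /thin npe (i2 ev e evK eK thv).
    by move: nev; rewrite (i1 e ev eK evK te thv) eqxx.
  - apply: contraT => npe; have thu : thin K eu by rewrite /thin pu tu.
    have te : thin K e by rewrite /thin npe (i2 eu e euK eK thu).
    by move: ne; rewrite (i1 e eu eK euK te thu) eqxx.
  apply: contraT => npe; have thu : thin K eu by rewrite /thin pu tu.
  have te : thin K e by rewrite /thin npe (i2 eu e euK eK thu).
  by move: ne; rewrite (i1 e eu eK euK te thu) eqxx.
split=> e f eK' fK' te.
  move=> tf; have [->|ne] := eqVneq e eu.
    have [->//|nf] := eqVneq f eu; by move: tf; rewrite thin'E // /thin (only f).
  by move: te; rewrite thin'E // /thin (only e).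
have [->|nf] := eqVneq f eu; first by rewrite /= eqxx !negb_or tu tv -leqNgt.
by rewrite /= (negbTE nf); have /(wf_plain wfK)/andP[] := only f fK' nf.
Qed.

Lemma contract_card : #|vs K| = #|vs K'|.+2.
Proof.
rewrite -(cardsID [set u; v] (vs K)) (setIidPr _) ?cards2 ?uv //.
by apply/subsetP => x; rewrite in_set2 => /orP[] /eqP ->.
Qed.

Lemma contract_card_gt1 : 1 < #|vs K'|.
Proof.
have <- : #|[set a; b]| = 2 by rewrite cards2 ab.
by apply: subset_leq_card; apply/subsetP => x; rewrite in_set2 => /orP[] /eqP ->; [exact: a_in | exact: b_in].
Qed.

Definition nonplain (K : lgraph V E) := [set e in es K | ~~ plain K e].

Lemma contract_nonplain : #|nonplain K'| <= #|nonplain K|.+1.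
Proof.
apply: (@leq_trans #|eu |: nonplain K|); last by rewrite cardsU1; case: (_ \notin _).
apply: subset_leq_card; apply/subsetP => e; rewrite inE in_setU1 => /andP[eK' npe].
have [//|ne] := eqVneq e eu; rewrite inE (es'K eK' ne) /=.
by move: npe; rewrite /= ne.
Qed.

End Contract.
End Reduce.

(** * Reduction to a pair of vertices *)

Section Main.
Variables (V E : finType) (side : V -> bool).
Implicit Types (K : lgraph V E) (w : E -> bool) (x y u v a b : V) (e : E).

Definition podb K u v eu ev :=
  [&& (eu \in at_ K u) && ~~ inc K v eu, (ev \in at_ K v) && ~~ inc K u ev,
      [forall e in at_ K u, (e != eu) ==> (plain K e && joins K e u v)]
    & [forall e in at_ K v, (e != ev) ==> (plain K e && joins K e v u)]].

Lemma podP K u v eu ev : reflect (pod K u v eu ev) (podb K u v eu ev).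
Proof.
apply: (iffP and4P) => -[h1 h2 h3 h4]; split=> //.
- by move=> e ez ne; move/forall_inP/(_ e ez): h3; rewrite ne.
- by move=> e ez ne; move/forall_inP/(_ e ez): h4; rewrite ne.
- by apply/forall_inP => e ez; apply/implyP; apply: h3.
by apply/forall_inP => e ez; apply/implyP; apply: h4.
Qed.

Lemma pod_sym K u v eu ev : pod K u v eu ev -> pod K v u ev eu.
Proof. by case. Qed.

Section Fixed.
Variable K : lgraph V E.
Hypothesis wfK : wf side K.

Lemma at_gt1 x : 1 < #|vs K| -> x \in vs K -> 1 < #|at_ K x|.
Proof.
by move=> v2 xK; apply: (card_at_ge2 wfK) => //; apply: contraTneq v2 => ->; rewrite cards1.
Qed.

(** A thin edge meets a second edge, which can be neither plain, nor thick, nor another thin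
    edge. *)
Lemma thin_low_contra x : 1 < #|vs K| -> x \in vs K ->
  (forall e, e \in es K -> ~~ plain K e) ->
  (forall e f, e \in es K -> f \in es K -> thin K e -> thin K f -> e = f) ->
  (forall e f, e \in es K -> f \in es K -> thin K e -> ~~ thick K f) ->
  forall e, e \in es K -> thick K e.
Proof.
move=> v2 xK np i1 i2 e eK; apply: contraT => nt.
have te : thin K e by rewrite /thin np.
have [f fx fe] := other_in e (at_gt1 v2 xK); have fK := at_es fx.
have tf : thin K f by rewrite /thin np // (i2 e f eK fK te).
by move: fe; rewrite (i1 f e fK eK tf te) eqxx.
Qed.

(** With a plain edge [f] all non-plain edges are odd: on at [h] means off at [t], so with [f] on
    the sums are [#|O|.+1] and 1. Without plain edges, turning everything on at [h] suffices from
    degree 3 on; below that all edges are thick. *)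
Lemma two_vertices_kprop : thin_inv K -> #|vs K| = 2 ->
  (forall e f x y, e \in es K -> f \in es K -> joins K e x y -> joins K f x y ->
     plain K f -> ~~ plain K e -> od K e) ->
  kprop K \/ forall e, e \in es K -> plain K e.
Proof.
move=> iK /eqP v2 norel; have /cards2P[h [t [ht vE]]] := v2.
have v2' : 1 < #|vs K| by rewrite (eqP v2).
have hK : h \in vs K by rewrite vE !inE eqxx.
have tK : t \in vs K by rewrite vE !inE eqxx orbT.
have jht e : e \in es K -> joins K e h t.
  move=> eK; have js := joins_src_dst K e; have [] := joins_vs wfK eK js.
  have := joins_neq wfK eK js; rewrite vE !in_set2 => ne /orP[] /eqP sE /orP[] /eqP dE;
    by rewrite sE dE ?eqxx in ne js * => //; rewrite joinsC.
have ath : at_ K h = es K.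
  by apply/setP => e; apply/idP/idP => [/at_es //|eK]; apply: joins_at eK (jht e eK).
have att : at_ K t = es K.
  by apply/setP => e; apply/idP/idP => [/at_es //|eK]; apply: joins_atr eK (jht e eK).
case: (pickP [pred e in es K | ~~ plain K e]) => [e1 /andP[e1K np1]|allp]; last first.
  by right=> e eK; have := allp e; rewrite /= eK /= => /negbFE.
left; case: (pickP [pred f in es K | plain K f]) => [f /andP[fK pf]|nop].
  pose O := [set e in es K | ~~ plain K e].
  have odO e : e \in es K -> ~~ plain K e -> od K e.
    by move=> eK; apply: (norel e f h t) => //; apply: jht.
  pose w e := if plain K e then e == f else pv K e h true.
  have fO : f \notin O by rewrite inE pf andbF.
  have smh : sm K w h = #|O|.+1.
    have -> : #|O|.+1 = #|f |: O| by rewrite cardsU1 fO.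
    apply: sm_card; first by rewrite ath subUset sub1set fK; apply/subsetP => e; rewrite inE => /andP[].
    rewrite ath => e eK; rewrite in_setU1 inE eK /=; case pe: (plain K e).
      by rewrite /va (even_plain wfK pe) addbF /w pe orbF.
    by rewrite orbT; apply: va_pv; rewrite /w pe.
  have smt : sm K w t = 1.
    rewrite -(cards1 f); apply: sm_card; first by rewrite att sub1set.
    rewrite att => e eK; rewrite inE; case pe: (plain K e).
      by rewrite /va (even_plain wfK pe) addbF /w pe.
    rewrite (va_other wfK w eK (jht e eK)) (va_pv (b := true)); last by rewrite /w pe.
    rewrite odO ?pe //=; apply/esym/negbTE; apply: contraFneq pe => ->.
    exact: pf.
  have O1 : 0 < #|O| by rewrite card_gt0; apply/set0Pn; exists e1; rewrite inE e1K.
  exists w => e eK; rewrite (okE w (jht e eK)) smh smt; case: ifP => pe.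
    by rewrite eqSS -lt0n.
  apply/or4P; move: O1; case: #|O| => [|[|n]] // _; first by apply: Or42.
  by apply: Or43; case: (va _ _ _ _).
have np e : e \in es K -> ~~ plain K e by move=> eK; have := nop e; rewrite /= eK /= => ->.
case: (ltnP 2 #|at_ K h|) => D3.
  pose w e := pv K e h true; exists w => e eK.
  have smh : sm K w h = #|at_ K h|.
    by apply: sm_card => // e' e'h; rewrite e'h; apply: va_pv.
  by apply: (ok_rest (jht e eK)); rewrite ?np // smh; apply: leq_trans D3; case: (va _ _ _ _).
have dd x : x \in vs K -> #|at_ K x| <= 2.
  by rewrite vE in_set2 => /orP[] /eqP -> //; rewrite att -ath.
have [i1 i2] := inv_low iK dd.
exists (fun=> false) => e eK; apply: (ok_thick wfK).
exact: (thin_low_contra v2' hK np i1 i2).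
Qed.

Section Many.
Hypothesis v3 : 2 < #|vs K|.
Let v2 : 1 < #|vs K| := ltnW v3.

Lemma deg2_pod e x y : (forall z, z \in vs K -> #|at_ K z| <= 2) ->
  e \in es K -> plain K e -> joins K e x y -> exists ex ey, pod K x y ex ey.
Proof.
move=> dd eK pe j; have [xK yK] := joins_vs wfK eK j.
have at2 z : z \in vs K -> e \in at_ K z -> exists2 f, f != e & at_ K z = [set e; f].
  move=> zK ez; have [f fz fe] := other_in e (at_gt1 v2 zK); exists f => //.
  apply/esym/eqP; rewrite eqEcard cards2 eq_sym fe dd // andbT.
  by apply/subsetP => g; rewrite in_set2 => /orP[] /eqP ->.
have exx : e \in at_ K x := joins_at eK j.
have eyy : e \in at_ K y := joins_atr eK j.
have [ex nex atx] := at2 x xK exx; have [ey ney aty] := at2 y yK eyy.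
have exz : ex \in at_ K x by rewrite atx !inE eqxx orbT.
have eyz : ey \in at_ K y by rewrite aty !inE eqxx orbT.
have iat g z : g \in at_ K z -> inc K z g by rewrite inE => /andP[].
have nxy : x != y := joins_neq wfK eK j.
(* otherwise e and the second edge close up a component of size two *)
have sep : ~~ inc K y ex.
  apply/negP => iy; have exy : ex \in at_ K y by rewrite inE (at_es exz).
  have eE : ex = ey by move: exy; rewrite aty in_set2 (negbTE nex) => /eqP.
  have [||| g] := cut_nonempty wfK (S := [set x; y]).
  - by apply/subsetP => z; rewrite in_set2 => /orP[] /eqP ->.
  - by apply/set0Pn; exists x; rewrite !inE eqxx.
  - by apply: contraTneq v3 => <-; rewrite cards2 nxy.
  case/(cutP wfK) => z [z' [gK jg zS]]; rewrite in_setD => /andP[z'S _]; case/negP: z'S.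
  have gz := joins_at gK jg.
  have gz' : (g == e) || (g == ex).
    by move: zS gz; rewrite in_set2 => /orP[] /eqP ->; rewrite ?atx ?aty -?eE in_set2.
  have jex : joins K ex x y.
    have [q jq] := at_joins exz; have := joins_or jq iy; rewrite eq_sym (negbTE nxy) /= => /eqP ->.
    by [].
  have jgxy : joins K g x y by case/orP: gz' => /eqP ->.
  have := joins_or jgxy (joins_inc (etrans (joinsC K g z' z) jg)).
  by rewrite in_set2.
have sep' : ~~ inc K x ey.
  apply/negP => ix; have eyx : ey \in at_ K x by rewrite inE (at_es eyz).
  have eE : ey = ex by move: eyx; rewrite atx in_set2 (negbTE ney) => /eqP.
  by move: sep; rewrite -eE iat.
exists ex, ey; split; rewrite ?exz ?eyz ?sep ?sep' //.
  by move=> g; rewrite atx in_set2 => /orP[/eqP -> _|->] //; rewrite pe j.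
by move=> g; rewrite aty in_set2 => /orP[/eqP -> _|->] //; rewrite pe joinsC j.
Qed.

Definition good_pod u v eu ev a b :=
  [/\ pod K u v eu ev, joins K eu u a, joins K ev v b,
   (forall r, r \in vs K -> 2 < #|at_ K r| -> #|at_ K u| <= 2 -> ~~ thick K eu -> ~~ thick K ev ->
     2 < #|at_ K a| \/ 2 < #|at_ K b|)
   & ((forall x, x \in vs K -> #|at_ K x| <= 2) -> plain K eu -> plain K ev ->
     forall e, e \in es K -> plain K e)].

(* A pod with two simple ends is chosen as close as possible to a vertex of degree at least 3. *)
Lemma good_pod_exists u v eu ev : thin_inv K -> pod K u v eu ev ->
  exists u v eu ev a b, good_pod u v eu ev a b.
Proof.
move=> iK pd0.
have ends u' v' eu' ev' : pod K u' v' eu' ev' ->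
    exists a b, joins K eu' u' a /\ joins K ev' v' b.
  case=> /andP[/at_joins[a ja] _] /andP[/at_joins[b jb] _] _ _; by exists a, b.
have uK' u' v' eu' ev' : pod K u' v' eu' ev' -> u' \in vs K.
  by case=> /andP[e1 _] _ _ _; have [a ja] := at_joins e1; have [] := joins_vs wfK (at_es e1) ja.
case: (pickP [pred p : V * V * (E * E) | podb K p.1.1 p.1.2 p.2.1 p.2.2 && (2 < #|at_ K p.1.1|)]) => [[[u1 v1] [e1 e2]]|nobig].
  case/andP => /podP /= pd D3; have [a [b [ja jb]]] := ends _ _ _ _ pd.
  exists u1, v1, e1, e2, a, b; split=> //.
    by move=> r _ _; rewrite leqNgt D3.
  by move=> dd; have := dd u1 (uK' _ _ _ _ pd); rewrite leqNgt D3.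
have small u' v' eu' ev' : pod K u' v' eu' ev' -> #|at_ K u'| <= 2.
  move=> pd; rewrite leqNgt; apply/negP => D3.
  by have := nobig ((u', v'), (eu', ev')); rewrite /= D3 andbT; case: podP.
case: (pickP [pred r in vs K | 2 < #|at_ K r|]) => [r0 /andP[r0K D3]|nohigh]; last first.
  have dd x : x \in vs K -> #|at_ K x| <= 2.
    by move=> xK; rewrite leqNgt; have := nohigh x; rewrite /= xK /= => ->.
  case: (pickP [pred p : V * V * (E * E) | podb K p.1.1 p.1.2 p.2.1 p.2.2 && (~~ plain K p.2.1 || ~~ plain K p.2.2)]) => [[[u1 v1] [e1 e2]]|nonp].
    case/andP => /podP /= pd np; have [a [b [ja jb]]] := ends _ _ _ _ pd.
    exists u1, v1, e1, e2, a, b; split=> //.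
      by move=> r rK; rewrite ltnNge dd.
    by move=> _ p1 p2; rewrite p1 p2 in np.
  have [a [b [ja jb]]] := ends _ _ _ _ pd0.
  exists u, v, eu, ev, a, b; split=> //; first by move=> r rK; rewrite ltnNge dd.
  move=> _ pu pv.
  (* No pod has a non-plain outer edge here, and every plain edge is the middle of a pod; so
     plainness propagates to the next edge of the cycle. *)
  have prop e x y f : e \in es K -> plain K e -> joins K e x y -> f \in at_ K x -> plain K f.
    move=> eK pe j fx; have [ex [ey pd]] := deg2_pod dd eK pe j.
    have [fE|nf] := eqVneq f ex; last by case: pd => _ _ /(_ f fx nf) /andP[].
    by have := nonp ((x, y), (ex, ey)); rewrite /=; case: podP => //= _ /norP[]; rewrite negbK -fE.
  pose S := [set x in vs K | [exists e in at_ K x, plain K e]].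
  have Sall x f : x \in S -> f \in at_ K x -> plain K f.
    rewrite inE => /andP[xK /existsP[e /andP[ex pe]]] fx; have [y j] := at_joins ex.
    exact: (prop e x y f (at_es ex) pe j fx).
  have SE : S = vs K.
    apply/eqP; apply: contraT => SnK; exfalso.
    have [|||e] := cut_nonempty wfK (S := S) => //.
    - by apply/subsetP => x; rewrite inE => /andP[].
    - apply/set0Pn; exists u; rewrite inE (uK' _ _ _ _ pd0); apply/existsP; exists eu.
      by rewrite pu andbT; case: pd0 => /andP[].
    case/(cutP wfK) => x [y [eK j xS]]; rewrite in_setD => /andP[yS yK]; case/negP: yS.
    rewrite inE yK; apply/existsP; exists e; rewrite (joins_atr eK j).
    exact: (Sall x e xS (joins_at eK j)).
  move=> e eK; have js := joins_src_dst K e; apply: (Sall (src K e)); last exact: joins_at js.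
  by rewrite SE (wf_src wfK).
have [l [l0 ll ladj _]] := lvl_exist wfK r0K.
have pb0 : podb K (u, v, (eu, ev)).1.1 (u, v, (eu, ev)).1.2 (u, v, (eu, ev)).2.1 (u, v, (eu, ev)).2.2.
  by apply/podP.
have [[[u1 v1] [e1 e2]] /= /podP pd pmin] := @arg_minnP _ (u, v, (eu, ev))
  (fun p => podb K p.1.1 p.1.2 p.2.1 p.2.2) (fun p => l p.1.1) pb0.
have [a [b [ja jb]]] := ends _ _ _ _ pd.
exists u1, v1, e1, e2, a, b; split=> //; last by move=> dd; have := dd r0 r0K; rewrite leqNgt D3.
move=> _ _ _ _ tu tv; left.
have u1K := uK' _ _ _ _ pd; have v1K := uK' _ _ _ _ (pod_sym pd).
have u12 := small _ _ _ _ pd.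
have [e1u nve1] : e1 \in at_ K u1 /\ ~~ inc K v1 e1 by case: pd => /andP[].
have [g gu ge] := other_in e1 (at_gt1 v2 u1K).
have atu : at_ K u1 = [set e1; g].
  apply/esym/eqP; rewrite eqEcard cards2 eq_sym ge u12 andbT.
  by apply/subsetP => f; rewrite in_set2 => /orP[] /eqP ->.
have /andP[pg jg] : plain K g && joins K g u1 v1 by case: pd => _ _ h _; apply: h.
have lv : l u1 <= l v1.
  by apply: (pmin (v1, u1, (e2, e1))); apply/podP; apply: pod_sym.
have u1r : u1 != r0 by apply: contraTneq D3 => <-; rewrite -leqNgt.
have [f [a' [fK jf lf]]] := ll u1 u1K u1r.
have fE : f = e1.
  have := joins_at fK jf; rewrite atu in_set2 => /orP[/eqP //|/eqP fg]; subst f.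
  by move: lv; rewrite (joins_inj wfK fK jg jf) lf ltnn.
subst f; have aa := joins_inj wfK fK ja jf; subst a'.
have [_ aK] := joins_vs wfK fK ja.
rewrite ltnNge; apply/negP => a2.
case pe: (plain K e1); last first.
  have te : thin K e1 by rewrite /thin pe tu.
  by case: (inv_high iK r0K D3 fK te ja); rewrite ltnNge ?u12 ?a2.
have e1a : e1 \in at_ K a := joins_atr fK ja.
have [h ha he] := other_in e1 (at_gt1 v2 aK).
have ata : at_ K a = [set e1; h].
  apply/esym/eqP; rewrite eqEcard cards2 eq_sym he a2 andbT.
  by apply/subsetP => f; rewrite in_set2 => /orP[] /eqP ->.
have iat f z : f \in at_ K z -> inc K z f by rewrite inE => /andP[].
have au : a != u1 by rewrite eq_sym; exact: (joins_neq wfK fK ja).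
have av : a != v1.
  by apply: contraNneq nve1 => <-; apply: iat.
have nag : ~~ inc K a g by apply/negP => /(joins_or jg); rewrite (negbTE au) (negbTE av).
(* If [a] had degree 2, the plain edge [e1] would make [a] and [u1] a pod one level closer to
   [r0]. *)
have pda : pod K a u1 h g.
  split.
  - rewrite ha; apply/negP => iu; have : h \in at_ K u1 by rewrite inE (at_es ha).
    rewrite atu in_set2 (negbTE he) /= => /eqP hg.
    by move: nag; rewrite -hg iat.
  - by rewrite gu.
  - by move=> f; rewrite ata in_set2 => /orP[/eqP -> _|->] //; rewrite pe joinsC ja.
  by move=> f; rewrite atu in_set2 => /orP[/eqP -> _|->] //; rewrite pe ja.
have := pmin (a, u1, (h, g)); rewrite /= lf ltnn => H.
by have : false; [apply: H; apply/podP | ].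
Qed.
End Many.
End Fixed.

(** The measure decreases: a relabelling removes a non-plain edge, and a contraction removes two
    vertices while creating at most one non-plain edge. *)
Theorem kprop_or_reducible K : wf side K -> thin_inv K -> 1 < #|vs K| ->
  kprop K \/ reducible_to_pair side K.
Proof.
have [n] := ubnP (2 * #|vs K| + #|nonplain K|); elim: n K => // n IH K le_n wfK iK v2.
case: (pickP [pred p : (E * E) * (V * V) | [&& p.1.1 \in es K, p.1.2 \in es K,
   joins K p.1.1 p.2.1 p.2.2, joins K p.1.2 p.2.1 p.2.2, plain K p.1.2, ~~ plain K p.1.1 & ~~ od K p.1.1]]).
  move=> [[e f] [x y]] /= /and5P[eK fK je jf /and3P[pf npe ode]].
  have [|||kp|red] := IH (relabel K e) _ _ _ v2.
  - rewrite ltnS in le_n; apply: leq_trans le_n; rewrite ltn_add2l; apply: proper_card.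
    apply/properP; split.
      by apply/subsetP => g; rewrite !inE /= negb_or => /and3P[-> ->].
    by exists e; rewrite !inE /= ?eK ?npe ?eqxx ?orbT ?andbF.
  - exact: relabel_wf.
  - exact: relabel_inv.
  - by left; apply: (relabel_kprop wfK eK fK je jf pf npe ode kp).
  by right; apply: (RRelabel wfK eK fK je jf).
move=> norel.
have irr_rel e f x y : e \in es K -> f \in es K -> joins K e x y -> joins K f x y ->
     plain K f -> ~~ plain K e -> od K e.
  move=> eK fK je jf pf npe; apply: contraT => ode.
  by have := norel ((e, f), (x, y)); rewrite /= eK fK je jf pf npe ode.
have [v2'|v3] : #|vs K| = 2 \/ 2 < #|vs K|.
  by move: v2; rewrite leq_eqVlt => /orP[/eqP|]; auto.
  case: (two_vertices_kprop wfK iK v2' irr_rel) => [|allp]; first by left.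
  by right; apply: RPair.
case: (pickP [pred p : V * V * (E * E) | podb K p.1.1 p.1.2 p.2.1 p.2.2]) => [[[u0 v0] [e0 e0']] /= /podP pd0|nopod].
  have [u [v [eu [ev [a [b [pd ja jb W1 W2]]]]]]] := good_pod_exists wfK v3 iK pd0.
  have cw := contract_wf wfK pd ja jb.
  have [|||kp|red] := IH (contract K u v eu ev a b) _ cw.
  - rewrite ltnS in le_n; apply: leq_trans le_n; rewrite (contract_card wfK pd ja jb).
    have := contract_nonplain K u v eu ev a b.
    rewrite !mulnS; move: (2 * _) #|nonplain _| #|nonplain _| => p q q'.
    by clear; lia.
  - exact: (contract_inv wfK pd ja jb iK W1 W2).
  - exact: (contract_card_gt1 wfK pd ja jb).
  - by left; apply: (contract_kprop wfK pd ja jb kp).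
  by right; apply: (RContract wfK pd ja jb).
left; apply: (irreducible_kprop wfK) => //.
have nopod' u v eu ev : ~ pod K u v eu ev.
  by move/podP => pb; have := nopod ((u, v), (eu, ev)); rewrite /= pb.
split=> //; move=> e x y eK j npe nte.
case: (pickP [pred r in vs K | 2 < #|at_ K r|]) => [r0 /andP[r0K D3]|nohigh].
  by apply: (inv_high iK r0K D3 eK _ j); rewrite /thin npe.
have dd z : z \in vs K -> #|at_ K z| <= 2.
  by move=> zK; rewrite leqNgt; have := nohigh z; rewrite /= zK /= => ->.
have np f : f \in es K -> ~~ plain K f.
  move=> fK; apply/negP => pf; have [ex [ey pd]] := deg2_pod wfK v3 dd fK pf (joins_src_dst K f).
  exact: nopod' pd.
have [i1 i2] := inv_low iK dd; have [xK _] := joins_vs wfK eK j.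
by move: nte; rewrite (thin_low_contra wfK v2 xK np i1 i2).
Qed.
End Main.

(** * Labelled cacti *)

Section Chains.
Variables (V E : finType) (side : V -> bool).
Implicit Types (K : lgraph V E) (x y z u v a b : V) (e el : E) (s : seq (E * V * V)).

(* The path y -e1- p1 = q1 -e2- p2 = q2 ... -el- x, where [s] lists the triples (ei, pi, qi). *)
Fixpoint chain K y s el x : bool :=
  if s is (e, p, q) :: s' then joins K e y p && chain K q s' el x else joins K el y x.

Fixpoint cverts s : seq V := if s is (e, p, q) :: s' then [:: p, q & cverts s'] else [::].
Fixpoint cedges s el : seq E := if s is (e, p, q) :: s' then e :: cedges s' el else [:: el].
Fixpoint cgreens s : seq {set V} :=
  if s is (e, p, q) :: s' then [set p; q] :: cgreens s' else [::].
(* The parity of the number of pairs on the path, visible or suppressed. *)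
Fixpoint cpar K s el : bool :=
  if s is (e, p, q) :: s' then ~~ (od K e (+) cpar K s' el) else od K el.

(** By [ear_par] the path carries an even number of pairs, visible or suppressed; with the base pair
    of [x] and [y] the closed cycle has an odd number, hence length 2 mod 4. By [ear_nil] a path
    without visible pairs is a suppressed one and not a plain parallel edge. *)
Record ear K (W : {set V}) (R : {set E}) x y s el : Prop := Ear {
  ear_chain : chain K y s el x;
  ear_verts : uniq (cverts s);
  ear_new : forall z, z \in cverts s -> z \notin W;
  ear_edges : uniq (cedges s el);
  ear_newe : forall e, e \in cedges s el -> (e \in es K) && (e \notin R);
  ear_par : cpar K s el = false;
  ear_nil : s = [::] -> ~~ plain K el
}.

Inductive lcactus K : {set V} -> {set E} -> {set {set V}} -> Prop :=
| LCpair x y : x != y -> lcactus K [set x; y] set0 [set [set x; y]]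
| LCear W R Gr x y s el : lcactus K W R Gr -> [set x; y] \in Gr -> ear K W R x y s el ->
    lcactus K (W :|: [set z in cverts s]) (R :|: [set e in cedges s el])
      (Gr :|: [set g in cgreens s]).

Definition kends K e := [set src K e; dst K e].

Lemma joins_kends K e x y : joins K e x y -> kends K e = [set x; y].
Proof. by case/joinsP => -[-> ->] //; rewrite /kends setUC. Qed.

Lemma set2_inj (x y z t : V) : [set x; y] = [set z; t] -> (x = z /\ y = t) \/ (x = t /\ y = z).
Proof.
move=> E1; have : x \in [set z; t] by rewrite -E1 !inE eqxx.
have : y \in [set z; t] by rewrite -E1 !inE eqxx orbT.
have : z \in [set x; y] by rewrite E1 !inE eqxx.
have : t \in [set x; y] by rewrite E1 !inE eqxx orbT.
rewrite !in_set2 => /orP[] /eqP h1 /orP[] /eqP h2 /orP[] /eqP h3 /orP[] /eqP h4; subst; auto.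
Qed.

Lemma lcactus_sub K W R Gr : lcactus K W R Gr ->
  [/\ R \subset es K, forall g, g \in Gr -> g \subset W
    & forall x y, [set x; y] \in Gr -> [/\ x != y, x \in W & y \in W]].
Proof.
suff : lcactus K W R Gr -> R \subset es K /\
   forall g, g \in Gr -> exists x y, [/\ g = [set x; y], x != y, x \in W & y \in W].
  move=> H /H[RK HG]; split=> //.
    move=> g /HG[x [y [-> _ xW yW]]]; by apply/subsetP => z; rewrite in_set2 => /orP[] /eqP ->.
  move=> x y /HG[x' [y' [E1 ne x'W y'W]]].
  by case: (set2_inj E1) => -[-> ->]; rewrite // eq_sym.
elim=> {W R Gr} [x y xy|W R Gr x y s el _ [RK HG] gxy er].
  rewrite sub0set; split=> // g; rewrite inE => /eqP ->; exists x, y.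
  by rewrite !inE !eqxx orbT.
split.
  by rewrite subUset RK; apply/subsetP => e; rewrite inE => /(ear_newe er)/andP[].
move=> g; rewrite in_setU => /orP[/HG[x' [y' [-> ne xW yW]]]|].
  by exists x', y'; rewrite !in_setU xW yW.
rewrite inE; have := ear_verts er; have : {subset cverts s <= cverts s} by [].
move: {1 3 4}(s) => s'; elim: s' => [|[[e p] q] s' IH] //= sub.
rewrite inE negb_or -!andbA => /and4P[pq ps qs us]; rewrite inE => /orP[/eqP ->|gs].
  by exists p, q; rewrite !in_setU !inE !sub ?inE ?eqxx ?orbT.
apply: IH => // z zs; apply: sub; by rewrite !inE zs !orbT.
Qed.

Lemma chain_edge K y s el x e : chain K y s el x -> e \in cedges s el ->
  exists z t, [/\ kends K e = [set z; t], (z == y) || (z \in cverts s) & (t == x) || (t \in cverts s)].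
Proof.
elim: s y => [|[[f p] q] s IH] y /=.
  by move=> j; rewrite inE => /eqP ->; exists y, x; rewrite !eqxx (joins_kends j).
case/andP => j ch; rewrite inE => /orP[/eqP ->|es].
  by exists y, p; rewrite eqxx !inE eqxx orbT (joins_kends j).
have [z [t [E1 zs ts]]] := IH q ch es; exists z, t; split=> //.
  by case/orP: zs => [/eqP ->|zs]; rewrite !inE ?eqxx ?zs ?orbT.
by case/orP: ts => [->//|ts]; rewrite !inE ts !orbT.
Qed.

Lemma chain_edge_new K y s el x e : s != [::] -> chain K y s el x -> e \in cedges s el ->
  exists2 z, z \in kends K e & z \in cverts s.
Proof.
elim: s y => [|[[f p] q] s IH] y //= _ /andP[j ch]; rewrite inE => /orP[/eqP ->|es].
  by exists p; rewrite ?(joins_kends j) !inE eqxx ?orbT.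
case: (eqVneq s [::]) => [s0|sn].
  subst s; move: es ch; rewrite /= inE => /eqP -> j'; exists q; last by rewrite !inE eqxx orbT.
  by rewrite (joins_kends j') !inE eqxx.
have [z zk zs] := IH q sn ch es; exists z => //; by rewrite !inE zs !orbT.
Qed.

Lemma chain_green_neq K y s el x e : s != [::] -> chain K y s el x -> uniq (cverts s) ->
  y \notin cverts s -> x \notin cverts s -> x != y ->
  e \in cedges s el -> kends K e \notin cgreens s.
Proof.
elim: s y => [|[[f p] q] s IH] y //= _ /andP[j ch].
rewrite !inE !negb_or -!andbA => /and4P[pq ps qs us] /and3P[yp yq ys] /and3P[xp xq xs] xy.
have gin g : g \in cgreens s -> g \subset [set z in cverts s].
  elim: (s) => [|[[f' p'] q'] s' IH'] //=; rewrite inE => /orP[/eqP ->|/IH' sub].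
    by apply/subsetP => z; rewrite in_set2 => /orP[] /eqP ->; rewrite !inE eqxx ?orbT.
  by apply: subset_trans sub _; apply/subsetP => z; rewrite !inE => ->; rewrite !orbT.
case/orP => [/eqP ->|es].
  rewrite (joins_kends j); apply/andP; split.
    apply/eqP => E1; have : y \in [set p; q] by rewrite -E1 !inE eqxx.
    by rewrite in_set2 (negbTE yp) (negbTE yq).
  apply/negP => /gin/subsetP/(_ y); rewrite !inE eqxx (negbTE ys) => /(_ isT) //.
have pn : p \notin kends K e.
  have [z [t [-> zs ts]]] := chain_edge ch es; rewrite in_set2 negb_or.
  apply/andP; split; apply/eqP => pE; subst.
    by move: zs; rewrite (negbTE ps) (negbTE pq).
  by move: ts; rewrite (negbTE ps) eq_sym (negbTE xp).
apply/andP; split; first by apply: contraNneq pn => ->; rewrite !inE eqxx.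
case: (eqVneq s [::]) => [-> //|sn]; apply: (IH q) => //.
Qed.

Lemma chain_uniq_ends K y s el x e f : s != [::] -> chain K y s el x -> uniq (cverts s) ->
  y \notin cverts s -> x \notin cverts s -> x != y -> uniq (cedges s el) ->
  e \in cedges s el -> f \in cedges s el -> kends K e = kends K f -> e = f.
Proof.
move=> sn; have head p q (s' : seq (E * V * V)) y' e' : s' != [::] \/ s' = [::] -> chain K q s' el x -> p != q -> p \notin cverts s' -> x != p ->
    e' \in cedges s' el -> kends K e' <> [set y'; p].
  move=> _ ch pq ps xp e's E1; have [z [t [E2 zs ts]]] := chain_edge ch e's.
  have : p \in [set z; t] by rewrite -E2 E1 !inE eqxx orbT.
  rewrite in_set2 => /orP[] /eqP pE; subst.
    by move: zs; rewrite (negbTE ps) (negbTE pq).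
  by move: ts; rewrite (negbTE ps) eq_sym (negbTE xp).
elim: s y sn => [|[[g p] q] s IH] y //= _ /andP[j ch].
rewrite !inE !negb_or -!andbA => /and4P[pq ps qs us] /and3P[yp yq ys] /and3P[xp xq xs] xy /andP[gs ues].
have hd e' : e' \in cedges s el -> kends K e' <> [set y; p].
  by apply: (head p q s y) => //; case: (eqVneq s [::]); auto.
case/orP => [/eqP ->|es1] /orP[/eqP ->|es2] // E1.
- by case: (hd f es2); rewrite -E1 (joins_kends j).
- by case: (hd e es1); rewrite E1 (joins_kends j).
case: (eqVneq s [::]) => [s0|sn]; first by subst s; move: es1 es2; rewrite !inE => /eqP -> /eqP ->.
by apply: (IH q).
Qed.

(** The ear of a plain red edge has a visible pair by [ear_nil], so the edge has an end that was new
    at that stage. This separates it from earlier edges, and within the ear vertices are distinct; a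
    later edge on old vertices only runs along a green pair. *)
Lemma red_unique K W R Gr : lcactus K W R Gr -> forall e, e \in R -> plain K e ->
  kends K e \notin Gr /\ forall f, f \in R -> kends K f = kends K e -> f = e.
Proof.
move=> lc; suff H : (forall e, e \in R -> kends K e \subset W) /\
    forall e, e \in R -> plain K e -> kends K e \notin Gr /\ forall f, f \in R -> kends K f = kends K e -> f = e.
  by case: H.
elim: lc => {W R Gr} [x y xy|W R Gr x y s el lc [HW HR] gxy er].
  by split=> e; rewrite inE.
have [_ GW Gxy] := lcactus_sub lc; have [xy xW yW] := Gxy x y gxy.
have xs : x \notin cverts s by apply/negP => /(ear_new er); rewrite xW.
have ys : y \notin cverts s by apply/negP => /(ear_new er); rewrite yW.
have ch := ear_chain er.
split=> e; rewrite in_setU inE => /orP[eR|es1].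
- exact: subset_trans (HW e eR) (subsetUl _ _).
- have [z [t [-> zs ts]]] := chain_edge ch es1; apply/subsetP => q.
  rewrite in_set2 => /orP[] /eqP ->; rewrite in_setU inE.
    by case/orP: zs => [/eqP ->|->]; rewrite ?yW ?orbT.
  by case/orP: ts => [/eqP ->|->]; rewrite ?xW ?orbT.
- move=> pe; have [n1 n2] := HR e eR pe; split.
    rewrite in_setU inE (negbTE n1) /=; apply/negP => gs.
    have [z zk zs] : exists2 z, z \in kends K e & z \in cverts s.
      move: (kends K e) gs => g; elim: (s) => [|[[f' p'] q'] s' IH'] //=.
      rewrite inE => /orP[/eqP ->|/IH'[z zg zs]]; first by exists p'; rewrite !inE eqxx.
      by exists z => //; rewrite !inE zs !orbT.
    by have := ear_new er zs; rewrite (subsetP (HW e eR) z zk).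
  move=> f; rewrite in_setU inE => /orP[fR|fs]; first exact: n2.
  move=> E1; case: (eqVneq s [::]) => [s0|sn].
    subst s; move: fs ch; rewrite /= inE => /eqP fE j; subst f.
    by move: n1; rewrite -E1; rewrite (joins_kends j) setUC gxy.
  have [z zk zs] := chain_edge_new sn ch fs.
  by have := ear_new er zs; rewrite (subsetP (HW e eR) z) // -E1.
move=> pe; have sn : s != [::].
  apply/eqP => s0; have := ear_nil er s0; subst s; move: es1; rewrite /= inE => /eqP <-.
  by rewrite pe.
have [z zk zs] := chain_edge_new sn ch es1.
have zW := ear_new er zs.
split.
  rewrite in_setU inE negb_or (chain_green_neq sn ch (ear_verts er)) // andbT.
  by apply/negP => /GW/subsetP/(_ z zk); rewrite (negbTE zW).
move=> f; rewrite in_setU inE => /orP[fR|fs] E1.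
  by have := subsetP (HW f fR) z; rewrite E1 zk (negbTE zW) => /(_ isT).
exact: (chain_uniq_ends sn ch (ear_verts er) ys xs xy (ear_edges er) fs es1 E1).
Qed.

(** [lcactus] describes only red edges and green pairs. The remaining edges are plain copies of
    green pairs, at least one for each pair. *)
Definition is_lcactus K := exists R Gr, [/\ lcactus K (vs K) R Gr,
  forall e, e \in es K -> e \in R \/ (plain K e && (kends K e \in Gr))
  & forall g, g \in Gr -> exists e, [/\ e \in es K, e \notin R, plain K e & kends K e = g]].

Lemma pair_lcactus K : wf side K -> #|vs K| = 2 -> (forall e, e \in es K -> plain K e) ->
  is_lcactus K.
Proof.
move=> wfK /eqP v2 allp; have /cards2P[x [y [xy vE]]] := v2.
have kE e : e \in es K -> kends K e = [set x; y].
  move=> eK; apply/eqP; rewrite eqEcard !cards2 xy (joins_neq wfK eK (joins_src_dst K e)) andbT -vE.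
  by apply/subsetP => z; rewrite in_set2 => /orP[] /eqP ->; [apply: (wf_src wfK) | apply: (wf_dst wfK)].
exists set0, [set [set x; y]]; split.
- by rewrite vE; apply: LCpair.
- by move=> e eK; right; rewrite allp // kE // set11.
move=> g; rewrite inE => /eqP ->.
have xK : x \in vs K by rewrite vE !inE eqxx.
have [e ex _] : exists2 e, e \in at_ K x & true.
  have : 0 < #|at_ K x| by apply: ltnW; apply: (at_gt1 wfK) => //; rewrite (eqP v2).
  by rewrite card_gt0 => /set0Pn[e ex]; exists e.
have eK := at_es ex.
by exists e; rewrite inE kE // allp.
Qed.

(** After the relabelling [e] and [f] are parallel and plain, so by [red_unique] neither is red and
    both lie on a green pair. Hence [e] can be put back as an ear consisting of one even edge, while
    [f] keeps the green pair occupied. *)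
Lemma relabel_lcactus K e f x y : wf side K -> e \in es K -> f \in es K -> joins K e x y ->
  joins K f x y -> plain K f -> ~~ plain K e -> ~~ od K e ->
  is_lcactus (relabel K e) -> is_lcactus K.
Proof.
move=> wfK eK fK je jf pf npe ode [R [Gr [lc He Hg]]].
have kef : kends K e = kends K f by rewrite (joins_kends je) (joins_kends jf).
have pe' : plain (relabel K e) e by rewrite /= eqxx orbT.
have pf' : plain (relabel K e) f by rewrite /= pf.
have fe : f != e by apply: contraNneq npe => <-.
have ru := red_unique lc.
have eR : e \notin R.
  apply/negP => eR; have [n1 n2] := ru e eR pe'.
  case: (He f fK) => [fR|/andP[_ fG]]; last by move: n1; rewrite -[kends _ e]/(kends K e) kef fG.
  by move: fe; rewrite (n2 f fR) ?eqxx.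
have eG : kends K e \in Gr by case: (He e eK) => [|/andP[]] //; rewrite (negbTE eR).
have fR : f \notin R.
  by apply/negP => fR; have [n1 _] := ru f fR pf'; move: n1; rewrite -[kends _ f]/(kends K f) -kef eG.
have lcK W1 R1 Gr1 : lcactus (relabel K e) W1 R1 Gr1 -> lcactus K W1 R1 Gr1.
  elim=> [x1 y1|W2 R2 Gr2 x1 y1 s el _ IH g1 er]; first exact: LCpair.
  apply: (LCear IH g1); case: er => c1 c2 c3 c4 c5 c6 c7; split=> //.
  - by elim: (s) (y1) c1 => [|[[e1 p1] q1] s1 IH1] y2 //= /andP[j1 /IH1 ->]; rewrite andbT.
  - by rewrite -c6; elim: (s) => [|[[e1 p1] q1] s1 IH1] //=; rewrite IH1.
  by move=> /c7; rewrite /= negb_or => /andP[].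
have er : ear K (vs K) R x y [::] e.
  split=> //=; first by rewrite joinsC.
    by move=> e1; rewrite inE => /eqP ->; rewrite eK.
  exact: negbTE.
have gxy : [set x; y] \in Gr by rewrite -(joins_kends je).
have := LCear (lcK _ _ _ lc) gxy er.
have e0 (T : finType) : [set z in ([::] : seq T)] = set0 by apply/setP => z; rewrite !inE.
rewrite /= !e0 !setU0.
move=> lc2; exists (R :|: [set e0 in cedges [::] e]), Gr; split=> //.
  move=> e1 e1K; have [->|ne] := eqVneq e1 e; first by left; rewrite !inE eqxx orbT.
  case: (He e1 e1K) => [e1R|]; first by left; rewrite in_setU e1R.
  by rewrite /= (negbTE ne) orbF; right.
move=> g /Hg[e1 [e1K e1R pe1 k1]].
have [E1|ne] := eqVneq e1 e.
  subst e1; exists f; split=> //; first by rewrite in_setU negb_or fR !inE fe.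
  by rewrite -kef.
exists e1; split=> //; first by rewrite in_setU negb_or e1R !inE ne.
by move: pe1; rewrite /= (negbTE ne) orbF.
Qed.

(** * Undoing a contraction *)

Section Uncontract.
Variables (K : lgraph V E) (u v : V) (eu ev : E) (a b : V).
Hypothesis wfK : wf side K.
Hypothesis pd : pod K u v eu ev.
Hypothesis ja : joins K eu u a.
Hypothesis jb : joins K ev v b.
Let K' := contract K u v eu ev a b.

Let euu : eu \in at_ K u. Proof. by case: pd => /andP[]. Qed.
Let evv : ev \in at_ K v. Proof. by case: pd => _ /andP[]. Qed.
Let nveu : ~~ inc K v eu. Proof. by case: pd => /andP[]. Qed.
Let nuev : ~~ inc K u ev. Proof. by case: pd => _ /andP[]. Qed.
Let iat e x : e \in at_ K x -> inc K x e. Proof. by rewrite inE => /andP[]. Qed.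

Let joins'E e x y : e != eu -> joins K' e x y = joins K e x y.
Proof. by rewrite /joins /= => /negbTE ->. Qed.

Let joins'eu x y : joins K' eu x y -> (x = a /\ y = b) \/ (x = b /\ y = a).
Proof. by rewrite /joins /= eqxx => /orP[] /andP[/eqP -> /eqP ->]; auto. Qed.

Let neuv : eu != ev. Proof. by apply: contraNneq nveu => ->; apply: iat. Qed.

Lemma chain_uncontract y s el x : eu \notin cedges s el -> chain K' y s el x ->
  chain K y s el x /\ cpar K' s el = cpar K s el.
Proof.
elim: s y => [|[[e p] q] s IH] y /=; rewrite inE.
  move=> ne; rewrite joins'E; last by rewrite eq_sym.
  by rewrite eq_sym (negbTE ne).
rewrite negb_or => /andP[ne nes] /andP[j /(IH q nes)[-> ->]].
rewrite joins'E in j; last by rewrite eq_sym.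
by rewrite j eq_sym (negbTE ne).
Qed.

(** The contracted edge becomes [eu], the pair of [u] and [v], and [ev], or the reverse, according
    to the direction of the chain. The label [~~ (od K eu (+) od K ev)] is what counts the new
    visible pair. *)
Lemma chain_expand y s el x : eu \in cedges s el -> uniq (cedges s el) -> chain K' y s el x ->
  exists s2 el2, [/\ chain K y s2 el2 x,
    perm_eq (cverts s2) ([:: u; v] ++ cverts s),
    perm_eq (cedges s2 el2) (ev :: cedges s el),
    cgreens s2 =i [set u; v] :: cgreens s
    & cpar K s2 el2 = cpar K' s el /\ s2 != [::]].
Proof.
have ja' : joins K eu a u by rewrite joinsC.
have jb' : joins K ev b v by rewrite joinsC.
elim: s y => [|[[e p] q] s IH] y /=; rewrite inE.
  move=> /eqP <- _ /joins'eu[] [-> ->].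
    exists [:: (eu, u, v)], ev; split=> //=; first by rewrite ja' jb.
      by rewrite -[[:: eu; ev]]/([:: eu] ++ [:: ev]) perm_catC.
    by rewrite eqxx.
  exists [:: (ev, v, u)], eu; split=> //=; first by rewrite jb' ja.
  - by rewrite -[[:: v; u]]/([:: v] ++ [:: u]) perm_catC.
  - by rewrite setUC.
  by rewrite eqxx addbC.
have [<-|ne] /= := eqVneq eu e.
  move=> _ /andP[nes _] /andP[/joins'eu[] [-> ->] ch].
    have [ch2 par] := chain_uncontract nes ch.
    exists [:: (eu, u, v), (ev, b, q) & s], el; split=> //=; first by rewrite ja' jb ch2.
      by rewrite -[[:: eu, ev & _]]/([:: eu] ++ [:: ev] ++ _) perm_catCA.
    split=> //; rewrite par ?eqxx; by case: (od K eu); case: (od K ev); case: (cpar _ _ _).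
  have [ch2 par] := chain_uncontract nes ch.
  exists [:: (ev, v, u), (eu, a, q) & s], el; split=> //=; first by rewrite jb' ja ch2.
  - by rewrite -[[:: v, u & _]]/([:: v] ++ [:: u] ++ _) perm_catCA.
  - by rewrite setUC.
  split=> //; rewrite par ?eqxx; by case: (od K eu); case: (od K ev); case: (cpar _ _ _).
move=> es1 /andP[nes ues] /andP[j ch].
have [s2 [el2 [ch2 pv pe gr [par _]]]] := IH q es1 ues ch.
exists ((e, p, q) :: s2), el2; split=> //=.
- by rewrite -(joins'E y p) ?j // eq_sym.
- rewrite perm_sym -[[:: u, v, p, q & _]]/([:: u; v] ++ [:: p; q] ++ cverts s) perm_catCA.
  by rewrite -[[:: p, q & cverts s2]]/([:: p; q] ++ cverts s2) perm_cat2l perm_sym.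
- rewrite perm_sym -[[:: ev, e & _]]/([:: ev] ++ [:: e] ++ cedges s el) perm_catCA.
  by rewrite /= perm_cons perm_sym.
- by move=> g; rewrite inE gr !inE orbCA.
by rewrite par /= 1?[e == eu]eq_sym ?(negbTE ne).
Qed.

(** Ears before the one through [eu] are unchanged, that ear is expanded, and later ears avoid [u],
    [v] and [ev]. *)
Lemma uncontract_lcactus_aux W R Gr : lcactus K' W R Gr -> u \notin W -> v \notin W -> ev \notin R ->
  (eu \notin R -> lcactus K W R Gr) /\
  (eu \in R -> lcactus K (W :|: [set u; v]) (R :|: [set ev]) (Gr :|: [set [set u; v]])).
Proof.
have es'K e : e \in es K' -> e \in es K.
  rewrite /= in_setU1 in_setD => /orP[/eqP ->|/andP[]] //; exact: at_es euu.
have evK := at_es evv.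
have uv : u != v by apply: contraNneq nveu => <-; apply: iat.
elim=> {W R Gr} [x y xy|W R Gr x y s el lc IH gxy er] uW vW evR.
  by split=> [_|]; [apply: LCpair | rewrite inE].
move: uW vW evR; rewrite !in_setU !inE !negb_or => /andP[uW us] /andP[vW vs1] /andP[evR evs].
have [IH1 IH2] := IH uW vW evR; case: er => c1 c2 c3 c4 c5 c6 c7.
have c5' e : e \in cedges s el -> (e \in es K) && (e \notin R).
  by move/c5 => /andP[/es'K -> ->].
have c7' : eu \notin cedges s el -> s = [::] -> ~~ plain K el.
  move=> nes s0; have := c7 s0; subst s; rewrite /= negb_and negbK; case/orP => // /eqP elE.
  by move: nes; rewrite /= inE elE eqxx.
split.
  case/andP => nR nes; have [ch par] := chain_uncontract nes c1.
  apply: (LCear (IH1 nR) gxy); split=> //; first by rewrite -par.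
  exact: c7'.
case/orP => [eR|es1].
  have nes : eu \notin cedges s el by apply/negP => /c5 /andP[_]; rewrite eR.
  have [ch par] := chain_uncontract nes c1.
  have gxy' : [set x; y] \in Gr :|: [set [set u; v]] by rewrite in_setU gxy.
  have := LCear (IH2 eR) gxy' (s := s) (el := el).
  rewrite (setUAC W [set u; v]) (setUAC R [set ev]) (setUAC Gr [set [set u; v]]).
  apply; split=> //; last exact: c7'.
  - move=> z zs; rewrite in_setU negb_or c3 //= in_set2 negb_or.
    by apply/andP; split; apply: contraTneq zs => ->.
  - move=> e es2; have /andP[-> eR'] := c5' e es2; rewrite in_setU inE negb_or eR' /=.
    by apply: contraTneq es2 => ->.
  by rewrite -par.
have nR : eu \notin R by have /andP[] := c5 eu es1.
have [s2 [el2 [ch2 pv pe gr [par sn2]]]] := chain_expand es1 c4 c1.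
have mv z : z \in cverts s2 -> [|| z == u, z == v | z \in cverts s].
  by rewrite (perm_mem pv) !inE.
have := LCear (IH1 nR) gxy (s := s2) (el := el2).
have -> : W :|: [set z in cverts s2] = W :|: [set z in cverts s] :|: [set u; v].
  by apply/setP => z; rewrite !inE (perm_mem pv) !inE; do !case: (_ == _); rewrite ?orbT ?orbF.
have -> : R :|: [set e in cedges s2 el2] = R :|: [set e in cedges s el] :|: [set ev].
  by apply/setP => z; rewrite !inE (perm_mem pe) !inE; do !case: (_ == _); rewrite ?orbT ?orbF.
have -> : Gr :|: [set g in cgreens s2] = Gr :|: [set g in cgreens s] :|: [set [set u; v]].
  by apply/setP => z; rewrite !inE gr !inE; do !case: (_ == _); rewrite ?orbT ?orbF.
apply; split=> //.
- by rewrite (perm_uniq pv) /= inE negb_or uv us vs1.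
- by move=> z /mv /or3P[/eqP ->|/eqP ->|/c3].
- by rewrite (perm_uniq pe) /= evs.
- by move=> e; rewrite (perm_mem pe) inE => /orP[/eqP ->|/c5' //]; rewrite evK.
- by rewrite par.
by move=> s0; rewrite s0 in sn2.
Qed.

Lemma uncontract_lcactus : is_lcactus K' -> is_lcactus K.
Proof.
move=> [R [Gr [lc He Hg]]].
have [RK' _ _] := lcactus_sub lc.
have evK' : ev \notin es K'.
  by rewrite /= in_setU1 eq_sym (negbTE neuv) in_setD in_setU evv orbT.
have evR : ev \notin R by apply: contraNN evK'; apply: (subsetP RK').
have euR : eu \in R.
  have euK' : eu \in es K' by rewrite /= setU11.
  by case: (He eu euK') => // /andP[]; rewrite /= eqxx.
have uW : u \notin vs K' by rewrite /= !inE eqxx.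
have vW : v \notin vs K' by rewrite /= !inE eqxx orbT.
have [_ /(_ euR) lc2] := uncontract_lcactus_aux lc uW vW evR.
have [_ uK] : a \in vs K /\ u \in vs K by have [] := joins_vs wfK (at_es euu) ja.
have vK : v \in vs K by have [] := joins_vs wfK (at_es evv) jb.
have vsE : vs K' :|: [set u; v] = vs K.
  apply/setP => z; rewrite /= !inE; case: (eqVneq z u) => [->|zu]; first by rewrite uK.
  by case: (eqVneq z v) => [->|zv]; rewrite ?vK //= orbF.
have keE e : e != eu -> kends K' e = kends K e by move=> ne; rewrite /kends /= (negbTE ne).
rewrite vsE in lc2; exists (R :|: [set ev]), (Gr :|: [set [set u; v]]); split=> //.
  move=> e eK; have [->|ne] := eqVneq e eu; first by left; rewrite in_setU euR.
  have [->|nev] := eqVneq e ev; first by left; rewrite !inE eqxx orbT.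
  case iuv: ((e \in at_ K u) || (e \in at_ K v)).
    right; have : plain K e && joins K e u v.
      case: pd => _ _ h1 h2; case/orP: iuv => iz; first exact: h1.
      by rewrite joinsC; apply: h2.
    by case/andP=> -> j; rewrite (joins_kends j) !inE eqxx orbT.
  have eK' : e \in es K' by rewrite /= in_setU1 in_setD in_setU iuv eK orbT.
  case: (He e eK') => [eR|/andP[pe kG]]; first by left; rewrite in_setU eR.
  by right; move: pe; rewrite /= ne /= => ->; rewrite in_setU -keE // kG.
move=> g; rewrite in_setU => /orP[/Hg[e [eK' eR pe kg]]|].
  have [ne pe'] : e != eu /\ plain K e by move: pe => /= /andP[].
  exists e; split=> //.
  - by move: eK'; rewrite /= in_setU1 (negbTE ne) in_setD => /andP[].
  - by rewrite in_setU negb_or eR inE; apply: contraTneq eK' => ->.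
  by rewrite -keE.
rewrite inE => /eqP ->.
have [m mu ne] : exists2 m, m \in at_ K u & m != eu.
  apply: other_in; apply: (card_at_ge2 wfK) => //.
  apply: contraTneq vK => ->; rewrite inE; apply: contraNneq nveu => ->; exact: iat.
have /andP[pm jm] : plain K m && joins K m u v by case: pd => _ _ h _; apply: h.
exists m; split=> //; last exact: joins_kends.
  exact: at_es mu.
rewrite in_setU negb_or inE; apply/andP; split.
  apply/negP => /(subsetP RK'); by rewrite /= in_setU1 (negbTE ne) in_setD in_setU mu.
by apply: contraNneq nuev => <-; apply: iat.
Qed.
End Uncontract.

Lemma reducible_lcactus K : reducible_to_pair side K -> is_lcactus K.
Proof.
elim=> {K} [K wfK v2 allp|K e f x y wfK eK fK je jf pf npe ode _ IH|K u v eu ev a b wfK pd ja jb _ IH].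
- exact: pair_lcactus.
- exact: (relabel_lcactus wfK eK fK je jf pf npe ode IH).
exact: (uncontract_lcactus wfK pd ja jb IH).
Qed.
End Chains.

(** * From labelled cacti to odd multi-cacti *)

Section ListCycle.
Variable V : finType.
Implicit Types (L c : seq V) (d x y : V) (g : {set V}).

Fixpoint pairs L d : seq {set V} :=
  if L is z :: L' then [set z; head d L'] :: pairs L' d else [::].

Fixpoint at_parity b (L : seq {set V}) g :=
  if L is h :: L' then (~~ b && (g == h)) || at_parity (~~ b) L' g else false.

Lemma at_parityP b (L : seq {set V}) g :
  reflect (exists i, [/\ i < size L, odd i = b & nth set0 L i = g]) (at_parity b L g).
Proof.
elim: L b => [|h L IH] b /=; first by apply: ReflectF => -[i []].
apply: (iffP orP) => [[/andP[nb /eqP ->]|/IH[i [iL ob E1]]]|[[|i] [iL ob E1]]].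
- by exists 0; split=> //; move: nb; case: b.
- by exists i.+1; split=> //=; rewrite ob negbK.
- by left; rewrite -ob -E1 /= eqxx.
by right; apply/IH; exists i; split=> //; rewrite -ob /= negbK.
Qed.

Lemma nth_pairs L d i : i < size L -> nth set0 (pairs L d) i = [set nth d L i; nth d L i.+1].
Proof. by elim: L i => [|z L IH] [|i] //= iL; rewrite IH. Qed.

Lemma size_pairs L d : size (pairs L d) = size L.
Proof. by elim: L => //= z L ->. Qed.

Lemma cycle_edges_pairs x c b g : uniq (x :: c) ->
  (g \in cycle_edges (x :: c) b) = at_parity b (pairs (x :: c) x) g.
Proof.
move=> uc; apply/imsetP/at_parityP => [[z]|[i [iL ob <-]]].
  rewrite inE => /andP[zc /eqP oz] ->; exists (index z (x :: c)).
  rewrite size_pairs index_mem; split=> //.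
  by rewrite nth_pairs ?index_mem // nth_index // next_nth zc.
rewrite size_pairs in iL; exists (nth x (x :: c) i).
  by rewrite inE mem_nth // index_uniq // ob eqxx.
by rewrite nth_pairs // next_nth mem_nth // index_uniq.
Qed.
End ListCycle.

Section ToPasted.
Variables (V E : finType) (K : lgraph V E).
Implicit Types (s : seq (E * V * V)).

(** From [y] to [x] the edges of the chain alternate with the visible pairs, beginning and ending
    with an edge. *)
Lemma chain_pairs y s el x g : chain K y s el x ->
  (at_parity false (pairs (y :: cverts s) x) g = (g \in map (kends K) (cedges s el)))
  * (at_parity true (pairs (y :: cverts s) x) g = (g \in cgreens s)).
Proof.
elim: s y => [|[[e p] q] s IH] y.
  by move=> j; rewrite /= !inE orbF (joins_kends j).
rewrite /chain -/chain => /andP[j /IH[H1 H2]].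
rewrite /= in H1 H2 *; rewrite H1 H2 !inE (joins_kends j).
by rewrite eq_sym.
Qed.

Lemma size_cverts s : size (cverts s) = (size s).*2.
Proof. by elim: s => //= -[[e p] q] s IH /=; rewrite IH doubleS. Qed.

Lemma cpar_plain s el : (forall e, e \in cedges s el -> od K e = false) ->
  cpar K s el = odd (size s).
Proof.
elim: s => [|[[e p] q] s IH] /= H; first by rewrite H ?inE.
rewrite H ?inE ?eqxx //= IH // => e' e's; by apply: H; rewrite inE e's orbT.
Qed.

Hypothesis allplain : forall e, plain K e.
Hypothesis alleven : forall e, od K e = false.

(** The list starts with [x] and [y], so the base pair is the green edge at index 0. As no edge is
    odd, [ear_par] makes the number of visible pairs even, [ear_nil] makes it positive, and the
    length is [m * 4 + 2] with [m] positive. *)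
Lemma ear_cycle (W : {set V}) (R : {set E}) (x y : V) s (el : E) : x != y -> x \in W -> y \in W -> ear K W R x y s el ->
  let c := [:: x, y & cverts s] in
  [/\ cycle_2mod4 c, cycle_green c = [set x; y] |: [set g in cgreens s],
      cycle_red c = kends K @: [set e in cedges s el]
    & W :&: [set z in c] = [set x; y]].
Proof.
move=> xy xW yW er c.
have xs : x \notin cverts s by apply/negP => /(ear_new er); rewrite xW.
have ys : y \notin cverts s by apply/negP => /(ear_new er); rewrite yW.
have uc : uniq c by rewrite /c /= !inE negb_or xy xs ys; exact: ear_verts er.
have par := chain_pairs _ (ear_chain er).
split.
- rewrite /cycle_2mod4 uc /c /= size_cverts.
  have := ear_par er; rewrite cpar_plain // => os.
  have sn : s != [::] by apply/eqP => /(ear_nil er); rewrite allplain.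
  have [m mE] : exists m, size s = m.*2 by exists (size s)./2; rewrite -[LHS]odd_double_half os.
  have m1 : 0 < m by case: m mE sn => // /size0nil ->.
  rewrite mE; apply/andP; split; last by rewrite -!muln2; clear -m1; lia.
  have -> : (m.*2).*2.+2 = m * 4 + 2 by clear; lia.
  by rewrite modnMDl.
- apply/setP => g; rewrite /cycle_green cycle_edges_pairs // in_setU1 inE.
  by have [_ <-] := par g.
- apply/setP => g; rewrite /cycle_red cycle_edges_pairs //.
  rewrite -[LHS]/(at_parity false (pairs (y :: cverts s) x) g); have [-> _] := par g.
  apply/mapP/imsetP => -[e es ->]; exists e => //; first by rewrite inE.
  by move: es; rewrite inE.
apply/setP => z; rewrite !inE; apply/andP/orP => [[zW /or3P[->|->|zs]]|[] /eqP ->]; auto.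
- by have := ear_new er zs; rewrite zW.
- by rewrite xW eqxx.
by rewrite yW eqxx orbT.
Qed.

(** The first ear is attached to a bare pair and yields the initial cycle; every later ear is a
    pasting step. *)
Lemma lcactus_pasted W R Gr : lcactus K W R Gr ->
  (exists x y, [/\ x != y, W = [set x; y], R = set0 & Gr = [set [set x; y]]])
  \/ pasted W (kends K @: R) Gr.
Proof.
elim=> {W R Gr} [x y xy|W R Gr x y s el lc IH gxy er]; first by left; exists x, y.
right; have [_ _ Gxy] := lcactus_sub lc; have [xy xW yW] := Gxy x y gxy.
have [cc cg cr cW] := ear_cycle xy xW yW er.
set c := [:: x, y & cverts s] in cc cg cr cW *.
have WE : W :|: [set z in cverts s] = W :|: [set z in c].
  apply/setP => z; rewrite !inE; case: (eqVneq z x) => [->|_]; first by rewrite xW.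
  by case: (eqVneq z y) => [->|_]; first by rewrite yW.
have GE : Gr :|: [set g in cgreens s] = Gr :|: cycle_green c.
  rewrite cg; apply/setP => g; rewrite !inE; case: (eqVneq g [set x; y]) => [->|_] //.
  by rewrite gxy.
rewrite imsetU -cr WE GE.
case: IH => [[x0 [y0 [xy0 W0 R0 G0]]]|pst]; last first.
  apply: (Pasted_step (x := x) (y := y)) => //.
  by rewrite cg setU11.
have gE : [set x; y] = [set x0; y0] by move: gxy; rewrite G0 inE => /eqP.
rewrite R0 imset0 set0U.
have -> : W :|: [set z in c] = [set z in c].
  by apply/setUidPr; rewrite W0 -gE; apply/subsetP => z; rewrite !inE => /orP[] ->; rewrite ?orbT.
have -> : Gr :|: cycle_green c = cycle_green c.
  by apply/setUidPr; rewrite G0 -gE cg sub1set setU11.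
exact: Pasted_cycle.
Qed.
End ToPasted.

(** * From multigraphs to labelled graphs and back *)

Section FromGraph.
Variable G : multigraph.
Hypothesis Gconn : connected_graph G.
Hypothesis Gbridgeless : bridgeless G.

Lemma orient_ends : exists sd : edge G -> vert G * vert G,
  forall e, ends e = [set (sd e).1; (sd e).2].
Proof.
apply: (@fin_all_exists _ (fun=> (vert G * vert G)%type)
  (fun e p => ends e = [set p.1; p.2])) => e.
have /cards2P[x [y [_ E1]]] : #|ends e| == 2 by rewrite card_ends.
by exists (x, y).
Qed.

Definition edge_cut (S : {set vert G}) : {set edge G} :=
  [set e | ~~ (ends e \subset S) && ~~ [disjoint ends e & S]].

Lemma adj_in_sym (F : {set edge G}) : symmetric (adj_in F).
Proof. by move=> x y; rewrite /adj_in /=; apply: eq_existsb => e; rewrite setUC. Qed.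

Lemma closed_of_cut (F : {set edge G}) (S : {set vert G}) : F :&: edge_cut S = set0 ->
  closed (adj_in F) S.
Proof.
move=> cut0; apply: intro_closed; first exact: sym_connect_sym (adj_in_sym F).
move=> x y /existsP[e /andP[eF /eqP eE]] xS; apply: contraT => yS.
have : e \in F :&: edge_cut S.
  rewrite !inE eF /= eE; apply/andP; split.
    by apply/negP => /subsetP /(_ y); rewrite !inE eqxx orbT (negbTE yS) => /(_ isT).
  by rewrite disjoint_sym disjoints_subset; apply/negP => /subsetP /(_ x xS); rewrite !inE eqxx.
by rewrite cut0 inE.
Qed.

Lemma not_connect_of_cut (F : {set edge G}) (S : {set vert G}) x y : F :&: edge_cut S = set0 ->
  x \in S -> y \notin S -> ~~ connect (adj_in F) x y.
Proof.
move=> /closed_of_cut cl xS yS; apply/negP => /(closed_connect cl).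
by rewrite xS (negbTE yS).
Qed.

(** An empty cut contradicts connectedness. If [e] were the only edge of the cut, the graph without
    [e] would have two component roots instead of one, and [e] would be a bridge. *)
Lemma edge_cut_gt1 (S : {set vert G}) : S != set0 -> S != [set: vert G] -> 1 < #|edge_cut S|.
Proof.
case/set0Pn => x xS nT.
have [y yS] : exists y, y \notin S.
  by apply/existsP; apply: contraNT nT => /existsPn H; apply/eqP/setP => y; rewrite inE; have := H y; rewrite negbK.
case: Gconn => _ conn.
have symF (F : {set edge G}) : connect_sym (adj_in F) by apply: sym_connect_sym; apply: adj_in_sym.
rewrite ltnNge; apply/negP; rewrite leq_eqVlt ltnS leqn0 cards_eq0 => /orP[/cards1P[e eE]|/eqP c0]; last first.
  have := not_connect_of_cut (F := [set: edge G]) _ xS yS; rewrite c0 setI0 => /(_ erefl).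
  by rewrite conn.
have nc : ~~ connect (adj_in [set~ e]) x y.
  by apply: not_connect_of_cut xS yS; rewrite eE setIC setICr.
have := Gbridgeless e; rewrite /bridge -leqNgt => le.
have n1 : n_comp (@adj G) (vert G) = 1.
  rewrite -[RHS](n_comp_connect (symF [set: edge G]) x); apply: eq_n_comp_r => z.
  by rewrite inE; exact/esym/conn.
have : #|[set fingraph.root (adj_in [set~ e]) x; fingraph.root (adj_in [set~ e]) y]| <= n_comp (adj_in [set~ e]) (vert G).
  apply: subset_leq_card; apply/subsetP => z; rewrite in_set2 !inE andbT.
  by case/orP => /eqP ->; apply: roots_root; apply: symF.
rewrite cards2 (root_connect (symF _)) nc => le2.
by move: (leq_trans le2 le); rewrite n1.
Qed.
End FromGraph.

Section Translate.
Variable G : multigraph.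
Hypothesis Gconn : connected_graph G.
Hypothesis Gbridgeless : bridgeless G.
Variable A : {set vert G}.
Hypothesis Abip : forall u v : vert G, adj u v -> (u \in A) != (v \in A).
Variable sd : edge G -> vert G * vert G.
Hypothesis sdE : forall e, ends e = [set (sd e).1; (sd e).2].

Definition graph_lgraph : lgraph (vert G) (edge G) :=
  LGraph [set: vert G] [set: edge G] (fun e => (sd e).1) (fun e => (sd e).2)
    (fun=> true) (fun=> false) (fun=> false).
Let K := graph_lgraph.

Lemma graph_cut S : cut K S = edge_cut S.
Proof.
apply/setP => e; rewrite !inE sdE /= disjoint_sym disjoints_subset.
have -> : ([set (sd e).1; (sd e).2] \subset S) = ((sd e).1 \in S) && ((sd e).2 \in S).
  by rewrite subUset !sub1set.
have -> : (S \subset ~: [set (sd e).1; (sd e).2]) = ~~ (((sd e).1 \in S) || ((sd e).2 \in S)).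
  rewrite -disjoints_subset disjoint_sym disjoints_subset subUset !sub1set !inE negb_or //.
by case: (_ \in S); case: (_ \in S).
Qed.

Lemma graph_wf : wf (fun x => x \in A) K.
Proof.
split=> //= [e _|S _ Sn ST].
  by apply: Abip; apply: adj_ends (sdE e).
by rewrite graph_cut; apply: edge_cut_gt1.
Qed.

Lemma graph_thin_inv : thin_inv K.
Proof. by split=> [r _ _ e x y _|_]; [|split=> e f _ _]; rewrite /thin. Qed.

Lemma graph_sm (w : edge G -> bool) x : sm K w x = on_deg w x.
Proof.
rewrite /sm /on_deg; apply: eq_big => e; last by rewrite /va /= addbF.
by rewrite !inE /inc sdE !inE.
Qed.

Lemma graph_kprop : kprop K -> has_property G (pred2 0%R 1%R).
Proof.
case=> w H; apply/has_property01; exists w => u v /existsP[e /andP[_ /eqP eE]].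
have := H e (in_setT e); rewrite /ok /= !graph_sm.
have := sdE e; rewrite eE => /set2_inj[] [-> ->] //.
by rewrite eq_sym.
Qed.

Lemma graph_cactus : is_lcactus K -> odd_multi_cactus G.
Proof.
move=> [R [Gr [lc He Hg]]].
have kE e : kends K e = ends e by rewrite sdE.
have ru := red_unique lc.
have thick_ok : green_thickening (kends K @: R) Gr.
  split.
  - move=> e; rewrite in_setU; case: (He e (in_setT e)) => [eR|/andP[_]].
      by rewrite -kE imset_f.
    by rewrite kE => ->; rewrite orbT.
  - move=> p /imsetP[e eR ->]; have [n1 n2] := ru e eR isT.
    rewrite /multiplicity (_ : [set f | _] = [set e]) ?cards1 //; apply/setP => f; rewrite !inE.
    apply/eqP/eqP => [fE|-> //]; case: (He f (in_setT f)) => [fR|/andP[_ fG]].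
      by apply: n2 => //; rewrite -fE kE.
    by move: n1; rewrite -fE -kE fG.
  move=> g /Hg[e [_ _ _ eE]]; rewrite /multiplicity card_gt0; apply/set0Pn; exists e.
  by rewrite inE -kE eE.
case: (lcactus_pasted (K := K) _ _ lc) => // [[x [y [xy VE R0 G0]]]|pst].
  by right; exists x, y; split=> //; move: thick_ok; rewrite R0 imset0 G0.
by left; exists (kends K @: R), Gr.
Qed.
End Translate.

Theorem theorem3 (G : multigraph) (Gconn : connected_graph G)
  (Gbridgeless : bridgeless G) (Gbip : bipartite G) :
  ~ has_property G (pred2 0%R 1%R) <-> odd_multi_cactus G.
Proof.
split; last exact: cactus_no_property.
move=> nprop; have [A Abip] := Gbip; have [sd sdE] := orient_ends G.
pose K := graph_lgraph sd.
have wfK : wf (fun x => x \in A) K by apply: graph_wf.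
case: (ltnP 1 #|vert G|) => v2.
  have v2' : 1 < #|vs K| by rewrite cardsT.
  case: (kprop_or_reducible wfK (graph_thin_inv sd) v2') => [/(graph_kprop sdE) //|red].
  exact: (graph_cactus sdE (reducible_lcactus red)).
(* With at most one vertex there is no edge, since an edge has two ends, and any weighting is
   good. *)
case: nprop; apply/has_property01; exists (fun=> false) => u v /existsP[e /andP[_ /eqP eE]].
have := card_ends e; have := subset_leq_card (subsetT (ends e)); rewrite cardsT => le1 E2.
by move: (leq_trans le1 v2); rewrite E2.
Qed.
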